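(* Let $0<\varepsilon<1$ and $0<\sigma<2$. If $C>0$ is large enough, then with $b=C\log t$, as $t\to+\infty$, \[ U(t)=\frac{1}{2\pi i}\int_{-b-i\sigma}^{\,b-i\sigma}\Bigl(\frac{t}{2\pi}\Bigr)^{\frac{ix}{2}}\zeta\bigl(\tfrac12+i(t+x)\bigr)\,\frac{\pi}{2\sinh\frac{\pi x}{2}}\,dx+O\bigl(t^{-\frac56+\varepsilon}\bigr), \] the integral being over the horizontal segment from $-b-i\sigma$ to $b-i\sigma$. Moreover, if the Lindelöf hypothesis holds, the error term may be replaced by $O(t^{-1+\varepsilon})$.
   Context: $\vartheta$ is the Riemann–Siegel theta function: the holomorphic function on $\mathbb C\setminus(\{iy:y\ge\frac12\}\cup\{iy:y\le-\frac12\})$ with $\vartheta(0)=0$ and $e^{i\vartheta(t)}=\pi^{-it/2}\sqrt{\Gamma(\frac14+\frac{it}{2})/\Gamma(\frac14-\frac{it}{2})}$. $\zeta$ is the Riemann zeta function. For real $t$, \[ U(t)=\frac{1}{2\pi i}\int_{-i\sigma'-\infty}^{-i\sigma'+\infty} e^{i\vartheta(t+x)-i\vartheta(t)}\,\zeta\bigl(\tfrac12+i(t+x)\bigr)\,\frac{\pi}{2\sinh\frac{\pi x}{2}}\,dx,\qquad 0<\sigma'<\tfrac12, \] which is independent of $\sigma'\in(0,\frac12)$. Here $(t/2\pi)^{ix/2}=\exp(\frac{ix}{2}\log\frac{t}{2\pi})$. The Lindelöf hypothesis is the statement $\zeta(\frac12+it)=O(|t|^{\delta})$ for every $\delta>0$.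 *)

(* Defs.v *)
From Stdlib Require Import Reals.
From Coquelicot Require Import Coquelicot.

Open Scope R_scope.

Definition Cexp (z : C) : C :=
  (exp (Re z) * cos (Im z), exp (Re z) * sin (Im z)).

Definition Carg (w : C) : R :=
  let x := Re w in let y := Im w in
  if Rlt_dec 0 x then atan (y / x)
  else if Rlt_dec x 0 then
         (if Rle_dec 0 y then atan (y / x) + PI else atan (y / x) - PI)
  else if Rlt_dec 0 y then PI / 2
  else if Rlt_dec y 0 then - (PI / 2) else 0.

Definition CLog (w : C) : C := (ln (Cmod w), Carg w).

Definition Rcpow (a : R) (s : C) : C := Cexp (RtoC (ln a) * s)%C.

Definition CSeries (a : nat -> C) : C :=
  (Series (fun n => Re (a n)), Series (fun n => Im (a n))).

Definition Csinh (w : C) : C := ((Cexp w - Cexp (- w)) / 2)%C.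

(** The Riemann zeta function on Re s > 0 (analytic continuation):
    zeta s = 1/(s-1) + sum_{n>=1} ( n^{-s} - int_n^{n+1} x^{-s} dx ). *)
Definition zeta (s : C) : C :=
  (/ (s - 1) +
   CSeries (fun n =>
     let m := INR (S n) in
     Rcpow m (- s) - (Rcpow m (1 - s) - Rcpow (m + 1) (1 - s)) / (s - 1)))%C.

(** Holomorphic log Gamma on Re z > 0 (Euler product with principal logs),
    real on the positive real axis: exp (lnGamma z) = Gamma z. *)
Definition lnGamma (z : C) : C :=
  (- CLog z +
   CSeries (fun n =>
     let k := INR (S n) in
     z * RtoC (ln (1 + / k)) - CLog (1 + z / RtoC k)))%C.

(** Riemann-Siegel theta on the strip |Im z| < 1/2 (the holomorphic function
    with theta 0 = 0 and exp(i theta z) = pi^{-iz/2} sqrt(Gamma(1/4+iz/2)/Gamma(1/4-iz/2))). *)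
Definition theta (z : C) : C :=
  (- (z / 2) * RtoC (ln PI) +
   (lnGamma (/ 4 + Ci * z / 2) - lnGamma (/ 4 - Ci * z / 2)) / (2 * Ci))%C.

Definition U (t : R) : C :=
  (/ (2 * RtoC PI * Ci) *
   @RInt_gen C_R_CompleteNormedModule
     (fun u : R =>
        let x : C := (u, (- / 4)%R) in
        Cexp (Ci * theta (RtoC t + x) - Ci * theta (RtoC t))
        * zeta (/ 2 + Ci * (RtoC t + x))
        * (RtoC PI / (2 * Csinh (RtoC PI * x / 2))))%C
     (Rbar_locally m_infty) (Rbar_locally p_infty))%C.

Definition segment_integral (sigma b t : R) : C :=
  (/ (2 * RtoC PI * Ci) *
   @RInt C_R_CompleteNormedModule
     (fun u : R =>
        let x : C := (u, (- sigma)%R) in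
        Cexp (Ci * x / 2 * RtoC (ln (t / (2 * PI))))
        * zeta (/ 2 + Ci * (RtoC t + x))
        * (RtoC PI / (2 * Csinh (RtoC PI * x / 2))))%C
     (- b) b)%C.

Definition Lindelof_hypothesis : Prop :=
  forall delta : R, 0 < delta ->
    exists K T : R, 0 < T /\
      forall t : R, T <= Rabs t ->
        Cmod (zeta (RtoC (/ 2) + Ci * RtoC t)) <= K * Rpower (Rabs t) delta.

Definition approx_with_error (sigma e : R) : Prop :=
  exists C0 : R, 0 < C0 /\
    forall Cc : R, C0 <= Cc ->
      exists K T : R, 0 < T /\
        forall t : R, T <= t ->
          Cmod (U t - segment_integral sigma (Cc * ln t) t)%C <= K * Rpower t e.

(* Main.v *)
Require Import Defs.
From Stdlib Require Import Reals Lra Lia Psatz ZArith.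
From Coquelicot Require Import Coquelicot.
Open Scope R_scope.
Set Bullet Behavior "Strict Subproofs".

(** On the line [Im x = -1/4] Stirling's formula gives
      [i theta(t+x) - i theta(t) = (ix/2) log(t/2pi) + i x^2/(4t) + O((1+|x|)^3/t^2)],
    so that the integrand of [U] is [g + i x^2/(4t) g + O(t^-1 e^-|x|)], with
    [g(x) = (t/2pi)^(ix/2) zeta(1/2+i(t+x)) pi/(2 sinh(pi x/2))]; the parts with [|Re x| > C log t]
    are negligible.  The main term [g] is moved to the line [Im x = -sigma].  In the correction the
    factor [x^2] cancels the pole of the kernel at [0], hence it can be moved to the real axis, where
    it is bounded by [1/t] times the size of zeta on the critical line near height [t].
    That size is [O(t^(1/6+eps))] (Weyl, by van der Corput's differencing) and [O(t^eps)] under the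
    Lindelof hypothesis.  Holomorphy of zeta is never needed: the contours are moved for the explicit
    finite approximations of zeta, which converge uniformly on segments. *)

(** * Finite sums and differentiation of complex-valued functions *)

(** On the line [Im x = -1/4], where [Re s = 3/4], the power of t has size t^(1/8) and zeta is
    bounded here only by a multiple of sqrt t. A first-order expansion of theta, with relative error
    1/t, would therefore leave an error far above t^(-5/6). The second-order remainder, of relative
    size t^(-2), tolerates the crude bound sqrt t for both factors and still gives 1/t; only the
    term of relative size 1/t has to be estimated sharply, and this is done where the power of t has
    modulus 1. Moving a line downwards increases [Re s]. The poles to be avoided are x = 0 and x =
    -2i of the kernel, whence 0 < sigma < 2, and x = -t - i/2 of zeta, which is out of reach while b
    <= t/4. Both claims are instances of one statement: a bound t^(kappa+delta) on the critical line
    gives the error t^(-1+kappa+eps), with kappa = 1/6 or 0. The size of C comes from the crude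
    bounds: C >= 4 gives e^(-b) <= t^(-4), enough against the factor t^3 in the tails of [U] and t^2
    on the vertical edges. *)

Fixpoint csum (f : nat -> C) (n : nat) : C :=
  match n with O => RtoC 0 | S k => (csum f k + f k)%C end.

Fixpoint rsum (f : nat -> R) (n : nat) : R :=
  match n with O => 0 | S k => rsum f k + f k end.

Lemma rsum_S (f : nat -> R) (n : nat) : rsum f (S n) = rsum f n + f n.
Proof. reflexivity. Qed.

Lemma csum_S (f : nat -> C) (n : nat) : csum f (S n) = (csum f n + f n)%C.
Proof. reflexivity. Qed.

Lemma csum_ext (f g : nat -> C) (n : nat) :
  (forall k, (k < n)%nat -> f k = g k) -> csum f n = csum g n.
Proof.
  induction n as [|n IH]; intros H; [reflexivity|]; simpl.
  rewrite IH, H; auto.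
Qed.

Lemma csum_plus (f g : nat -> C) (n : nat) :
  csum (fun k => f k + g k)%C n = (csum f n + csum g n)%C.
Proof. induction n as [|n IH]; simpl; [ring|rewrite IH; ring]. Qed.

Lemma csum_minus (f g : nat -> C) (n : nat) :
  csum (fun k => f k - g k)%C n = (csum f n - csum g n)%C.
Proof. induction n as [|n IH]; simpl; [ring|rewrite IH; ring]. Qed.

Lemma csum_scal (c : C) (f : nat -> C) (n : nat) :
  csum (fun k => c * f k)%C n = (c * csum f n)%C.
Proof. induction n as [|n IH]; simpl; [ring|rewrite IH; ring]. Qed.

Lemma csum_add (f : nat -> C) (n m : nat) :
  csum f (n + m) = (csum f n + csum (fun k => f (n + k)%nat) m)%C.
Proof.
  induction m as [|m IH]; [rewrite Nat.add_0_r; simpl; ring|].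
  rewrite Nat.add_succ_r; simpl; rewrite IH; ring.
Qed.

Lemma csum_exchange (f : nat -> nat -> C) (n m : nat) :
  csum (fun i => csum (fun j => f i j) m) n = csum (fun j => csum (fun i => f i j) n) m.
Proof.
  induction n as [|n IH]; simpl.
  - induction m as [|m IH]; simpl; [reflexivity|rewrite <- IH; ring].
  - rewrite IH, <- csum_plus; reflexivity.
Qed.

Lemma csum_conj (f : nat -> C) (n : nat) :
  Cconj (csum f n) = csum (fun k => Cconj (f k)) n.
Proof.
  induction n as [|n IH]; simpl.
  - unfold Cconj, RtoC; simpl; f_equal; ring.
  - rewrite Cplus_conj, IH; reflexivity.
Qed.

Lemma csum_telescope (f : nat -> C) (n : nat) :
  csum (fun k => f (S k) - f k)%C n = (f n - f 0%nat)%C.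
Proof. induction n as [|n IH]; simpl; [ring|rewrite IH; ring]. Qed.

Lemma rsum_telescope (f : nat -> R) (n : nat) :
  rsum (fun k => f (S k) - f k) n = f n - f 0%nat.
Proof. induction n as [|n IH]; simpl; [ring|rewrite IH; ring]. Qed.

Lemma rsum_le (f g : nat -> R) (n : nat) :
  (forall k, (k < n)%nat -> f k <= g k) -> rsum f n <= rsum g n.
Proof.
  induction n as [|n IH]; intros H; simpl; [lra|].
  assert (f n <= g n) by auto. assert (rsum f n <= rsum g n) by auto. lra.
Qed.

Lemma rsum_ext (f g : nat -> R) (n : nat) :
  (forall k, (k < n)%nat -> f k = g k) -> rsum f n = rsum g n.
Proof.
  induction n as [|n IH]; intros H; [reflexivity|]; simpl.
  rewrite IH, H; auto.
Qed.

Lemma rsum_plus (f g : nat -> R) (n : nat) :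
  rsum (fun k => f k + g k) n = rsum f n + rsum g n.
Proof. induction n as [|n IH]; simpl; [ring|rewrite IH; ring]. Qed.

Lemma rsum_scal (c : R) (f : nat -> R) (n : nat) :
  rsum (fun k => c * f k) n = c * rsum f n.
Proof. induction n as [|n IH]; simpl; [ring|rewrite IH; ring]. Qed.

Lemma rsum_const (c : R) (n : nat) : rsum (fun _ => c) n = INR n * c.
Proof.
  induction n as [|n IH]; [simpl; ring|].
  rewrite S_INR. simpl rsum. rewrite IH; ring.
Qed.

Lemma rsum_add (f : nat -> R) (n m : nat) :
  rsum f (n + m) = rsum f n + rsum (fun k => f (n + k)%nat) m.
Proof.
  induction m as [|m IH]; [rewrite Nat.add_0_r; simpl; ring|].
  rewrite Nat.add_succ_r; simpl; rewrite IH; ring.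
Qed.

Lemma rsum_pos (f : nat -> R) (n : nat) :
  (forall k, (k < n)%nat -> 0 <= f k) -> 0 <= rsum f n.
Proof.
  intros H. apply Rle_trans with (rsum (fun _ => 0) n).
  - rewrite rsum_const; lra.
  - apply rsum_le; auto.
Qed.

Lemma rsum_incr (f : nat -> R) (n m : nat) :
  (n <= m)%nat -> (forall k, 0 <= f k) -> rsum f n <= rsum f m.
Proof.
  intros H H0. replace m with (n + (m - n))%nat by lia. rewrite rsum_add.
  assert (0 <= rsum (fun k => f (n + k)%nat) (m - n)) by (apply rsum_pos; auto). lra.
Qed.

Lemma Cmod_csum_le (f : nat -> C) (g : nat -> R) (n : nat) :
  (forall k, (k < n)%nat -> Cmod (f k) <= g k) -> Cmod (csum f n) <= rsum g n.
Proof.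
  induction n as [|n IH]; intros H; simpl; [rewrite Cmod_0; lra|].
  eapply Rle_trans; [apply Cmod_triangle|]. apply Rplus_le_compat; auto.
Qed.

(** The sum of (c - f k)^2 is nonnegative for every c; it is a quadratic in c, and its value at the
    mean of f is the inequality. *)
Lemma rsum_cauchy_schwarz (f : nat -> R) (n : nat) :
  (rsum f n) ^ 2 <= INR n * rsum (fun k => f k ^ 2) n.
Proof.
  assert (H : forall c, 0 <= c * c * INR n - 2 * c * rsum f n + rsum (fun k => f k ^ 2) n).
  { intros c. induction n as [|n IH]; [simpl; lra|].
    rewrite S_INR, !rsum_S. assert (0 <= (c - f n) ^ 2) by apply pow2_ge_0.
    match goal with |- 0 <= ?a => replace a with ((c * c * INR n - 2 * c * rsum f n + rsum (fun k => f k ^ 2) n) + (c - f n) ^ 2) by ring end. lra. }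
  destruct n as [|n]; [simpl; lra|].
  assert (Hn : 0 < INR (S n)) by (apply lt_0_INR; lia).
  set (S1 := rsum f (S n)) in *. set (S2 := rsum (fun k => f k ^ 2) (S n)) in *.
  specialize (H (S1 / INR (S n))).
  replace (S1 / INR (S n) * (S1 / INR (S n)) * INR (S n) - 2 * (S1 / INR (S n)) * S1 + S2)
    with (S2 - S1 ^ 2 / INR (S n)) in H by (field; lra).
  apply Rmult_le_reg_l with (/ INR (S n)); [apply Rinv_0_lt_compat; lra|].
  replace (/ INR (S n) * (INR (S n) * S2)) with S2 by (field; lra).
  unfold Rdiv in H. lra.
Qed.

Lemma Cmod_minus_le (z w : C) : Cmod (z - w) <= Cmod z + Cmod w.
Proof. unfold Cminus. eapply Rle_trans; [apply Cmod_triangle|]. rewrite Cmod_opp; lra. Qed.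

Lemma Cmod_minus_ge (z w : C) : Cmod z - Cmod w <= Cmod (z - w).
Proof.
  assert (H := Cmod_triangle (z - w) w). replace (z - w + w)%C with z in H by ring. lra.
Qed.

Lemma Cmod_minus_sym (z w : C) : Cmod (z - w) = Cmod (w - z).
Proof. rewrite <- Cmod_opp. f_equal. ring. Qed.

Lemma Im_le_Cmod (z : C) : Rabs (Im z) <= Cmod z.
Proof. eapply Rle_trans; [|apply Rmax_Cmod]. apply Rmax_r. Qed.

Lemma Re_le_Cmod (z : C) : Re z <= Cmod z.
Proof. eapply Rle_trans; [apply Rle_abs|apply re_le_Cmod]. Qed.

Lemma Cmod_le_Re_Im (z : C) : Cmod z <= Rabs (Re z) + Rabs (Im z).
Proof.
  destruct z as [a b]. simpl.
  assert (E : (a, b) = (RtoC a + Ci * RtoC b)%C)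
    by (unfold Ci, RtoC, Cplus, Cmult; simpl; f_equal; ring).
  rewrite E. eapply Rle_trans; [apply Cmod_triangle|].
  rewrite Cmod_mult, Cmod_Ci, !Cmod_R. lra.
Qed.

(** Componentwise, so that real derivatives do the work. Complex differentiation enters later only
    through derivatives along horizontal and vertical lines. *)
Definition cder (f : R -> C) (x : R) (l : C) : Prop :=
  is_derive (fun r => Re (f r)) x (Re l) /\ is_derive (fun r => Im (f r)) x (Im l).

Lemma is_derive_eq (f : R -> R) (x l l' : R) : is_derive f x l -> l = l' -> is_derive f x l'.
Proof. intros H ->; exact H. Qed.

Lemma is_derive_mult_R (f g : R -> R) (x a b : R) :
  is_derive f x a -> is_derive g x b -> is_derive (fun r => f r * g r) x (a * g x + f x * b).
Proof. intros Hf Hg. apply (is_derive_mult f g x a b Hf Hg). intros; apply Rmult_comm. Qed.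

Lemma is_derive_plus_R (f g : R -> R) (x a b : R) :
  is_derive f x a -> is_derive g x b -> is_derive (fun r => f r + g r) x (a + b).
Proof. intros Hf Hg. apply (is_derive_plus f g x a b Hf Hg). Qed.

Lemma is_derive_minus_R (f g : R -> R) (x a b : R) :
  is_derive f x a -> is_derive g x b -> is_derive (fun r => f r - g r) x (a - b).
Proof. intros Hf Hg. apply (is_derive_minus f g x a b Hf Hg). Qed.

Lemma is_derive_comp_R (f g : R -> R) (x a b : R) :
  is_derive f (g x) a -> is_derive g x b -> is_derive (fun r => f (g r)) x (b * a).
Proof. intros Hf Hg. apply (is_derive_comp f g x a b Hf Hg). Qed.

Lemma cder_eq (f : R -> C) (x : R) (l l' : C) : cder f x l -> l = l' -> cder f x l'.
Proof. intros H ->; exact H. Qed.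

Lemma cder_ext (f g : R -> C) (x : R) (l : C) :
  (forall r, f r = g r) -> cder f x l -> cder g x l.
Proof.
  intros H [H1 H2]; split.
  - apply (is_derive_ext (fun r => Re (f r))); [intros; rewrite H; auto|auto].
  - apply (is_derive_ext (fun r => Im (f r))); [intros; rewrite H; auto|auto].
Qed.

Lemma cder_const (c : C) (x : R) : cder (fun _ => c) x 0%C.
Proof. split; apply @is_derive_const. Qed.

Lemma cder_plus (f g : R -> C) (x : R) (a b : C) :
  cder f x a -> cder g x b -> cder (fun r => f r + g r)%C x (a + b)%C.
Proof. intros [H1 H2] [H3 H4]; split; apply is_derive_plus_R; auto. Qed.

Lemma cder_minus (f g : R -> C) (x : R) (a b : C) :
  cder f x a -> cder g x b -> cder (fun r => f r - g r)%C x (a - b)%C.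
Proof.
  intros [H1 H2] [H3 H4]; split; apply is_derive_minus_R; auto.
Qed.

Lemma cder_mult (f g : R -> C) (x : R) (a b : C) :
  cder f x a -> cder g x b -> cder (fun r => f r * g r)%C x (a * g x + f x * b)%C.
Proof.
  intros [H1 H2] [H3 H4]; split.
  - eapply is_derive_eq.
    + simpl. apply is_derive_minus_R; apply is_derive_mult_R; eassumption.
    + unfold Re, Im; simpl; ring.
  - eapply is_derive_eq.
    + simpl. apply is_derive_plus_R; apply is_derive_mult_R; eassumption.
    + unfold Re, Im; simpl; ring.
Qed.

Lemma cder_RtoC (f : R -> R) (x l : R) : is_derive f x l -> cder (fun r => RtoC (f r)) x (RtoC l).
Proof. intros H; split; simpl; [exact H|apply @is_derive_const]. Qed.

Lemma cder_id (x : R) : cder (fun r => RtoC r) x (RtoC 1).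
Proof. apply cder_RtoC. apply @is_derive_id. Qed.

Lemma cder_pair (f g : R -> R) (x a b : R) :
  is_derive f x a -> is_derive g x b -> cder (fun r => (f r, g r)) x (a, b).
Proof. split; assumption. Qed.

Lemma cder_exp (f : R -> C) (x : R) (l : C) :
  cder f x l -> cder (fun r => Cexp (f r)) x (l * Cexp (f x))%C.
Proof.
  intros [H1 H2].
  assert (He : is_derive (fun r => exp (Re (f r))) x (Re l * exp (Re (f x)))).
  { apply is_derive_comp_R; [apply is_derive_exp|exact H1]. }
  split; unfold Cexp; simpl.
  - eapply is_derive_eq.
    + apply is_derive_mult_R; [exact He|]. apply is_derive_comp_R; [apply is_derive_cos|exact H2].
    + unfold Re, Im; simpl; ring.
  - eapply is_derive_eq.
    + apply is_derive_mult_R; [exact He|]. apply is_derive_comp_R; [apply is_derive_sin|exact H2].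
    + unfold Re, Im; simpl; ring.
Qed.

Lemma Csqmod_pos (z : C) : z <> 0%C -> 0 < Re z ^ 2 + Im z ^ 2.
Proof.
  intros H. rewrite <- Cmod2_alt. apply pow_lt. apply Cmod_gt_0; exact H.
Qed.

Lemma cder_inv (f : R -> C) (x : R) (l : C) :
  f x <> 0%C -> cder f x l -> cder (fun r => / f r)%C x (- l / (f x * f x))%C.
Proof.
  intros Hn [H1 H2]. assert (Hp := Csqmod_pos _ Hn).
  assert (Hd : is_derive (fun r => / (Re (f r) ^ 2 + Im (f r) ^ 2)) x
     (- (2 * Re (f x) * Re l + 2 * Im (f x) * Im l) / (Re (f x) ^ 2 + Im (f x) ^ 2) ^ 2)).
  { apply (is_derive_inv (fun r => Re (f r) ^ 2 + Im (f r) ^ 2) x (2 * Re (f x) * Re l + 2 * Im (f x) * Im l)); [|lra].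
    apply (is_derive_ext (fun r => Re (f r) * Re (f r) + Im (f r) * Im (f r))); [intros; simpl; ring|].
    eapply is_derive_eq.
    + apply is_derive_plus_R; apply is_derive_mult_R; eassumption.
    + cbv beta; ring. }
  destruct (f x) as [a b] eqn:E. destruct l as [p q].
  unfold Re, Im in *; simpl fst in *; simpl snd in *.
  assert (Hq : (a * a - b * b) ^ 2 + (a * b + b * a) ^ 2 <> 0).
  { replace ((a * a - b * b) ^ 2 + (a * b + b * a) ^ 2) with ((a ^ 2 + b ^ 2) ^ 2) by ring.
    apply pow_nonzero; lra. }
  split; unfold Re, Im, Cinv; simpl fst; simpl snd.
  - eapply is_derive_eq.
    + unfold Rdiv. apply is_derive_mult_R; [exact H1|exact Hd].
    + cbv beta; rewrite ?E; simpl fst; simpl snd. field. split; intro HH; [lra|apply Hq; nra].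
  - eapply is_derive_eq.
    + unfold Rdiv. apply is_derive_mult_R; [|exact Hd].
      apply @is_derive_opp. exact H2.
    + cbv beta; rewrite ?E; simpl fst; simpl snd. unfold opp; simpl. field. split; intro HH; [lra|apply Hq; nra].
Qed.

Lemma CLog_Re_pos (z : C) : 0 < Re z -> CLog z = (ln (Re z ^ 2 + Im z ^ 2) / 2, atan (Im z / Re z)).
Proof.
  intros H. unfold CLog, Carg. destruct (Rlt_dec 0 (Re z)) as [_|n]; [|contradiction].
  f_equal. assert (Hp : 0 < Re z ^ 2 + Im z ^ 2) by nra.
  rewrite <- Cmod2_alt in *. assert (0 < Cmod z) by (assert (H0 := Cmod_ge_0 z); nra).
  rewrite ln_pow by assumption. simpl INR. field.
Qed.

(** On [Re > 0] the argument [Carg] is a single arctangent; continuity spreads this condition to a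
    neighbourhood, where both components can be differentiated. *)
Lemma cder_log (f : R -> C) (x : R) (l : C) :
  0 < Re (f x) -> cder f x l -> cder (fun r => CLog (f r)) x (l / f x)%C.
Proof.
  intros Hp [H1 H2].
  assert (Hc : locally x (fun r => 0 < Re (f r))).
  { assert (Hc : continuous (fun r => Re (f r)) x) by (apply (ex_derive_continuous (fun r => Re (f r)) x); exists (Re l); exact H1).
    apply (Hc (fun y => 0 < y)). apply (open_gt 0 (Re (f x)) Hp). }
  assert (Hs : 0 < Re (f x) ^ 2 + Im (f x) ^ 2) by nra.
  split.
  - apply (is_derive_ext_loc (fun r => / 2 * ln (Re (f r) * Re (f r) + Im (f r) * Im (f r)))).
    { apply (filter_imp (fun r => 0 < Re (f r))); [|exact Hc]. intros r Hr. rewrite (CLog_Re_pos (f r) Hr).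
      unfold Re at 3; simpl fst. unfold Rdiv. rewrite Rmult_comm. f_equal. f_equal. ring. }
    eapply is_derive_eq.
    + apply is_derive_mult_R; [apply @is_derive_const|].
      apply is_derive_comp_R.
      * apply is_derive_ln. nra.
      * apply is_derive_plus_R; apply is_derive_mult_R; eassumption.
    + unfold Re, Im in *; simpl. unfold zero; simpl. field. simpl in Hs. nra.
  - apply (is_derive_ext_loc (fun r => atan (Im (f r) * / Re (f r)))).
    { apply (filter_imp (fun r => 0 < Re (f r))); [|exact Hc]. intros r Hr. rewrite (CLog_Re_pos (f r) Hr). reflexivity. }
    eapply is_derive_eq.
    + apply is_derive_comp_R; [apply is_derive_atan|].
      apply is_derive_mult_R; [exact H2|]. apply (is_derive_inv (fun r => Re (f r)) x (Re l)); [exact H1|lra].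
    + unfold Re, Im in *; simpl. unfold Rsqr. field. repeat split; try lra; simpl in Hs; nra.
Qed.

Lemma incr_of_derive_nonneg (f f' : R -> R) (a b : R) :
  a <= b -> (forall x, a <= x <= b -> is_derive f x (f' x)) ->
  (forall x, a <= x <= b -> 0 <= f' x) -> f a <= f b.
Proof.
  intros Hab Hd Hp.
  destruct (MVT_gen f a b f') as [c [Hc E]].
  - intros x Hx. rewrite Rmin_left, Rmax_right in Hx by lra. apply Hd; lra.
  - intros x Hx. rewrite Rmin_left, Rmax_right in Hx by lra.
    apply continuity_pt_filterlim. apply (ex_derive_continuous f x). exists (f' x). apply Hd; lra.
  - rewrite Rmin_left, Rmax_right in Hc by lra. specialize (Hp c Hc). nra.
Qed.

Lemma Cmod_sq (z : C) : Cmod z * Cmod z = Re z * Re z + Im z * Im z.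
Proof. assert (H := Cmod2_alt z). simpl in H. rewrite !Rmult_1_r in H. exact H. Qed.

Lemma Re_conj_mult_le (w z : C) : Re w * Re z + Im w * Im z <= Cmod w * Cmod z.
Proof.
  assert (H := Re_le_Cmod (Cconj w * z)). rewrite Cmod_mult, Cmod_conj in H.
  unfold Cconj, Cmult, Re, Im in *; simpl in H. lra.
Qed.

(* The mean value inequality is proved on the real function [Re (conj w * f)], [w = f b - f a]. *)
Lemma cder_mvi (f f' : R -> C) (g g' : R -> R) (a b : R) :
  a <= b -> (forall x, a <= x <= b -> cder f x (f' x)) ->
  (forall x, a <= x <= b -> is_derive g x (g' x)) ->
  (forall x, a <= x <= b -> Cmod (f' x) <= g' x) -> Cmod (f b - f a) <= g b - g a.
Proof.
  intros Hab Hf Hg Hle.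
  set (w := (f b - f a)%C).
  assert (Hm : g a <= g b).
  { apply (incr_of_derive_nonneg g g'); auto. intros x Hx.
    eapply Rle_trans; [apply Cmod_ge_0|apply Hle; auto]. }
  assert (Hk : Cmod w * g a - (Re w * Re (f a) + Im w * Im (f a))
               <= Cmod w * g b - (Re w * Re (f b) + Im w * Im (f b))).
  { apply (incr_of_derive_nonneg (fun x => Cmod w * g x - (Re w * Re (f x) + Im w * Im (f x)))
             (fun x => Cmod w * g' x - (Re w * Re (f' x) + Im w * Im (f' x)))); auto.
    - intros x Hx. destruct (Hf x Hx) as [H1 H2].
      eapply is_derive_eq.
      + apply is_derive_minus_R; [|apply is_derive_plus_R];
          (apply is_derive_mult_R; [apply @is_derive_const|]); eauto.
      + unfold zero; simpl; ring.
    - intros x Hx. assert (H := Re_conj_mult_le w (f' x)). specialize (Hle x Hx).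
      assert (H0 := Cmod_ge_0 w). nra. }
  assert (Hw : Re w * Re w + Im w * Im w <= Cmod w * (g b - g a)).
  { unfold w in *; unfold Cminus, Cplus, Copp, Re, Im in *; simpl in *. nra. }
  rewrite <- Cmod_sq in Hw.
  assert (H0 := Cmod_ge_0 w). destruct (Rle_lt_or_eq_dec 0 (Cmod w) H0) as [Hp|Hp].
  - apply Rmult_le_reg_l with (Cmod w); auto.
  - lra.
Qed.

(** * Exponential and principal logarithm: Taylor bounds *)

Lemma Cexp_plus (z w : C) : Cexp (z + w) = (Cexp z * Cexp w)%C.
Proof.
  unfold Cexp, Cmult, Cplus, Re, Im; simpl.
  rewrite exp_plus, cos_plus, sin_plus. f_equal; ring.
Qed.

Lemma Cexp_0 : Cexp 0 = 1%C.
Proof. unfold Cexp, RtoC; simpl. rewrite exp_0, cos_0, sin_0. f_equal; ring. Qed.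

Lemma Cmod_Cexp (z : C) : Cmod (Cexp z) = exp (Re z).
Proof.
  unfold Cexp, Cmod; simpl.
  replace (exp (Re z) * cos (Im z) * (exp (Re z) * cos (Im z) * 1) +
    exp (Re z) * sin (Im z) * (exp (Re z) * sin (Im z) * 1))
    with (Rsqr (exp (Re z)) * (Rsqr (sin (Im z)) + Rsqr (cos (Im z)))) by (unfold Rsqr; ring).
  rewrite sin2_cos2, Rmult_1_r. apply sqrt_Rsqr. left; apply exp_pos.
Qed.

Lemma Cexp_neq_0 (z : C) : Cexp z <> 0%C.
Proof. apply Cmod_gt_0. rewrite Cmod_Cexp. apply exp_pos. Qed.

Lemma Cexp_opp (z : C) : Cexp (- z) = (/ Cexp z)%C.
Proof.
  assert (H := Cexp_neq_0 z).
  replace (/ Cexp z)%C with (Cexp (- z) * Cexp z * / Cexp z)%C; [field; auto|].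
  rewrite <- Cexp_plus. replace (- z + z)%C with (RtoC 0) by ring. rewrite Cexp_0. ring.
Qed.

(** The mean value inequality along r w, 0 <= r <= 1, against a linear majorant. The other Taylor
    bounds below are obtained in the same way. *)
Lemma Cexp_minus_one_le (w : C) : Cmod (Cexp w - 1) <= Cmod w * exp (Cmod w).
Proof.
  replace (Cexp w - 1)%C with (Cexp (RtoC 1 * w) - Cexp (RtoC 0 * w))%C
    by (rewrite Cmult_0_l, Cmult_1_l, Cexp_0; ring).
  replace (Cmod w * exp (Cmod w)) with (1 * (Cmod w * exp (Cmod w)) - 0 * (Cmod w * exp (Cmod w))) by ring.
  apply (cder_mvi (fun r => Cexp (RtoC r * w)) (fun r => w * Cexp (RtoC r * w))%C
           (fun r => r * (Cmod w * exp (Cmod w))) (fun _ => Cmod w * exp (Cmod w))); [lra| | |].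
  - intros x _. eapply cder_eq.
    + apply cder_exp. apply cder_mult; [apply cder_id|apply cder_const].
    + cbv beta; ring.
  - intros x _. auto_derive; auto. ring.
  - intros x Hx. rewrite Cmod_mult, Cmod_Cexp. apply Rmult_le_compat_l; [apply Cmod_ge_0|].
    assert (H : Re (RtoC x * w) <= Cmod w).
    { eapply Rle_trans; [apply Re_le_Cmod|]. rewrite Cmod_mult, Cmod_R, Rabs_pos_eq by lra.
      assert (H0 := Cmod_ge_0 w). nra. }
    destruct H as [H|H]; [left; apply exp_increasing; auto|rewrite H; lra].
Qed.

Lemma exp_le (x y : R) : x <= y -> exp x <= exp y.
Proof. intros [H|H]; [left; apply exp_increasing; auto|rewrite H; lra]. Qed.

Lemma Cexp_taylor1 (w : C) : Cmod (Cexp w - 1 - w) <= Cmod w ^ 2 * exp (Cmod w).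
Proof.
  set (M := Cmod w ^ 2 * exp (Cmod w)).
  replace (Cexp w - 1 - w)%C with ((Cexp (RtoC 1 * w) - RtoC 1 * w) - (Cexp (RtoC 0 * w) - RtoC 0 * w))%C
    by (rewrite Cmult_0_l, Cmult_1_l, Cexp_0; ring).
  replace M with (1 * M - 0 * M) by ring.
  apply (cder_mvi (fun r => Cexp (RtoC r * w) - RtoC r * w)%C (fun r => w * (Cexp (RtoC r * w) - 1))%C
           (fun r => r * M) (fun _ => M)); [lra| | |].
  - intros x _. eapply cder_eq.
    + apply cder_minus; [apply cder_exp|]; (apply cder_mult; [apply cder_id|apply cder_const]).
    + cbv beta; ring.
  - intros x _. auto_derive; auto. ring.
  - intros x Hx. rewrite Cmod_mult. unfold M.
    replace (Cmod w ^ 2 * exp (Cmod w)) with (Cmod w * (Cmod w * exp (Cmod w))) by ring.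
    apply Rmult_le_compat_l; [apply Cmod_ge_0|].
    eapply Rle_trans; [apply Cexp_minus_one_le|].
    assert (H0 := Cmod_ge_0 w).
    assert (H : Cmod (RtoC x * w) <= Cmod w) by (rewrite Cmod_mult, Cmod_R, Rabs_pos_eq by lra; nra).
    apply Rmult_le_compat; [apply Cmod_ge_0|left; apply exp_pos|exact H|apply exp_le; exact H].
Qed.

Lemma CLog_1 : CLog 1 = 0%C.
Proof.
  rewrite CLog_Re_pos by (simpl; lra). unfold RtoC; simpl.
  replace (1 * (1 * 1) + 0 * (0 * 1)) with 1 by ring. rewrite ln_1.
  replace (0 / 1) with 0 by field. rewrite atan_0. f_equal; field.
Qed.

Lemma Re_ge_opp_Cmod (z : C) : - Cmod z <= Re z.
Proof. assert (H := re_le_Cmod z). assert (H0 := Rle_abs (- Re z)). rewrite Rabs_Ropp in H0. lra. Qed.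

Lemma Re_one_plus (w : C) (r : R) : Cmod w <= / 2 -> 0 <= r <= 1 -> / 2 <= Re (1 + RtoC r * w).
Proof.
  intros Hw Hr. assert (H := Re_ge_opp_Cmod (RtoC r * w)).
  rewrite Cmod_mult, Cmod_R, Rabs_pos_eq in H by lra.
  rewrite re_plus. replace (Re 1) with 1 by reflexivity.
  assert (H0 := Cmod_ge_0 w). nra.
Qed.

Lemma Cmod_one_plus_ge (w : C) (r : R) : Cmod w <= / 2 -> 0 <= r <= 1 -> / 2 <= Cmod (1 + RtoC r * w).
Proof. intros. eapply Rle_trans; [apply Re_one_plus; eauto|apply Re_le_Cmod]. Qed.

Lemma Cmod_inv_le (z : C) (c : R) : 0 < c -> c <= Cmod z -> Cmod (/ z) <= / c.
Proof.
  intros Hc H. rewrite Cmod_inv by (apply Cmod_gt_0; lra).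
  apply Rinv_le_contravar; auto.
Qed.

Lemma Cmod_ge_neq_0 (z : C) (c : R) : 0 < c -> c <= Cmod z -> z <> 0%C.
Proof. intros Hc H. apply Cmod_gt_0; lra. Qed.

(** Along r w the remainder has derivative -r w^2/(1 + r w), and |w| <= 1/2 keeps |1 + r w| above
    1/2; the majorant 2 r |w|^2 integrates to |w|^2. *)
Lemma CLog_taylor1 (w : C) : Cmod w <= / 2 -> Cmod (CLog (1 + w) - w) <= Cmod w ^ 2.
Proof.
  intros Hw. set (M := 2 * Cmod w ^ 2).
  replace (CLog (1 + w) - w)%C with ((CLog (1 + RtoC 1 * w) - RtoC 1 * w) - (CLog (1 + RtoC 0 * w) - RtoC 0 * w))%C
    by (rewrite Cmult_0_l, Cmult_1_l, Cplus_0_r, CLog_1; ring).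
  replace (Cmod w ^ 2) with (1 ^ 2 * M / 2 - 0 ^ 2 * M / 2) by (unfold M; field).
  apply (cder_mvi (fun r => CLog (1 + RtoC r * w) - RtoC r * w)%C
           (fun r => - RtoC r * (w * w) / (1 + RtoC r * w))%C
           (fun r => r ^ 2 * M / 2) (fun r => r * M)); [lra| | |].
  - intros x Hx. assert (Hn := Cmod_ge_neq_0 _ (/ 2) ltac:(lra) (Cmod_one_plus_ge w x Hw Hx)).
    eapply cder_eq.
    + apply cder_minus; [apply cder_log; [assert (H := Re_one_plus w x Hw Hx); lra|
        apply cder_plus; [apply cder_const|]]|]; (apply cder_mult; [apply cder_id|apply cder_const]).
    + cbv beta. field. exact Hn.
  - intros x _. auto_derive; auto. field.
  - intros x Hx. unfold Cdiv. rewrite !Cmod_mult, Cmod_opp, Cmod_R, Rabs_pos_eq by lra.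
    assert (H := Cmod_inv_le _ (/ 2) ltac:(lra) (Cmod_one_plus_ge w x Hw Hx)).
    rewrite Rinv_inv in H. unfold M.
    replace (x * (2 * Cmod w ^ 2)) with (x * (Cmod w * Cmod w) * 2) by ring.
    apply Rmult_le_compat_l; [|exact H]. assert (H0 := Cmod_ge_0 w). nra.
Qed.

(** Here the derivative is r^2 w^3/(1 + r w), which gives 2/3 of the stated bound. *)
Lemma CLog_taylor2 (w : C) : Cmod w <= / 2 -> Cmod (CLog (1 + w) - w + w * w / 2) <= Cmod w ^ 3.
Proof.
  intros Hw. set (M := 2 * Cmod w ^ 3).
  replace (CLog (1 + w) - w + w * w / 2)%C with
   ((CLog (1 + RtoC 1 * w) - RtoC 1 * w + RtoC 1 * RtoC 1 * (w * w / 2))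
     - (CLog (1 + RtoC 0 * w) - RtoC 0 * w + RtoC 0 * RtoC 0 * (w * w / 2)))%C
    by (rewrite !Cmult_0_l, !Cmult_1_l, !Cplus_0_r, CLog_1; ring).
  apply Rle_trans with (1 ^ 3 * M / 3 - 0 ^ 3 * M / 3);
    [|unfold M; assert (0 <= Cmod w ^ 3) by (apply pow_le, Cmod_ge_0); lra].
  apply (cder_mvi (fun r => CLog (1 + RtoC r * w) - RtoC r * w + RtoC r * RtoC r * (w * w / 2))%C
           (fun r => RtoC r * RtoC r * (w * (w * w)) / (1 + RtoC r * w))%C
           (fun r => r ^ 3 * M / 3) (fun r => r * r * M)); [lra| | |].
  - intros x Hx. assert (Hn := Cmod_ge_neq_0 _ (/ 2) ltac:(lra) (Cmod_one_plus_ge w x Hw Hx)).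
    eapply cder_eq.
    + apply cder_plus; [apply cder_minus; [apply cder_log; [assert (H := Re_one_plus w x Hw Hx); lra|
        apply cder_plus; [apply cder_const|]]|]|]; (apply cder_mult; [|apply cder_const]);
        try apply cder_id. apply cder_mult; apply cder_id.
    + cbv beta. field. exact Hn.
  - intros x _. auto_derive; auto. field.
  - intros x Hx. unfold Cdiv. rewrite !Cmod_mult, !Cmod_R, !Rabs_pos_eq by lra.
    assert (H := Cmod_inv_le _ (/ 2) ltac:(lra) (Cmod_one_plus_ge w x Hw Hx)).
    rewrite Rinv_inv in H. unfold M.
    replace (x * x * (2 * Cmod w ^ 3)) with (x * x * (Cmod w * (Cmod w * Cmod w)) * 2) by ring.
    apply Rmult_le_compat_l; [|exact H]. assert (H0 := Cmod_ge_0 w).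
    repeat apply Rmult_le_pos; lra.
Qed.

Lemma CLog_scal (k : R) (z : C) : 0 < k -> 0 < Re z -> CLog (RtoC k * z) = (RtoC (ln k) + CLog z)%C.
Proof.
  intros Hk Hz.
  assert (E : (RtoC k * z)%C = (k * Re z, k * Im z)).
  { destruct z; unfold RtoC, Cmult; simpl; f_equal; ring. }
  rewrite E, (CLog_Re_pos z Hz), CLog_Re_pos by (simpl; nra).
  unfold Cplus, RtoC; simpl. f_equal.
  - replace (k * Re z * (k * Re z * 1) + k * Im z * (k * Im z * 1))
      with (k * k * (Re z * (Re z * 1) + Im z * (Im z * 1))) by ring.
    rewrite !ln_mult by nra. field.
  - rewrite Rplus_0_l. f_equal. field. lra.
Qed.

(* Both sides have the same derivative along the segment from [z] to [z + h]. *)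
Lemma CLog_quotient (z h : C) : 0 < Re z -> 0 < Re (z + h) -> Cmod (h / z) <= / 2 ->
  CLog (z + h) = (CLog z + CLog (1 + h / z))%C.
Proof.
  intros Hz Hh Hw.
  assert (Hz0 : z <> 0%C) by (intros E; rewrite E in Hz; simpl in Hz; lra).
  assert (Hr : forall x, 0 <= x <= 1 -> 0 < Re (z + RtoC x * h)).
  { intros x Hx. rewrite re_plus in Hh. rewrite re_plus, re_scal_l.
    destruct (Rlt_dec x 1); [|replace x with 1 by lra; lra].
    assert (0 < (1 - x) * Re z) by (apply Rmult_lt_0_compat; lra).
    assert (0 <= x * (Re z + Re h)) by (apply Rmult_le_pos; lra). lra. }
  set (D := fun r => (CLog (z + RtoC r * h) - CLog (1 + RtoC r * (h / z)))%C).
  assert (H : Cmod (D 1 - D 0) <= 0 - 0).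
  { apply (cder_mvi D (fun _ => 0%C) (fun _ => 0) (fun _ => 0)); [lra| | |].
    - intros x Hx. unfold D.
      assert (Hn := Cmod_ge_neq_0 _ (/ 2) ltac:(lra) (Cmod_one_plus_ge _ x Hw Hx)).
      assert (Hn' : (z + RtoC x * h)%C <> 0%C)
        by (intros E; specialize (Hr x Hx); rewrite E in Hr; simpl in Hr; lra).
      eapply cder_eq.
      + apply cder_minus; apply cder_log.
        * apply Hr; auto.
        * apply cder_plus; [apply cder_const|apply cder_mult; [apply cder_id|apply cder_const]].
        * assert (H := Re_one_plus _ x Hw Hx); lra.
        * apply cder_plus; [apply cder_const|apply cder_mult; [apply cder_id|apply cder_const]].
      + cbv beta. field. split; assumption.
    - intros x _. apply @is_derive_const.
    - intros x _. rewrite Cmod_0; lra. }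
  assert (E : (D 1 - D 0)%C = 0%C) by (apply Cmod_eq_0; assert (H0 := Cmod_ge_0 (D 1 - D 0)); lra).
  unfold D in E. rewrite !Cmult_0_l, !Cmult_1_l, !Cplus_0_r, CLog_1 in E.
  replace (CLog (z + h)) with ((CLog (z + h) - CLog (1 + h / z) - (CLog z - 0)) + CLog z + CLog (1 + h / z))%C by ring.
  rewrite E. ring.
Qed.

Lemma RtoC_neq_0 (x : R) : x <> 0 -> RtoC x <> 0%C.
Proof. intros H E. apply H. injection E; auto. Qed.

(** * Exponential sums: the tests of Kuzmin-Landau and van der Corput *)

Definition cis (x : R) : C := (cos x, sin x).

Lemma Cmod_cis (x : R) : Cmod (cis x) = 1.
Proof.
  unfold cis, Cmod; simpl.
  replace (cos x * (cos x * 1) + sin x * (sin x * 1)) with (Rsqr (sin x) + Rsqr (cos x))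
    by (unfold Rsqr; ring).
  rewrite sin2_cos2. apply sqrt_1.
Qed.

Lemma cis_plus (x y : R) : cis (x + y) = (cis x * cis y)%C.
Proof. unfold cis, Cmult; simpl. rewrite cos_plus, sin_plus. f_equal; ring. Qed.

Lemma cis_opp (x : R) : cis (- x) = Cconj (cis x).
Proof. unfold cis, Cconj; simpl. rewrite cos_neg, sin_neg. reflexivity. Qed.

Lemma cis_nat_period (x : R) (k : nat) : cis (x + 2 * INR k * PI) = cis x.
Proof. unfold cis. rewrite cos_period, sin_period. reflexivity. Qed.

Lemma cis_period (x : R) (k : Z) : cis (x + 2 * PI * IZR k) = cis x.
Proof.
  destruct k as [|p|p].
  - f_equal; ring.
  - rewrite <- (positive_nat_Z p), <- INR_IZR_INZ.
    rewrite <- (cis_nat_period x (Pos.to_nat p)). f_equal; ring.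
  - change (Z.neg p) with (- Z.pos p)%Z. rewrite <- (positive_nat_Z p), opp_IZR, <- INR_IZR_INZ.
    rewrite <- (cis_nat_period _ (Pos.to_nat p)). f_equal; ring.
Qed.

Definition cot (x : R) : R := cos x / sin x.

Lemma cot_decr (a b : R) : 0 < a -> a <= b -> b < PI -> cot b <= cot a.
Proof.
  intros Ha Hab Hb.
  assert (H1 : 0 < sin a) by (apply sin_gt_0; lra).
  assert (H2 : 0 < sin b) by (apply sin_gt_0; lra).
  assert (H3 : 0 <= sin (b - a)) by (apply sin_ge_0; lra).
  rewrite sin_minus in H3. unfold cot.
  apply Rmult_le_reg_r with (sin a * sin b); [nra|].
  replace (cos b / sin b * (sin a * sin b)) with (cos b * sin a) by (field; lra).
  replace (cos a / sin a * (sin a * sin b)) with (cos a * sin b) by (field; lra). lra.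
Qed.

(** Jordan's inequality. The difference of the two sides vanishes at 0 and at PI/2; as cos
    decreases, it grows up to c = acos(2/PI) and falls after it. *)
Lemma sin_ge_linear (x : R) : 0 <= x <= PI / 2 -> 2 * x / PI <= sin x.
Proof.
  intros Hx. assert (HP := PI_RGT_0).
  set (k := fun r => sin r - 2 * r / PI).
  assert (Hd : forall r, is_derive k r (cos r - 2 / PI)).
  { intros r. unfold k. auto_derive; auto. field; lra. }
  assert (H2P : 0 < 2 / PI < 1).
  { split; [apply Rdiv_lt_0_compat; lra|]. assert (H := PI2_1).
    apply Rmult_lt_reg_r with PI; [lra|]. unfold Rdiv. rewrite Rmult_assoc, Rinv_l by lra. lra. }
  set (c := acos (2 / PI)).
  assert (Hc : cos c = 2 / PI) by (apply cos_acos; lra).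
  assert (Hcb := acos_bound (2 / PI)). fold c in Hcb.
  assert (Hc2 : c <= PI / 2).
  { destruct (Rle_dec c (PI / 2)) as [|n]; auto. exfalso.
    assert (H : cos c < 0) by (apply cos_lt_0; lra). lra. }
  assert (0 <= k x); [|unfold k in *; lra].
  destruct (Rle_dec x c) as [Hxc|Hxc].
  - replace 0 with (k 0) by (unfold k; rewrite sin_0; field; lra).
    apply (incr_of_derive_nonneg k (fun r => cos r - 2 / PI)); [lra|auto|].
    intros r Hr. rewrite <- Hc. assert (cos c <= cos r) by (apply cos_decr_1; lra). lra.
  - assert (- k x <= - k (PI / 2)).
    { apply (incr_of_derive_nonneg (fun r => - k r) (fun r => - (cos r - 2 / PI))); [lra| |].
      - intros r Hr. apply (is_derive_opp k r (cos r - 2 / PI)). apply Hd.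
      - intros r Hr. assert (cos r <= cos c) by (apply cos_decr_1; lra). lra. }
    assert (k (PI / 2) = 0) by (unfold k; rewrite sin_PI2; field; lra). lra.
Qed.

Lemma cot_bound (x d : R) : 0 < d <= PI / 2 -> d <= x <= PI - d -> Rabs (cot x) <= PI / (2 * d).
Proof.
  intros Hd Hx. assert (HP := PI_RGT_0).
  assert (Hs : 2 * d / PI <= sin x).
  { destruct (Rle_dec x (PI / 2)).
    - eapply Rle_trans; [|apply sin_ge_linear; lra].
      apply Rmult_le_compat_r; [left; apply Rinv_0_lt_compat; lra|lra].
    - rewrite <- sin_PI_x. eapply Rle_trans; [|apply sin_ge_linear; lra].
      apply Rmult_le_compat_r; [left; apply Rinv_0_lt_compat; lra|lra]. }
  assert (Hdp : 0 < 2 * d / PI) by (apply Rdiv_lt_0_compat; lra).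
  unfold cot, Rdiv. rewrite Rabs_mult, Rabs_inv, (Rabs_pos_eq (sin x)) by lra.
  assert (Rabs (cos x) <= 1) by (apply Rabs_le; apply COS_bound).
  replace (PI * / (2 * d)) with (1 * / (2 * d / PI)) by (field; lra).
  apply Rmult_le_compat; auto.
  - apply Rabs_pos.
  - left; apply Rinv_0_lt_compat; lra.
  - apply Rinv_le_contravar; auto.
Qed.

(** After summation by parts the variation of the decreasing weights telescopes to k 0 - k M; with
    the boundary terms at 0 and M this makes four times the bound on |k|. *)
Lemma abel_monotone (k : nat -> R) (E : nat -> C) (B : R) (M : nat) :
  (forall n, (n < M)%nat -> k (S n) <= k n) -> (forall n, Cmod (E n) <= 1) ->
  (forall n, (n <= M)%nat -> Rabs (k n) <= B) ->
  Cmod (csum (fun n => RtoC (k n) * (E (S n) - E n)) (S M))%C <= 4 * B.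
Proof.
  intros Hk HE HB.
  assert (H : Cmod (csum (fun n => RtoC (k n) * (E (S n) - E n)) (S M) - RtoC (k M) * E (S M))%C
              <= Rabs (k 0%nat) + (k 0%nat - k M)).
  { induction M as [|M IH].
    - simpl. replace (0 + RtoC (k 0%nat) * (E 1%nat - E 0%nat) - RtoC (k 0%nat) * E 1%nat)%C
        with (- (RtoC (k 0%nat) * E 0%nat))%C by ring.
      rewrite Cmod_opp, Cmod_mult, Cmod_R. specialize (HE 0%nat).
      assert (H0 := Rabs_pos (k 0%nat)). nra.
    - rewrite csum_S.
      match goal with |- Cmod (?X + _ - _)%C <= _ =>
        replace (X + RtoC (k (S M)) * (E (S (S M)) - E (S M)) - RtoC (k (S M)) * E (S (S M)))%C
        with ((X - RtoC (k M) * E (S M)) + RtoC (k M - k (S M)) * E (S M))%C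
        by (rewrite RtoC_minus; ring) end.
      eapply Rle_trans; [apply Cmod_triangle|].
      assert (IH' := IH (fun n Hn => Hk n (Nat.lt_lt_succ_r _ _ Hn)) (fun n Hn => HB n (le_S _ _ Hn))).
      rewrite Cmod_mult, Cmod_R. assert (Hm := Hk M (Nat.lt_succ_diag_r M)).
      rewrite Rabs_pos_eq by lra. specialize (HE (S M)).
      assert ((k M - k (S M)) * Cmod (E (S M)) <= (k M - k (S M)) * 1)
        by (apply Rmult_le_compat_l; lra). lra. }
  assert (H0 := HB 0%nat (Nat.le_0_l M)). assert (H1 := HB M (Nat.le_refl M)).
  assert (H2 : Cmod (RtoC (k M) * E (S M)) <= B).
  { rewrite Cmod_mult, Cmod_R. specialize (HE (S M)). assert (H3 := Cmod_ge_0 (E (S M))).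
    assert (H4 := Rabs_pos (k M)). nra. }
  match type of H with Cmod (?X - ?Y)%C <= _ =>
    replace X with ((X - Y) + Y)%C by ring end.
  eapply Rle_trans; [apply Cmod_triangle|].
  assert (k 0%nat <= B) by (eapply Rle_trans; [apply Rle_abs|auto]).
  assert (- k M <= B) by (eapply Rle_trans; [apply Rle_abs|rewrite Rabs_Ropp; auto]). lra.
Qed.

(** This is 1/(e^(ia) - 1) = -1/2 - (i/2) cot(a/2). It writes a term of an exponential sum as a
    first difference, with a weight that is monotone in the increment a. *)
Lemma cis_cot (a : R) (E : C) : sin (a / 2) <> 0 ->
  E = (RtoC (- / 2) * (E * cis a - E) + - (Ci / 2) * (RtoC (cot (a / 2)) * (E * cis a - E)))%C.
Proof.
  intros Hs.
  assert (Hc : (RtoC (- / 2) * (cis a - 1) + - (Ci / 2) * (RtoC (cot (a / 2)) * (cis a - 1)))%C = 1%C).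
  { unfold cis. replace a with (2 * (a / 2)) at 1 2 4 5 by field.
    rewrite cos_2a_sin, sin_2a. unfold cot.
    unfold Ci, Cdiv, Cinv, RtoC, Copp, Cminus, Cplus, Cmult; simpl.
    set (s := sin (a / 2)) in *. set (c := cos (a / 2)).
    assert (Hsc : c * c = 1 - s * s).
    { assert (H := sin2_cos2 (a / 2)). unfold Rsqr in H. fold s c in H. lra. }
    f_equal.
    - field_simplify; auto. replace (c ^ 2) with (1 - s * s) by (rewrite <- Hsc; ring). field; auto.
    - field_simplify; auto; field; auto. }
  transitivity (E * (RtoC (- / 2) * (cis a - 1) + - (Ci / 2) * (RtoC (cot (a / 2)) * (cis a - 1))))%C.
  - rewrite Hc; ring.
  - ring.
Qed.

(** After [cis_cot] the constant part telescopes and contributes at most 1. Increasing increments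
    make the cotangents decrease, so partial summation bounds the other part by 2 PI/d; and 1 <=
    PI/d. *)
Lemma kuzmin_landau (phi : nat -> R) (d : R) (M : nat) :
  0 < d <= PI ->
  (forall n, (n < M)%nat -> d <= phi (S n) - phi n <= 2 * PI - d) ->
  (forall n, (S n < M)%nat -> phi (S n) - phi n <= phi (S (S n)) - phi (S n)) ->
  Cmod (csum (fun n => cis (phi n)) M) <= 3 * PI / d.
Proof.
  intros Hd Hr Hm. assert (HP := PI_RGT_0).
  assert (Hpd : 1 <= PI / d).
  { apply Rmult_le_reg_r with d; [lra|]. unfold Rdiv. rewrite Rmult_assoc, Rinv_l; lra. }
  destruct M as [|M].
  { simpl. rewrite Cmod_0. apply Rmult_le_pos; [lra|left; apply Rinv_0_lt_compat; lra]. }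
  set (th := fun n => phi (S n) - phi n).
  rewrite (csum_ext _ (fun n => RtoC (- / 2) * (cis (phi (S n)) - cis (phi n)) +
     - (Ci / 2) * (RtoC (cot (th n / 2)) * (cis (phi (S n)) - cis (phi n))))%C).
  2:{ intros n Hn. replace (phi (S n)) with (phi n + th n) by (unfold th; ring).
      rewrite cis_plus. apply cis_cot. specialize (Hr n Hn). fold (th n) in Hr.
      apply Rgt_not_eq, sin_gt_0; lra. }
  rewrite csum_plus, !csum_scal, (csum_telescope (fun n => cis (phi n))).
  eapply Rle_trans; [apply Cmod_triangle|]. rewrite !Cmod_mult.
  assert (H1 : Cmod (cis (phi (S M)) - cis (phi 0%nat)) <= 2)
    by (eapply Rle_trans; [apply Cmod_minus_le|]; rewrite !Cmod_cis; lra).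
  assert (H2 : Cmod (csum (fun k => RtoC (cot (th k / 2)) * (cis (phi (S k)) - cis (phi k)))%C (S M))
               <= 4 * (PI / (2 * (d / 2)))).
  { apply (abel_monotone (fun n => cot (th n / 2)) (fun n => cis (phi n))).
    - intros n Hn. assert (Ha := Hr n ltac:(lia)). assert (Hb := Hr (S n) ltac:(lia)).
      specialize (Hm n ltac:(lia)). apply cot_decr; unfold th; lra.
    - intros n; rewrite Cmod_cis; lra.
    - intros n Hn. specialize (Hr n ltac:(lia)). apply cot_bound; unfold th; lra. }
  rewrite Cmod_opp, Cmod_R, Rabs_Ropp, Rabs_pos_eq by lra.
  unfold Cdiv. rewrite Cmod_mult, Cmod_Ci, Cmod_inv by (apply RtoC_neq_0; lra).
  rewrite Cmod_R, Rabs_pos_eq by lra.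
  replace (4 * (PI / (2 * (d / 2)))) with (4 * (PI / d)) in H2 by (field; lra).
  replace (3 * PI / d) with (3 * (PI / d)) by (field; lra). lra.
Qed.

(** The added phase is a multiple of 2 PI at every integer, but it moves all increments by 2 PI k;
    this brings them into the range required by Kuzmin-Landau. *)
Lemma csum_cis_shift (phi : nat -> R) (k : Z) (M : nat) :
  csum (fun n => cis (phi n)) M = csum (fun n => cis (phi n + 2 * PI * (IZR k * INR n))) M.
Proof.
  apply csum_ext. intros n _. rewrite INR_IZR_INZ, <- mult_IZR, cis_period. reflexivity.
Qed.

Lemma kuzmin_landau_mod (phi : nat -> R) (d : R) (k : Z) (M : nat) :
  0 < d <= PI ->
  (forall n, (n < M)%nat -> d <= phi (S n) - phi n + 2 * PI * IZR k <= 2 * PI - d) ->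
  (forall n, (S n < M)%nat -> phi (S n) - phi n <= phi (S (S n)) - phi (S n)) ->
  Cmod (csum (fun n => cis (phi n)) M) <= 3 * PI / d.
Proof.
  intros Hd Hr Hm. rewrite (csum_cis_shift phi k). apply kuzmin_landau; auto.
  - intros n Hn. specialize (Hr n Hn). rewrite S_INR. lra.
  - intros n Hn. specialize (Hm n Hn). rewrite !S_INR. lra.
Qed.

Lemma Cmod_csum_cis_le (phi : nat -> R) (M : nat) : Cmod (csum (fun n => cis (phi n)) M) <= INR M.
Proof.
  eapply Rle_trans; [apply (Cmod_csum_le _ (fun _ => 1)); intros; rewrite Cmod_cis; lra|].
  rewrite rsum_const; lra.
Qed.

Lemma monotone_threshold (th : nat -> R) (c : R) (M : nat) :
  (forall n, (S n < M)%nat -> th n <= th (S n)) ->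
  exists m, (m <= M)%nat /\ (forall n, (n < m)%nat -> th n < c) /\
    (forall n, (m <= n < M)%nat -> c <= th n).
Proof.
  induction M as [|M IH]; intros Hm.
  - exists 0%nat. split; [lia|]. split; intros; lia.
  - destruct IH as [m [H1 [H2 H3]]]; [intros; apply Hm; lia|].
    destruct (Nat.eq_dec m M) as [->|Hne].
    + destruct (Rlt_dec (th M) c) as [Hlt|Hge].
      * exists (S M). split; [lia|]. split; [|intros; lia].
        intros n Hn. destruct (Nat.eq_dec n M) as [->|]; auto. apply H2; lia.
      * exists M. split; [lia|]. split; auto. intros n Hn. replace n with M by lia. lra.
    + exists m. split; [lia|]. split; auto. intros n Hn.
      destruct (Nat.eq_dec n M) as [->|]; [|apply H3; lia].
      destruct M as [|M]; [lia|].
      apply Rle_trans with (th M); [apply H3; lia|apply Hm; lia].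
Qed.

Lemma increments_ge (th : nat -> R) (l : R) (m M : nat) :
  (forall n, (S n < M)%nat -> l <= th (S n) - th n) -> (m < M)%nat ->
  forall j, (m + j < M)%nat -> th m + INR j * l <= th (m + j)%nat.
Proof.
  intros Hl Hm j. induction j as [|j IH]; intros Hj.
  - rewrite Nat.add_0_r. simpl; lra.
  - specialize (IH ltac:(lia)). rewrite S_INR, Nat.add_succ_r.
    specialize (Hl (m + j)%nat ltac:(lia)). lra.
Qed.

Lemma increments_le (th : nat -> R) (l : R) (M : nat) :
  (forall n, (S n < M)%nat -> th (S n) - th n <= l) ->
  forall j, (j < M)%nat -> th j <= th 0%nat + INR j * l.
Proof.
  intros Hl j. induction j as [|j IH]; intros Hj.
  - simpl; lra.
  - specialize (IH ltac:(lia)). rewrite S_INR. specialize (Hl j ltac:(lia)). lra.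
Qed.

(** The increasing increments are cut at -d and d. Outside, Kuzmin-Landau applies, to the left after
    a shift by 2 PI; stopping at 3 PI/2 leaves room for d <= 1 at the far end. In between the
    increments grow by at least d^2 per step, so at most 2/d + 1 terms lie there. *)
Lemma second_diff_block_core (phi : nat -> R) (d : R) (M : nat) :
  0 < d <= 1 ->
  (forall n, (n < M)%nat -> - (3 * PI / 2) <= phi (S n) - phi n <= 3 * PI / 2) ->
  (forall n, (S n < M)%nat -> d * d <= (phi (S (S n)) - phi (S n)) - (phi (S n) - phi n)) ->
  Cmod (csum (fun n => cis (phi n)) M) <= 27 / d.
Proof.
  intros Hd Hr Hl. assert (HP := PI_RGT_0). assert (HP2 := PI2_1). assert (HP4 := PI_4).
  set (th := fun n => phi (S n) - phi n).
  assert (Hl' : forall n, (S n < M)%nat -> d * d <= th (S n) - th n) by (intros; apply Hl; auto).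
  assert (Hmon : forall n, (S n < M)%nat -> th n <= th (S n))
    by (intros n Hn; specialize (Hl' n Hn); nra).
  destruct (monotone_threshold th (- d) M Hmon) as [m1 [H11 [H12 H13]]].
  destruct (monotone_threshold th d M Hmon) as [m2 [H21 [H22 H23]]].
  assert (H12m : (m1 <= m2)%nat).
  { destruct (le_lt_dec m1 m2) as [|n]; auto. exfalso.
    specialize (H12 m2 n). specialize (H23 m2 ltac:(lia)). lra. }
  replace M with (m1 + ((m2 - m1) + (M - m2)))%nat by lia.
  rewrite csum_add, csum_add.
  assert (HA : Cmod (csum (fun n => cis (phi n)) m1) <= 3 * PI / d).
  { apply (kuzmin_landau_mod phi d 1); [lra| |].
    - intros n Hn. specialize (H12 n Hn). specialize (Hr n ltac:(lia)). unfold th in H12. lra.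
    - intros n Hn. apply (Hmon n); lia. }
  assert (HC : Cmod (csum (fun k => cis (phi (m1 + (m2 - m1 + k))%nat)) (M - m2)) <= 3 * PI / d).
  { rewrite (csum_ext _ (fun k => cis (phi (m2 + k)%nat))) by (intros; f_equal; f_equal; lia).
    apply (kuzmin_landau_mod (fun k => phi (m2 + k)%nat) d 0); [lra| |].
    - intros n Hn. specialize (H23 (m2 + n)%nat ltac:(lia)). specialize (Hr (m2 + n)%nat ltac:(lia)).
      rewrite Nat.add_succ_r. unfold th in H23. lra.
    - intros n Hn. rewrite !Nat.add_succ_r. apply (Hmon (m2 + n)%nat); lia. }
  assert (HB : Cmod (csum (fun k => cis (phi (m1 + k)%nat)) (m2 - m1)) <= 3 / d).
  { eapply Rle_trans; [apply (Cmod_csum_cis_le (fun k => phi (m1 + k)%nat))|].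
    assert (Hid : 1 <= / d) by (rewrite <- Rinv_1; apply Rinv_le_contravar; lra).
    destruct (Nat.eq_dec m1 m2) as [->|Hne]; [rewrite Nat.sub_diag; simpl; unfold Rdiv; lra|].
    assert (Hinc := increments_ge th (d * d) m1 M Hl' ltac:(lia) (m2 - 1 - m1) ltac:(lia)).
    specialize (H13 m1 ltac:(lia)). specialize (H22 (m1 + (m2 - 1 - m1))%nat ltac:(lia)).
    replace (m2 - m1)%nat with (S (m2 - 1 - m1)) by lia. rewrite S_INR.
    assert (Hj : INR (m2 - 1 - m1) * d <= 2) by nra.
    assert (INR (m2 - 1 - m1) <= 2 / d).
    { apply Rmult_le_reg_r with d; [lra|]. unfold Rdiv. rewrite Rmult_assoc, Rinv_l; lra. }
    unfold Rdiv in *. lra. }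
  eapply Rle_trans; [apply Cmod_triangle|].
  assert (H := Cmod_triangle (csum (fun k => cis (phi (m1 + k)%nat)) (m2 - m1))
                 (csum (fun k => cis (phi (m1 + (m2 - m1 + k))%nat)) (M - m2))).
  apply Rle_trans with (3 * PI / d + (3 / d + 3 * PI / d)); [lra|].
  (* With PI <= 4 the constant 6 PI + 3 is at most 27. *)
  replace (3 * PI / d + (3 / d + 3 * PI / d)) with ((6 * PI + 3) / d) by (field; lra).
  apply Rmult_le_compat_r; [left; apply Rinv_0_lt_compat; lra|lra].
Qed.

(** The condition on the length bounds the total growth of the increments by PI, so one shift by a
    multiple of 2 PI confines them to [-3 PI/2, 3 PI/2], where 0 is the only multiple of 2 PI. *)
Lemma second_diff_block (phi : nat -> R) (d A : R) (M : nat) :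
  0 < d <= 1 -> 0 <= A -> INR M * (A * (d * d)) <= PI ->
  (forall n, (S n < M)%nat ->
     d * d <= (phi (S (S n)) - phi (S n)) - (phi (S n) - phi n) <= A * (d * d)) ->
  Cmod (csum (fun n => cis (phi n)) M) <= 27 / d.
Proof.
  intros Hd HA HM Hl. assert (HP := PI_RGT_0).
  set (th := fun n => phi (S n) - phi n).
  (* Puts the first increment into [-3 PI/2, PI/2), leaving PI for the growth. *)
  set (m := up ((th 0%nat - PI / 2) / (2 * PI))).
  assert (Hm : - (3 * PI / 2) <= th 0%nat - 2 * PI * IZR m < PI / 2).
  { destruct (archimed ((th 0%nat - PI / 2) / (2 * PI))) as [H1 H2]. fold m in H1, H2.
    set (r := (th 0%nat - PI / 2) / (2 * PI)) in *.
    assert (E : th 0%nat = r * (2 * PI) + PI / 2) by (unfold r; field; lra).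
    rewrite E. nra. }
  rewrite (csum_cis_shift phi (- m)).
  apply second_diff_block_core; auto.
  - intros n Hn.
    assert (Hup := increments_le th (A * (d * d)) M (fun k Hk => proj2 (Hl k Hk)) n Hn).
    assert (Hlo := increments_ge th (d * d) 0 M (fun k Hk => proj1 (Hl k Hk)) ltac:(lia) n Hn).
    simpl in Hlo.
    assert (H0 : 0 <= INR n) by apply pos_INR.
    assert (Hn' : INR n * (A * (d * d)) <= PI).
    { eapply Rle_trans; [|exact HM]. apply Rmult_le_compat_r; [nra|]. apply le_INR; lia. }
    assert (0 <= INR n * (d * d)) by nra.
    rewrite opp_IZR, S_INR.
    match goal with |- _ <= ?e <= _ => replace e with (th n - 2 * PI * IZR m) by (unfold th; ring) end.
    lra.
  - intros n Hn. specialize (Hl n Hn). rewrite !S_INR.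
    match goal with |- _ <= ?e => replace e with ((phi (S (S n)) - phi (S n)) - (phi (S n) - phi n)) by ring end.
    lra.
Qed.

Lemma second_diff_blocks (d A : R) (B : nat) :
  0 < d <= 1 -> 0 <= A -> INR B * (A * (d * d)) <= PI ->
  forall (q : nat) (phi : nat -> R) (N : nat), (N <= q * B)%nat ->
  (forall n, (S n < N)%nat ->
     d * d <= (phi (S (S n)) - phi (S n)) - (phi (S n) - phi n) <= A * (d * d)) ->
  Cmod (csum (fun n => cis (phi n)) N) <= INR q * (27 / d).
Proof.
  intros Hd HA HB. assert (Hd27 : 0 < 27 / d) by (apply Rdiv_lt_0_compat; lra).
  induction q as [|q IH]; intros phi N HN Hl.
  - replace N with 0%nat by lia. simpl. rewrite Cmod_0; lra.
  - rewrite S_INR. destruct (le_lt_dec N (q * B)) as [Hle|Hlt].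
    + eapply Rle_trans; [apply IH; auto|]. lra.
    + replace N with (q * B + (N - q * B))%nat by lia. rewrite csum_add.
      eapply Rle_trans; [apply Cmod_triangle|]. rewrite Rmult_plus_distr_r, Rmult_1_l.
      apply Rplus_le_compat.
      * apply IH; [lia|]. intros n Hn. apply Hl; lia.
      * apply (second_diff_block (fun k => phi (q * B + k)%nat) d A); auto.
        -- eapply Rle_trans; [|exact HB]. apply Rmult_le_compat_r; [nra|]. apply le_INR. simpl in HN. lia.
        -- intros n Hn. rewrite !Nat.add_succ_r. apply Hl; lia.
Qed.

(** Van der Corput's second-derivative test, with d^2 as lower bound of the second derivative: at
    most N A d^2 + 1 blocks, each contributing 27/d. If d > 1 or A d^2 > 1, the trivial bound N
    suffices. *)
Lemma second_diff_test (phi : nat -> R) (d A : R) (N : nat) :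
  0 < d -> 1 <= A ->
  (forall n, (S n < N)%nat ->
     d * d <= (phi (S (S n)) - phi (S n)) - (phi (S n) - phi n) <= A * (d * d)) ->
  Cmod (csum (fun n => cis (phi n)) N) <= 27 * (A * INR N * d + / d).
Proof.
  intros Hd HA Hl. assert (HN := pos_INR N).
  assert (Hid : 0 < / d) by (apply Rinv_0_lt_compat; lra).
  assert (HAN : 0 <= A * INR N * d) by (repeat apply Rmult_le_pos; lra).
  destruct (Rlt_dec 1 d) as [H1|H1].
  { eapply Rle_trans; [apply Cmod_csum_cis_le|].
    assert (INR N <= INR N * (A * d)) by (rewrite <- (Rmult_1_r (INR N)) at 1; apply Rmult_le_compat_l; nra).
    lra. }
  destruct (Rlt_dec 1 (A * (d * d))) as [H2|H2].
  { eapply Rle_trans; [apply Cmod_csum_cis_le|].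
    assert (INR N <= INR N * (A * d)) by (rewrite <- (Rmult_1_r (INR N)) at 1; apply Rmult_le_compat_l; nra).
    lra. }
  assert (HA2 : 0 < A * (d * d)) by (repeat apply Rmult_lt_0_compat; lra).
  set (x := / (A * (d * d))).
  assert (Hx : 0 < x) by (apply Rinv_0_lt_compat; lra).
  assert (HxA : x * (A * (d * d)) = 1) by (unfold x; field; lra).
  destruct (nfloor_ex x) as [b Hb]; [lra|].
  assert (HP := PI2_1).
  (* A block has floor(x) + 1 terms; as A d^2 <= 1, the growth over it is at most 1 + A d^2 <= 2 <=
     PI. *)
  assert (HB : INR (S b) * (A * (d * d)) <= PI).
  { rewrite S_INR. nra. }
  assert (Hq : (N <= S (N / S b) * S b)%nat).
  { assert (H := Nat.div_mod_eq N (S b)). assert (H0 := Nat.mod_upper_bound N (S b) ltac:(lia)). nia. }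
  eapply Rle_trans; [apply (second_diff_blocks d A (S b)) with (q := S (N / S b)); auto; lra|].
  assert (Hdiv : INR (N / S b) <= INR N * (A * (d * d))).
  { assert (H : INR (N / S b) * INR (S b) <= INR N).
    { rewrite <- mult_INR. apply le_INR. rewrite Nat.mul_comm. apply Nat.Div0.mul_div_le. }
    rewrite S_INR in H. assert (H0 := pos_INR (N / S b)).
    apply Rmult_le_reg_r with x; [lra|].
    replace (INR N * (A * (d * d)) * x) with (INR N * (x * (A * (d * d)))) by ring. rewrite HxA. nra. }
  rewrite S_INR.
  apply Rle_trans with ((INR N * (A * (d * d)) + 1) * (27 / d)).
  - apply Rmult_le_compat_r; [apply Rlt_le, Rdiv_lt_0_compat; lra|lra].
  - right. field. lra.
Qed.

(** * Van der Corput's differencing inequality *)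

Lemma rsum_rev (f : nat -> R) (h : nat) : rsum (fun k => f (h - k)%nat) h = rsum (fun k => f (S k)) h.
Proof.
  induction h as [|h IH]; [reflexivity|].
  set (F := fun k => f (S h - k)%nat).
  change (rsum F (S h)) with (rsum F (1 + h)). rewrite rsum_add, (rsum_S (fun k => f (S k))), <- IH.
  rewrite (rsum_ext (fun k => F (1 + k)%nat) (fun k => f (h - k)%nat)) by (intros; reflexivity).
  replace (rsum F 1) with (f (S h)) by (unfold F; simpl; ring). ring.
Qed.

(** The sum of the two truncated differences is |h - k|, and each value is taken at most twice. *)
Lemma rsum_toeplitz_le (f : nat -> R) (H h : nat) : (forall d, 0 <= f d) -> (h < H)%nat ->
  rsum (fun k => f ((h - k) + (k - h))%nat) H <= 2 * rsum f H.
Proof.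
  intros Hf Hh. replace H with (h + (H - h))%nat at 1 by lia. rewrite rsum_add.
  rewrite (rsum_ext (fun k => f (h - k + (k - h))%nat) (fun k => f (h - k)%nat) h)
    by (intros; f_equal; lia).
  rewrite (rsum_ext (fun k => f (h - (h + k) + (h + k - h))%nat) f (H - h))
    by (intros; f_equal; lia).
  rewrite rsum_rev.
  assert (H1 : rsum (fun k => f (S k)) h <= rsum f H).
  { apply Rle_trans with (rsum f (1 + h)).
    - rewrite rsum_add. simpl rsum at 2. specialize (Hf 0%nat). simpl Nat.add. lra.
    - apply rsum_incr; [lia|auto]. }
  assert (H2 : rsum f (H - h) <= rsum f H) by (apply rsum_incr; [lia|auto]). lra.
Qed.

Lemma csum_shift_le (a : nat -> C) (M h : nat) : (forall n, Cmod (a n) <= 1) ->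
  Cmod (csum a M - csum (fun n => a (n + h)%nat) M) <= 2 * INR h.
Proof.
  intros Ha.
  assert (E : (csum a M - csum (fun n => a (n + h)%nat) M)%C
     = (csum a h - csum (fun k => a (M + k)%nat) h)%C).
  { assert (E1 := csum_add a M h). rewrite Nat.add_comm, csum_add in E1.
    rewrite (csum_ext (fun n => a (n + h)%nat) (fun n => a (h + n)%nat))
      by (intros; f_equal; lia).
    replace (csum a M) with (csum a h + csum (fun k => a (h + k)%nat) M
       - csum (fun k => a (M + k)%nat) h)%C by (rewrite E1; ring). ring. }
  rewrite E. eapply Rle_trans; [apply Cmod_minus_le|].
  assert (H : forall b : nat -> C, (forall n, Cmod (b n) <= 1) -> Cmod (csum b h) <= INR h).
  { intros b Hb. eapply Rle_trans; [apply (Cmod_csum_le _ (fun _ => 1)); auto|].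
    rewrite rsum_const; lra. }
  assert (H1 := H a Ha). assert (H2 := H (fun k => a (M + k)%nat) (fun n => Ha _)). lra.
Qed.

(** Averaging over H shifts replaces the sum by 1/H times the sum of [T n], up to boundary terms.
    Cauchy-Schwarz and the expansion of |T n|^2 leave the correlations of a with its shifts, whose
    bound depends only on the distance d. The witness X is described through its square, which
    avoids a square root of the sum of beta. *)
Lemma van_der_corput_differencing (a : nat -> C) (M H : nat) (beta : nat -> R) :
  (0 < H)%nat -> (forall n, Cmod (a n) <= 1) -> (forall d, 0 <= beta d) ->
  (forall d k, (k + d < H)%nat ->
     Cmod (csum (fun n => a (n + (k + d))%nat * Cconj (a (n + k)%nat))%C M) <= beta d) ->
  exists X, 0 <= X /\ Cmod (csum a M) <= 2 * INR H + X /\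
    X * X <= 2 * INR M / INR H * rsum beta H.
Proof.
  intros HH Ha Hb Hc.
  assert (HHr : 0 < INR H) by (apply lt_0_INR; lia).
  assert (HMr := pos_INR M).
  set (T := fun n => csum (fun h => a (n + h)%nat) H).
  set (S1 := rsum (fun n => Cmod (T n)) M).
  assert (HS1 : 0 <= S1) by (apply rsum_pos; intros; apply Cmod_ge_0).
  exists (S1 / INR H). split; [|split].
  - apply Rmult_le_pos; auto. left; apply Rinv_0_lt_compat; lra.
  - assert (E : (RtoC (INR H) * csum a M)%C
      = (csum (fun h => csum a M - csum (fun n => a (n + h)%nat) M) H + csum T M)%C).
    { unfold T. rewrite csum_minus, (csum_exchange (fun n h => a (n + h)%nat) M H).
      assert (E0 : forall (c : C) n, csum (fun _ => c) n = (RtoC (INR n) * c)%C).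
      { intros c n. induction n as [|n IH]; [simpl; ring|].
        rewrite csum_S, IH, S_INR, RtoC_plus. ring. }
      rewrite E0. ring. }
    apply Rmult_le_reg_l with (INR H); auto.
    apply Rle_trans with (Cmod (RtoC (INR H) * csum a M)%C).
    { rewrite Cmod_mult, Cmod_R, Rabs_pos_eq; lra. }
    rewrite E. eapply Rle_trans; [apply Cmod_triangle|].
    replace (INR H * (2 * INR H + S1 / INR H)) with (INR H * (2 * INR H) + S1) by (field; lra).
    apply Rplus_le_compat.
    + rewrite <- rsum_const. apply Cmod_csum_le. intros h Hh.
      eapply Rle_trans; [apply csum_shift_le; auto|].
      apply Rmult_le_compat_l; [lra|apply le_INR; lia].
    + apply Cmod_csum_le. intros; lra.
  - assert (HS2 : rsum (fun n => Cmod (T n) ^ 2) M <= INR H * (2 * rsum beta H)).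
    { assert (E : RtoC (rsum (fun n => Cmod (T n) ^ 2) M)
        = csum (fun h => csum (fun k => csum (fun n => a (n + h)%nat * Cconj (a (n + k)%nat))%C M) H) H).
      { transitivity (csum (fun n => csum (fun h => csum (fun k => a (n + h)%nat * Cconj (a (n + k)%nat)) H) H) M)%C.
        - assert (E1 : forall n, RtoC (Cmod (T n) ^ 2) =
            csum (fun h => csum (fun k => a (n + h)%nat * Cconj (a (n + k)%nat))%C H) H).
          { intros n. rewrite Cmod2_conj. unfold T. rewrite csum_conj.
            rewrite Cmult_comm, <- csum_scal. apply csum_ext. intros h _.
            rewrite Cmult_comm, <- csum_scal. reflexivity. }
          clear -E1. induction M as [|M IH]; [reflexivity|].
          rewrite csum_S, rsum_S, RtoC_plus, IH, E1. reflexivity.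
        - rewrite csum_exchange. apply csum_ext. intros h _. rewrite csum_exchange. reflexivity. }
      assert (H0 : 0 <= rsum (fun n => Cmod (T n) ^ 2) M) by (apply rsum_pos; intros; apply pow2_ge_0).
      rewrite <- (Rabs_pos_eq _ H0), <- Cmod_R, E, <- rsum_const.
      apply Cmod_csum_le. intros h Hh.
      eapply Rle_trans; [|apply (rsum_toeplitz_le beta H h Hb Hh)].
      apply Cmod_csum_le. intros k Hk. destruct (le_lt_dec k h) as [Hle|Hlt].
      - specialize (Hc (h - k)%nat k ltac:(lia)).
        replace (k + (h - k))%nat with h in Hc by lia.
        replace (h - k + (k - h))%nat with (h - k)%nat by lia. exact Hc.
      - specialize (Hc (k - h)%nat h ltac:(lia)).
        replace (h + (k - h))%nat with k in Hc by lia.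
        replace (h - k + (k - h))%nat with (k - h)%nat by lia.
        rewrite <- Cmod_conj, csum_conj.
        rewrite (csum_ext _ (fun n => a (n + k)%nat * Cconj (a (n + h)%nat))%C); [exact Hc|].
        intros n _. rewrite Cmult_conj, Cconj_conj. ring. }
    assert (HCS := rsum_cauchy_schwarz (fun n => Cmod (T n)) M). fold S1 in HCS.
    assert (HS : S1 ^ 2 <= INR M * (INR H * (2 * rsum beta H)))
      by (eapply Rle_trans; [exact HCS|]; apply Rmult_le_compat_l; auto).
    replace (S1 / INR H * (S1 / INR H)) with (S1 ^ 2 * / (INR H * INR H)) by (field; lra).
    replace (2 * INR M / INR H * rsum beta H)
      with (INR M * (INR H * (2 * rsum beta H)) * / (INR H * INR H)) by (field; lra).
    apply Rmult_le_compat_r; auto. left; apply Rinv_0_lt_compat; nra.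
Qed.

(** * Weyl's bound for dyadic pieces of the zeta sum *)

Lemma ln_le_sub1 (x : R) : 0 < x -> ln x <= x - 1.
Proof.
  intros Hx. assert (H := exp_ineq1_le (ln x)). rewrite exp_ln in H by auto. lra.
Qed.

Lemma ln_quotient_bounds (x y : R) : 0 < x -> 0 < y -> (x - y) / x <= ln x - ln y <= (x - y) / y.
Proof.
  intros Hx Hy. split.
  - assert (H := ln_le_sub1 (y / x) ltac:(apply Rdiv_lt_0_compat; auto)).
    unfold Rdiv in H. rewrite ln_mult, ln_Rinv in H by (auto; apply Rinv_0_lt_compat; auto).
    replace ((x - y) / x) with (1 - y * / x) by (field; lra). lra.
  - assert (H := ln_le_sub1 (x / y) ltac:(apply Rdiv_lt_0_compat; auto)).
    unfold Rdiv in H. rewrite ln_mult, ln_Rinv in H by (auto; apply Rinv_0_lt_compat; auto).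
    replace ((x - y) / y) with (x * / y - 1) by (field; lra). lra.
Qed.

Lemma ln_second_diff (m : R) : 0 < m -> ln (m + 2) - 2 * ln (m + 1) + ln m = ln (1 - / (m + 1) ^ 2).
Proof.
  intros Hm. replace (1 - / (m + 1) ^ 2) with (m * (m + 2) * / ((m + 1) * (m + 1))) by (field; lra).
  rewrite !ln_mult, ln_Rinv, ln_mult; try nra. apply Rinv_0_lt_compat; nra.
Qed.

Lemma ln_second_diff_bounds (m : R) : 1 <= m ->
  / (m + 1) ^ 2 <= - (ln (m + 2) - 2 * ln (m + 1) + ln m) <= 2 * / (m + 1) ^ 2.
Proof.
  intros Hm. rewrite ln_second_diff by lra.
  assert (Hp : 0 < / (m + 1) ^ 2 <= / 4).
  { split; [apply Rinv_0_lt_compat; nra|apply Rinv_le_contravar; nra]. }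
  set (p := / (m + 1) ^ 2) in *.
  assert (H := ln_quotient_bounds 1 (1 - p) ltac:(lra) ltac:(lra)). rewrite ln_1 in H.
  assert ((1 - (1 - p)) / (1 - p) <= 2 * p).
  { apply Rmult_le_reg_r with (1 - p); [lra|]. unfold Rdiv. rewrite Rmult_assoc, Rinv_l by lra. nra. }
  lra.
Qed.

(** The expression is the second difference of log at m + d minus that at m, which is
    log((1-q)/(1-p)); as q <= p <= 1/4, it lies between p - q and 2(p - q). *)
Lemma ln_third_diff_bounds (m d : R) : 1 <= m -> 0 <= d ->
  let p := / (m + 1) ^ 2 in let q := / (m + d + 1) ^ 2 in
  p - q <= (ln (m + 2 + d) - ln (m + 2)) - 2 * (ln (m + 1 + d) - ln (m + 1)) + (ln (m + d) - ln m)
    <= 2 * (p - q).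
Proof.
  intros Hm Hd p q.
  replace ((ln (m + 2 + d) - ln (m + 2)) - 2 * (ln (m + 1 + d) - ln (m + 1)) + (ln (m + d) - ln m))
    with ((ln (m + d + 2) - 2 * ln (m + d + 1) + ln (m + d)) - (ln (m + 2) - 2 * ln (m + 1) + ln m))
    by (replace (m + d + 2) with (m + 2 + d) by ring; replace (m + d + 1) with (m + 1 + d) by ring; ring).
  rewrite !ln_second_diff by lra. fold p q.
  assert (Hp : 0 < p <= / 4).
  { split; [apply Rinv_0_lt_compat; nra|apply Rinv_le_contravar; nra]. }
  assert (Hq : 0 < q <= p).
  { split; [apply Rinv_0_lt_compat; nra|apply Rinv_le_contravar; nra]. }
  assert (H := ln_quotient_bounds (1 - q) (1 - p) ltac:(lra) ltac:(lra)).
  replace (1 - q - (1 - p)) with (p - q) in H by ring.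
  assert ((p - q) / (1 - p) <= 2 * (p - q)).
  { apply Rmult_le_reg_r with (1 - p); [lra|]. unfold Rdiv. rewrite Rmult_assoc, Rinv_l by lra. nra. }
  assert (p - q <= (p - q) / (1 - q)).
  { apply Rmult_le_reg_r with (1 - q); [lra|]. unfold Rdiv. rewrite Rmult_assoc, Rinv_l by lra. nra. }
  lra.
Qed.

(** With u and v the two inverses, u - v = d u v, so the difference of squares is d u v (u + v);
    both u and v lie between 1/(4N) and 1/N. *)
Lemma inv_square_diff_bounds (m d N : R) : 1 <= N -> N <= m -> m + 1 <= 3 * N -> 0 <= d <= N ->
  d / (32 * N ^ 3) <= / (m + 1) ^ 2 - / (m + d + 1) ^ 2 <= 2 * d / N ^ 3.
Proof.
  intros HN Hm Hm' Hd.
  set (u := / (m + 1)). set (v := / (m + d + 1)).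
  assert (Hu : / (4 * N) <= u <= / N).
  { split; apply Rinv_le_contravar; lra. }
  assert (Hv : / (4 * N) <= v <= / N).
  { split; apply Rinv_le_contravar; lra. }
  assert (E : / (m + 1) ^ 2 - / (m + d + 1) ^ 2 = d * (u * v * (u + v))) by (unfold u, v; field; lra).
  rewrite E. set (w := / N) in *.
  assert (Hw : 0 < w) by (apply Rinv_0_lt_compat; lra).
  assert (Hw4 : / (4 * N) = w / 4) by (unfold w; field; lra). rewrite Hw4 in *.
  replace (d / (32 * N ^ 3)) with (d * (w / 4 * (w / 4) * (w / 4 + w / 4))) by (unfold w; field; lra).
  replace (2 * d / N ^ 3) with (d * (w * w * (w + w))) by (unfold w; field; lra).
  split; (apply Rmult_le_compat_l; [lra|]); (apply Rmult_le_compat; [nra|nra| |lra]);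
    apply Rmult_le_compat; lra.
Qed.

(** The phase of (N + n)^(-it). For t > 0 its increments increase with n, as the tests above
    require. *)
Definition lphase (t : R) (N n : nat) : R := - (t * ln (INR (N + n))).

Lemma lphase_second_diff (t : R) (N n : nat) : (1 <= N)%nat ->
  lphase t N (S (S n)) - lphase t N (S n) - (lphase t N (S n) - lphase t N n)
  = t * - (ln (INR (N + n) + 2) - 2 * ln (INR (N + n) + 1) + ln (INR (N + n))).
Proof.
  intros HN. unfold lphase. rewrite !Nat.add_succ_r, !S_INR.
  replace (INR (N + n) + 1 + 1) with (INR (N + n) + 2) by ring. ring.
Qed.

Lemma INR_ge_1 (n : nat) : (1 <= n)%nat -> 1 <= INR n.
Proof. intros H. apply (le_INR 1 n) in H. exact H. Qed.

(** The second difference lies between t/(2N)^2 and 2t/N^2; hence d^2 = t/(4N^2) and the ratio 8. *)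
Lemma lphase_sum_second (t : R) (N M : nat) : 0 < t -> (1 <= N)%nat -> (M <= N)%nat ->
  Cmod (csum (fun n => cis (lphase t N n)) M) <= 108 * (sqrt t + INR N / sqrt t).
Proof.
  intros Ht HN HM. assert (HNr := INR_ge_1 N HN).
  assert (Hs : 0 < sqrt t) by (apply sqrt_lt_R0; auto).
  assert (Hss : sqrt t * sqrt t = t) by (apply sqrt_sqrt; lra).
  set (d := sqrt t / (2 * INR N)).
  assert (Hd : 0 < d) by (apply Rdiv_lt_0_compat; lra).
  eapply Rle_trans; [apply (second_diff_test _ d 8 M Hd); [lra|]|].
  - intros n Hn. rewrite lphase_second_diff by auto.
    assert (Hm : INR N <= INR (N + n)) by (apply le_INR; lia).
    assert (Hm2 : INR (N + n) + 1 <= 2 * INR N).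
    { rewrite <- S_INR. replace 2 with (INR 2) by (simpl; lra). rewrite <- mult_INR. apply le_INR; lia. }
    assert (H := ln_second_diff_bounds (INR (N + n)) ltac:(lra)).
    assert (Hlo : / (2 * INR N) ^ 2 <= / (INR (N + n) + 1) ^ 2) by (apply Rinv_le_contravar; nra).
    assert (Hup : / (INR (N + n) + 1) ^ 2 <= / (INR N) ^ 2) by (apply Rinv_le_contravar; nra).
    replace (d * d) with (t * / (2 * INR N) ^ 2) 
      by (transitivity (sqrt t * sqrt t * / (2 * INR N) ^ 2); [rewrite Hss; ring|unfold d; field; lra]).
    replace (8 * (t * / (2 * INR N) ^ 2)) with (t * (2 * / INR N ^ 2)) by (field; lra).
    split; apply Rmult_le_compat_l; lra.
  - assert (HMr : INR M <= INR N) by (apply le_INR; auto).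
    assert (Hdi : / d = 2 * (INR N / sqrt t)) by (unfold d; field; lra).
    rewrite Hdi. assert (HMd : INR M * d <= sqrt t / 2).
    { apply Rle_trans with (INR N * d); [apply Rmult_le_compat_r; lra|]. unfold d. right; field; lra. }
    assert (0 < INR N / sqrt t) by (apply Rdiv_lt_0_compat; lra). nra.
Qed.

(** For t <= N the increments lie between -1 and -t/(2N), away from the multiples of 2 PI, so
    Kuzmin-Landau applies after one shift by 2 PI. *)
Lemma lphase_sum_first (t : R) (N M : nat) : 0 < t -> t <= INR N -> (1 <= N)%nat -> (M <= N)%nat ->
  Cmod (csum (fun n => cis (lphase t N n)) M) <= 24 * INR N / t.
Proof.
  intros Ht HtN HN HM. assert (HNr := INR_ge_1 N HN).
  assert (HP := PI2_1). assert (HP4 := PI_4).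
  assert (Hb : t / (2 * INR N) <= / 2).
  { apply Rmult_le_reg_r with (2 * INR N); [lra|]. unfold Rdiv. rewrite Rmult_assoc, Rinv_l; lra. }
  assert (Hb0 : 0 < t / (2 * INR N)) by (apply Rdiv_lt_0_compat; lra).
  eapply Rle_trans; [apply (kuzmin_landau_mod (lphase t N) (t / (2 * INR N)) 1 M); [lra| |]|].
  - intros n Hn. unfold lphase. rewrite Nat.add_succ_r, S_INR.
    assert (Hm : INR N <= INR (N + n)) by (apply le_INR; lia).
    assert (Hm2 : INR (N + n) + 1 <= 2 * INR N).
    { rewrite <- S_INR. replace 2 with (INR 2) by (simpl; lra). rewrite <- mult_INR. apply le_INR; lia. }
    set (m := INR (N + n)) in *.
    assert (H := ln_quotient_bounds (m + 1) m ltac:(lra) ltac:(lra)).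
    replace (m + 1 - m) with 1 in H by ring.
    assert (H1 : / (2 * INR N) <= 1 / (m + 1)) by (unfold Rdiv; rewrite Rmult_1_l; apply Rinv_le_contravar; lra).
    assert (H2 : 1 / m <= / INR N) by (unfold Rdiv; rewrite Rmult_1_l; apply Rinv_le_contravar; lra).
    assert (H3 : t * / (2 * INR N) <= t * (ln (m + 1) - ln m)) by (apply Rmult_le_compat_l; lra).
    assert (H4 : t * (ln (m + 1) - ln m) <= t * / INR N) by (apply Rmult_le_compat_l; lra).
    assert (H5 : t * / INR N <= 1).
    { apply Rmult_le_reg_r with (INR N); [lra|]. rewrite Rmult_assoc, Rinv_l; lra. }
    unfold Rdiv in *. lra.
  - intros n Hn. assert (H := lphase_second_diff t N n HN).
    assert (Hm : INR N <= INR (N + n)) by (apply le_INR; lia).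
    assert (H0 := ln_second_diff_bounds (INR (N + n)) ltac:(lra)).
    assert (H1 : 0 < / (INR (N + n) + 1) ^ 2) by (apply Rinv_0_lt_compat; nra).
    assert (0 <= t * - (ln (INR (N + n) + 2) - 2 * ln (INR (N + n) + 1) + ln (INR (N + n))))
      by (apply Rmult_le_pos; lra). lra.
  - replace (3 * PI / (t / (2 * INR N))) with (6 * PI * (INR N / t)) by (field; lra).
    assert (0 < INR N / t) by (apply Rdiv_lt_0_compat; lra).
    replace (24 * INR N / t) with (24 * (INR N / t)) by (field; lra). nra.
Qed.

(** The product with the conjugate of a shift turns the third derivative of the phase into a second
    one, of order t d/N^3. The conjugate of the sum is taken to make the second difference positive;
    it lies between e^2 and 128 e^2. *)
Lemma lphase_correlation (t : R) (N M k d : nat) : 0 < t -> (1 <= N)%nat -> (M <= N)%nat ->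
  (1 <= d)%nat -> (k + d <= N)%nat ->
  let e := sqrt (t * INR d / (32 * INR N ^ 3)) in
  Cmod (csum (fun n => cis (lphase t N (n + (k + d))) * Cconj (cis (lphase t N (n + k))))%C M)
    <= 27 * (128 * INR M * e + / e).
Proof.
  intros Ht HN HM Hd Hkd e. assert (HNr := INR_ge_1 N HN). assert (Hdr := INR_ge_1 d Hd).
  assert (HN3 : 0 < INR N ^ 3) by (apply pow_lt; lra).
  assert (He0 : 0 < t * INR d / (32 * INR N ^ 3)).
  { apply Rdiv_lt_0_compat; nra. }
  assert (He : 0 < e) by (apply sqrt_lt_R0; auto).
  assert (Hee : e * e = t * INR d / (32 * INR N ^ 3)) by (apply sqrt_sqrt; lra).
  set (psi := fun n => lphase t N (n + k) - lphase t N (n + (k + d))).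
  rewrite <- Cmod_conj, csum_conj.
  rewrite (csum_ext _ (fun n => cis (psi n))).
  2:{ intros n _. unfold psi, Rminus. rewrite cis_plus, cis_opp, Cmult_conj, Cconj_conj. ring. }
  apply second_diff_test; [auto|lra|].
  intros n Hn. unfold psi, lphase.
  replace (N + (S (S n) + k))%nat with (S (S (N + n + k))) by lia.
  replace (N + (S n + k))%nat with (S (N + n + k)) by lia.
  replace (N + (n + k))%nat with (N + n + k)%nat by lia.
  replace (N + (S (S n) + (k + d)))%nat with (S (S (N + n + k)) + d)%nat by lia.
  replace (N + (S n + (k + d)))%nat with (S (N + n + k) + d)%nat by lia.
  replace (N + (n + (k + d)))%nat with (N + n + k + d)%nat by lia.
  rewrite !(plus_INR _ d), !S_INR.
  assert (Hm : INR N <= INR (N + n + k)) by (apply le_INR; lia).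
  assert (Hm2 : INR (N + n + k) + 1 <= 3 * INR N).
  { rewrite <- S_INR. replace 3 with (INR 3) by (simpl; lra). rewrite <- mult_INR. apply le_INR; lia. }
  assert (HdN : INR d <= INR N) by (apply le_INR; lia).
  set (m := INR (N + n + k)) in *.
  replace (m + 1 + 1) with (m + 2) by ring.
  assert (H := ln_third_diff_bounds m (INR d) ltac:(lra) ltac:(lra)).
  assert (H0 := inv_square_diff_bounds m (INR d) (INR N) ltac:(lra) ltac:(lra) ltac:(lra) ltac:(lra)).
  cbv zeta in H.
  match goal with |- _ <= ?x <= _ => replace x with
   (t * (ln (m + 2 + INR d) - ln (m + 2) - 2 * (ln (m + 1 + INR d) - ln (m + 1)) + (ln (m + INR d) - ln m)))
   by ring end.
  rewrite Hee.
  replace (t * INR d / (32 * INR N ^ 3)) with (t * (INR d / (32 * INR N ^ 3))) by (field; lra).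
  replace (128 * (t * (INR d / (32 * INR N ^ 3)))) with (t * (2 * (2 * INR d / INR N ^ 3))) by (field; lra).
  split; apply Rmult_le_compat_l; lra.
Qed.

(** Each step is 1/y <= 2(y - x) for x = sqrt H and y = sqrt(H + 1). *)
Lemma inv_sqrt_sum (H : nat) : rsum (fun d => / sqrt (INR (S d))) H <= 2 * sqrt (INR H).
Proof.
  induction H as [|H IH]; [simpl; rewrite sqrt_0; lra|].
  rewrite rsum_S. assert (Hp := pos_INR H). rewrite S_INR.
  set (x := sqrt (INR H)) in *. set (y := sqrt (INR H + 1)).
  assert (Hx : 0 <= x) by apply sqrt_pos.
  assert (Hy : 0 < y) by (apply sqrt_lt_R0; lra).
  assert (Hxx : x * x = INR H) by (apply sqrt_sqrt; lra).
  assert (Hyy : y * y = INR H + 1) by (apply sqrt_sqrt; lra).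
  assert (Hxy : x <= y) by (apply sqrt_le_1; lra).
  assert (/ y <= 2 * (y - x)); [|lra].
  apply Rmult_le_reg_r with y; [lra|]. rewrite Rinv_l by lra. nra.
Qed.

Lemma rsum_eq_shift (f : nat -> R) (H : nat) : rsum f (S H) = f 0%nat + rsum (fun k => f (S k)) H.
Proof.
  change (S H) with (1 + H)%nat. rewrite rsum_add. simpl rsum at 1. simpl Nat.add. ring.
Qed.

Lemma le_of_sq_le (x y : R) : 0 <= y -> x * x <= y * y -> x <= y.
Proof. intros Hy H. apply Rnot_lt_le. intros Hlt. nra. Qed.

(** Third-derivative test at t = p^6. A differencing length of about N/p^2 = N t^(-1/3) balances the
    diagonal against the main part of the correlations: both contribute a multiple of N p^2 to the
    square of the sum. *)
Lemma lphase_sum_third (p : R) (N M : nat) : 1 <= p -> p ^ 2 <= INR N -> (M <= N)%nat ->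
  Cmod (csum (fun n => cis (lphase (p ^ 6) N n)) M) <= 38 * (sqrt (INR N) * p) + 30 * (INR N / p).
Proof.
  intros Hp HpN HM.
  assert (Hp2 : 1 <= p ^ 2) by nra.
  assert (Hp0 : 0 < p ^ 2) by lra.
  assert (Hp6 : 0 < p ^ 6) by (apply pow_lt; lra).
  assert (HN : (1 <= N)%nat) by (destruct N; [simpl in HpN; lra|lia]).
  assert (HNr := INR_ge_1 N HN).
  assert (HN3 : 0 < INR N ^ 3) by (apply pow_lt; lra).
  set (Nr := INR N) in *.
  set (x := Nr / p ^ 2).
  assert (Hxp : x * p ^ 2 = Nr) by (unfold x; field; lra).
  assert (Hx1 : 1 <= x) by nra.
  assert (HxN : x <= Nr) by nra.
  destruct (nfloor_ex x) as [b Hb]; [lra|].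
  set (e := fun d : nat => sqrt (p ^ 6 * INR d / (32 * Nr ^ 3))).
  (* The zero shift has only the trivial bound. *)
  set (beta := fun d : nat => match d with O => Nr | S _ => 27 * (128 * Nr * e d + / e d) end).
  assert (Hepos : forall d, (1 <= d)%nat -> 0 < e d).
  { intros d Hd. apply sqrt_lt_R0. apply Rdiv_lt_0_compat; [|lra].
    apply Rmult_lt_0_compat; auto. apply INR_ge_1 in Hd; lra. }
  assert (Hbeta0 : forall d, 0 <= beta d).
  { intros [|d]; simpl; [lra|]. assert (H := Hepos (S d) ltac:(lia)).
    assert (0 < / e (S d)) by (apply Rinv_0_lt_compat; auto).
    apply Rmult_le_pos; [lra|]. apply Rplus_le_le_0_compat; [|lra]. apply Rmult_le_pos; lra. }
  destruct (van_der_corput_differencing (fun n => cis (lphase (p ^ 6) N n)) M (S b) beta)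
    as [X [HX0 [HXS HXX]]]; auto.
  { lia. }
  { intros n. rewrite Cmod_cis; lra. }
  { intros d k Hkd. destruct d as [|d].
    - simpl beta. eapply Rle_trans; [apply (Cmod_csum_le _ (fun _ => 1))|].
      + intros n _. rewrite Cmod_mult, Cmod_conj, !Cmod_cis. lra.
      + rewrite rsum_const, Rmult_1_r. apply le_INR; auto.
    - assert (Hle : (k + S d <= N)%nat).
      { apply INR_le. apply Rle_trans with (INR b); [apply le_INR; lia|]. fold Nr. lra. }
      eapply Rle_trans; [apply (lphase_correlation (p ^ 6) N M k (S d)); auto; lia|].
      fold Nr. fold (e (S d)). simpl beta.
      assert (H := Hepos (S d) ltac:(lia)).
      assert (INR M <= Nr) by (apply le_INR; auto).
      apply Rmult_le_compat_l; [lra|]. apply Rplus_le_compat_r. apply Rmult_le_compat_r; lra. }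
  assert (He_le : forall d, (1 <= d <= b)%nat -> Nr * e d <= p ^ 2 / 5).
  { intros d Hd. apply le_of_sq_le; [lra|].
    assert (Hee : e d * e d = p ^ 6 * INR d / (32 * Nr ^ 3)).
    { apply sqrt_sqrt. apply Rlt_le, Rdiv_lt_0_compat; [|lra].
      apply Rmult_lt_0_compat; auto. assert (H := INR_ge_1 d ltac:(lia)); lra. }
    replace (Nr * e d * (Nr * e d)) with (Nr * Nr * (e d * e d)) by ring. rewrite Hee.
    assert (Hdx : INR d <= x) by (apply Rle_trans with (INR b); [apply le_INR; lia|lra]).
    replace (Nr * Nr * (p ^ 6 * INR d / (32 * Nr ^ 3))) with (p ^ 6 / (32 * Nr) * INR d) by (field; lra).
    apply Rle_trans with (p ^ 6 / (32 * Nr) * x).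
    - apply Rmult_le_compat_l; auto. apply Rlt_le, Rdiv_lt_0_compat; lra.
    - replace (p ^ 6 / (32 * Nr) * x) with (p ^ 4 / 32) by (unfold x; field; lra).
      assert (0 < p ^ 4) by (apply pow_lt; lra).
      replace (p ^ 2 / 5 * (p ^ 2 / 5)) with (p ^ 4 / 25) by field. lra. }
  (* As [e d] is proportional to sqrt d, the sum of the inverses reduces to [inv_sqrt_sum]. *)
  assert (He_inv : forall d, (1 <= d)%nat -> / e d = / e 1%nat * / sqrt (INR d)).
  { intros d Hd. assert (Hd1 := INR_ge_1 d Hd). unfold e.
    replace (p ^ 6 * INR d / (32 * Nr ^ 3)) with (p ^ 6 * INR 1 / (32 * Nr ^ 3) * INR d) by (simpl; field; lra).
    rewrite sqrt_mult; [|simpl; apply Rlt_le, Rdiv_lt_0_compat; lra|lra]. apply Rinv_mult. }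
  assert (Hsum : rsum beta (S b) <= 693 * Nr + 324 * (Nr ^ 2 / p ^ 4)).
  { rewrite rsum_eq_shift.
    apply Rle_trans with (Nr + rsum (fun k => 692 * p ^ 2 + 27 * / e 1%nat * / sqrt (INR (S k))) b).
    { simpl beta at 1. apply Rplus_le_compat_l. apply rsum_le. intros k Hk. simpl beta.
      rewrite He_inv by lia. assert (H := He_le (S k) ltac:(lia)). lra. }
    rewrite rsum_plus, rsum_const, (rsum_scal (27 * / e 1%nat)).
    assert (H1 : INR b * (692 * p ^ 2) <= 692 * Nr).
    { rewrite <- Hxp. nra. }
    assert (H2 : / e 1%nat * rsum (fun k => / sqrt (INR (S k))) b <= 12 * (Nr ^ 2 / p ^ 4)).
    { assert (Hei : 0 < / e 1%nat) by (apply Rinv_0_lt_compat, Hepos; lia).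
      apply Rle_trans with (/ e 1%nat * (2 * sqrt (INR b))).
      { apply Rmult_le_compat_l; [lra|apply inv_sqrt_sum]. }
      assert (Hq : 0 < Nr ^ 2 / p ^ 4) by (apply Rdiv_lt_0_compat; apply pow_lt; lra).
      apply le_of_sq_le; [lra|].
      assert (Hb0 := pos_INR b).
      assert (Hsb : sqrt (INR b) * sqrt (INR b) = INR b) by (apply sqrt_sqrt; auto).
      assert (Hee : e 1%nat * e 1%nat = p ^ 6 / (32 * Nr ^ 3)).
      { unfold e. rewrite sqrt_sqrt; [simpl INR; field; lra|]. simpl INR. apply Rlt_le, Rdiv_lt_0_compat; lra. }
      replace (/ e 1%nat * (2 * sqrt (INR b)) * (/ e 1%nat * (2 * sqrt (INR b))))
        with (4 * (/ (e 1%nat * e 1%nat)) * (sqrt (INR b) * sqrt (INR b)))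
        by (field; apply Rgt_not_eq, Hepos; lia).
      rewrite Hee, Hsb.
      apply Rle_trans with (4 * / (p ^ 6 / (32 * Nr ^ 3)) * x).
      { apply Rmult_le_compat_l; [|lra]. apply Rmult_le_pos; [lra|].
        apply Rlt_le, Rinv_0_lt_compat, Rdiv_lt_0_compat; lra. }
      replace (4 * / (p ^ 6 / (32 * Nr ^ 3)) * x) with (128 * (Nr ^ 2 / p ^ 4 * (Nr ^ 2 / p ^ 4)))
        by (unfold x; field; lra).
      nra. }
    lra. }
  assert (HX2 : X * X <= 2 * p ^ 2 * (693 * Nr + 324 * (Nr ^ 2 / p ^ 4))).
  { eapply Rle_trans; [exact HXX|]. apply Rmult_le_compat.
    - apply Rmult_le_pos; [|left; apply Rinv_0_lt_compat, lt_0_INR; lia].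
      apply Rmult_le_pos; [lra|apply pos_INR].
    - apply rsum_pos; auto.
    - assert (HMr : INR M <= Nr) by (apply le_INR; auto). rewrite S_INR.
      apply Rmult_le_reg_r with (INR b + 1); [lra|].
      unfold Rdiv. rewrite Rmult_assoc, Rinv_l by lra. rewrite <- Hxp in HMr. nra.
    - exact Hsum. }
  set (nu := sqrt Nr) in *.
  assert (Hnu : nu * nu = Nr) by (apply sqrt_sqrt; lra).
  assert (Hnu0 : 0 <= nu) by apply sqrt_pos.
  assert (Hq : 0 < Nr / p) by (apply Rdiv_lt_0_compat; lra).
  assert (HXle : X <= 38 * (nu * p) + 26 * (Nr / p)).
  { assert (Hnp : 0 <= nu * p) by (apply Rmult_le_pos; lra).
    apply le_of_sq_le; [lra|]. eapply Rle_trans; [exact HX2|].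
    replace (2 * p ^ 2 * (693 * Nr + 324 * (Nr ^ 2 / p ^ 4)))
      with (1386 * ((nu * nu) * p ^ 2) + 648 * (Nr / p * (Nr / p))) by (rewrite Hnu; field; lra).
    assert (0 <= nu * p * (Nr / p)) by (apply Rmult_le_pos; lra).
    assert (0 <= nu * nu * p ^ 2) by nra. assert (0 <= Nr / p * (Nr / p)) by nra. nra. }
  assert (HH : 2 * INR (S b) <= 4 * (Nr / p)).
  { rewrite S_INR. assert (x <= Nr / p).
    { unfold x. apply Rmult_le_compat_l; [lra|]. apply Rinv_le_contravar; nra. }
    lra. }
  lra.
Qed.

(** Writing t = p^6 makes the limits between the ranges of N integer powers of p: up to t^(1/3) the
    trivial bound, up to t^(2/3) differencing, up to t the second-derivative test, up to t^2
    Kuzmin-Landau. Each of these stays below a multiple of sqrt N t^(1/6) in its range. *)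
Lemma lphase_sum_weyl (p : R) (N M : nat) : 1 <= p -> (1 <= N)%nat -> INR N <= p ^ 12 -> (M <= N)%nat ->
  Cmod (csum (fun n => cis (lphase (p ^ 6) N n)) M) <= 216 * (sqrt (INR N) * p).
Proof.
  intros Hp HN HNp HM. assert (HNr := INR_ge_1 N HN).
  set (Nr := INR N) in *. set (nu := sqrt Nr).
  assert (Hnu : nu * nu = Nr) by (apply sqrt_sqrt; lra).
  assert (Hnu0 : 0 <= nu) by apply sqrt_pos.
  assert (Hnu1 : 1 <= nu) by (apply le_of_sq_le; lra).
  assert (Hp2 : 1 <= p ^ 2) by nra.
  assert (Hp3 : 1 <= p ^ 3) by (simpl; nra).
  assert (Hp4 : 1 <= p ^ 4) by (replace (p ^ 4) with (p ^ 2 * p ^ 2) by ring; nra).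
  assert (Hp6 : 1 <= p ^ 6) by (replace (p ^ 6) with (p ^ 2 * p ^ 4) by ring; nra).
  assert (Hnp : 0 <= nu * p) by (apply Rmult_le_pos; lra).
  assert (HMr : INR M <= Nr) by (apply le_INR; auto).
  destruct (Rle_dec Nr (p ^ 2)) as [H1|H1].
  { eapply Rle_trans; [apply Cmod_csum_cis_le|].
    assert (nu <= p) by (apply le_of_sq_le; [lra|simpl in H1; lra]).
    assert (nu * nu <= nu * p) by (apply Rmult_le_compat_l; lra). lra. }
  destruct (Rle_dec Nr (p ^ 4)) as [H2|H2].
  { eapply Rle_trans; [apply lphase_sum_third; auto; fold Nr; lra|]. fold Nr nu.
    assert (nu <= p ^ 2) by (apply le_of_sq_le; [lra|replace (p ^ 2 * p ^ 2) with (p ^ 4) by ring; lra]).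
    assert (Nr / p <= nu * p).
    { apply Rmult_le_reg_r with p; [lra|]. unfold Rdiv. rewrite Rmult_assoc, Rinv_l by lra.
      simpl in *. nra. }
    lra. }
  destruct (Rle_dec Nr (p ^ 6)) as [H3|H3].
  { eapply Rle_trans; [apply lphase_sum_second; auto; lra|]. fold Nr.
    assert (Es : sqrt (p ^ 6) = p ^ 3).
    { replace (p ^ 6) with ((p ^ 3) * (p ^ 3)) by ring. apply sqrt_square; lra. }
    rewrite Es.
    assert (p ^ 2 <= nu) by (apply le_of_sq_le; [lra|replace (p ^ 2 * p ^ 2) with (p ^ 4) by ring; lra]).
    assert (nu <= p ^ 3) by (apply le_of_sq_le; [lra|replace (p ^ 3 * p ^ 3) with (p ^ 6) by ring; lra]).
    assert (p ^ 3 <= nu * p) by (replace (p ^ 3) with (p ^ 2 * p) by ring; nra).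
    assert (Nr / p ^ 3 <= nu * p).
    { apply Rmult_le_reg_r with (p ^ 3); [lra|]. unfold Rdiv. rewrite Rmult_assoc, Rinv_l by lra.
      rewrite Rmult_1_r. apply Rle_trans with (nu * p ^ 3); [nra|]. nra. }
    lra. }
  eapply Rle_trans; [apply lphase_sum_first; auto; fold Nr; lra|]. fold Nr.
  assert (nu <= p ^ 6) by (apply le_of_sq_le; [lra|replace (p ^ 6 * p ^ 6) with (p ^ 12) by ring; lra]).
  assert (Nr / p ^ 6 <= nu * p).
  { apply Rmult_le_reg_r with (p ^ 6); [lra|]. unfold Rdiv. rewrite Rmult_assoc, Rinv_l by lra.
    rewrite Rmult_1_r. apply Rle_trans with (nu * p ^ 6); [nra|].
    rewrite (Rmult_assoc nu p). apply Rmult_le_compat_l; [lra|].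
    rewrite <- (Rmult_1_l (p ^ 6)) at 1. apply Rmult_le_compat_r; lra. }
  unfold Rdiv in *. lra.
Qed.

(** Partial summation: the variation w 0 - w M and the last weight w M add up to w 0. *)
Lemma abel_weights (w : nat -> R) (a : nat -> C) (B : R) (M : nat) :
  (forall n, (n < M)%nat -> 0 <= w (S n) <= w n) -> 0 <= w 0%nat ->
  (forall m, (m <= M)%nat -> Cmod (csum a m) <= B) ->
  Cmod (csum (fun n => RtoC (w n) * a n)%C M) <= w 0%nat * B.
Proof.
  intros Hw Hw0 Ha.
  assert (H : Cmod (csum (fun n => RtoC (w n) * a n) M - RtoC (w M) * csum a M)%C <= (w 0%nat - w M) * B
              /\ 0 <= w M).
  { induction M as [|M IH].
    - split; auto. simpl. replace (0 - RtoC (w 0%nat) * 0)%C with (RtoC 0) by ring. rewrite Cmod_0; lra.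
    - destruct IH as [IH1 IH2]; [intros; apply Hw; lia|intros; apply Ha; lia|].
      assert (HM := Hw M ltac:(lia)). split; [|lra].
      assert (E : (csum (fun n => RtoC (w n) * a n) (S M) - RtoC (w (S M)) * csum a (S M))%C
        = ((csum (fun n => RtoC (w n) * a n) M - RtoC (w M) * csum a M)
           + RtoC (w M - w (S M)) * csum a (S M))%C) by (rewrite !csum_S, RtoC_minus; ring).
      rewrite E. eapply Rle_trans; [apply Cmod_triangle|].
      rewrite Cmod_mult, Cmod_R, Rabs_pos_eq by lra.
      assert (HB := Ha (S M) ltac:(lia)).
      assert ((w M - w (S M)) * Cmod (csum a (S M)) <= (w M - w (S M)) * B)
        by (apply Rmult_le_compat_l; lra). lra. }
  destruct H as [H HM].
  replace (csum (fun n => RtoC (w n) * a n) M)%C with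
    ((csum (fun n => RtoC (w n) * a n) M - RtoC (w M) * csum a M) + RtoC (w M) * csum a M)%C by ring.
  eapply Rle_trans; [apply Cmod_triangle|].
  rewrite Cmod_mult, Cmod_R, Rabs_pos_eq by lra.
  assert (HB := Ha M (Nat.le_refl M)).
  assert (w M * Cmod (csum a M) <= w M * B) by (apply Rmult_le_compat_l; lra). lra.
Qed.

Lemma Rcpow_cis (m s t : R) : 0 < m ->
  Rcpow m (- (RtoC s + Ci * RtoC t)) = (RtoC (Rpower m (- s)) * cis (- (t * ln m)))%C.
Proof.
  intros Hm. unfold Rcpow, Cexp, Rpower, cis, RtoC, Ci, Copp, Cplus, Cmult, Re, Im; simpl.
  f_equal.
  - replace (ln m * - (s + (0 * t - 1 * 0)) - 0 * - (0 + (0 * 0 + 1 * t))) with (- s * ln m) by ring.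
    replace (ln m * - (0 + (0 * 0 + 1 * t)) + 0 * - (s + (0 * t - 1 * 0))) with (- (t * ln m)) by ring. ring.
  - replace (ln m * - (s + (0 * t - 1 * 0)) - 0 * - (0 + (0 * 0 + 1 * t))) with (- s * ln m) by ring.
    replace (ln m * - (0 + (0 * 0 + 1 * t)) + 0 * - (s + (0 * t - 1 * 0))) with (- (t * ln m)) by ring. ring.
Qed.

(** The largest weight N^(-1/2) cancels the sqrt N of the phase sum, so every dyadic block costs the
    same t^(1/6). *)
Lemma weyl_dyadic_block (p : R) (N M : nat) : 1 <= p -> (1 <= N)%nat -> INR N <= p ^ 12 -> (M <= N)%nat ->
  Cmod (csum (fun n => Rcpow (INR (N + n)) (- (RtoC (/ 2) + Ci * RtoC (p ^ 6)))) M) <= 216 * p.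
Proof.
  intros Hp HN HNp HM. assert (HNr := INR_ge_1 N HN).
  assert (Hpos : forall n, 1 <= INR (N + n)) by (intros; apply INR_ge_1; lia).
  rewrite (csum_ext _ (fun n => RtoC (Rpower (INR (N + n)) (- / 2)) * cis (lphase (p ^ 6) N n))%C).
  2:{ intros n _. rewrite Rcpow_cis; [reflexivity|]. specialize (Hpos n); lra. }
  eapply Rle_trans; [apply (abel_weights (fun n => Rpower (INR (N + n)) (- / 2))
     (fun n => cis (lphase (p ^ 6) N n)) (216 * (sqrt (INR N) * p)))|].
  - intros n _. split; [left; apply exp_pos|].
    unfold Rpower. apply exp_le.
    assert (ln (INR (N + n)) <= ln (INR (N + S n))).
    { apply ln_le; [specialize (Hpos n); lra|apply le_INR; lia]. }
    lra.
  - left; apply exp_pos.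
  - intros m Hm. apply lphase_sum_weyl; auto; lia.
  - rewrite Nat.add_0_r. rewrite Rpower_Ropp, Rpower_sqrt by lra.
    right. field. apply Rgt_not_eq, sqrt_lt_R0; lra.
Qed.

(** * The zeta function on the critical line and to its right *)

Lemma Re_csum (a : nat -> C) (n : nat) : Re (csum a n) = rsum (fun k => Re (a k)) n.
Proof. induction n as [|n IH]; [reflexivity|]. rewrite csum_S, rsum_S, re_plus, IH. reflexivity. Qed.

Lemma Im_csum (a : nat -> C) (n : nat) : Im (csum a n) = rsum (fun k => Im (a k)) n.
Proof. induction n as [|n IH]; [reflexivity|]. rewrite csum_S, rsum_S, im_plus, IH. reflexivity. Qed.

Lemma sum_n_rsum (a : nat -> R) (n : nat) : sum_n a n = rsum a (S n).
Proof.
  induction n as [|n IH].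
  - rewrite sum_O. simpl; ring.
  - rewrite sum_Sn, IH, (rsum_S a (S n)). reflexivity.
Qed.

Lemma rsum_lim (a : nat -> R) : ex_series a -> is_lim_seq (rsum a) (Series a).
Proof.
  intros H. apply is_lim_seq_incr_1.
  apply (is_lim_seq_ext (sum_n a)); [intros; apply sum_n_rsum|].
  apply (Series_correct a H).
Qed.

(** A majorant of the form g n - g (n+1), with g tending to 0, yields convergence and, in the lemmas
    that follow, the bound g N for the tail. *)
Lemma ex_series_telescope (a : nat -> R) (g : nat -> R) (N : nat) :
  (forall n, (N <= n)%nat -> Rabs (a n) <= g n - g (S n)) -> is_lim_seq g 0 -> ex_series a.
Proof.
  intros Ha Hg. apply (ex_series_incr_n a N).
  apply (ex_series_le (fun k => a (N + k)%nat) (fun k => g (N + k)%nat - g (S (N + k)))).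
  - intros n. apply Ha; lia.
  - exists (g N - 0).
    change (is_lim_seq (sum_n (fun k => g (N + k)%nat - g (S (N + k)))) (Finite (g N - 0))).
    apply (is_lim_seq_ext (fun n => g N - g (n + S N)%nat)).
    + intros n. rewrite sum_n_rsum.
      rewrite (rsum_ext _ (fun k => (- g (N + S k)%nat) - (- g (N + k)%nat))).
      * rewrite (rsum_telescope (fun k => - g (N + k)%nat)), Nat.add_0_r.
        replace (n + S N)%nat with (N + S n)%nat by lia. ring.
      * intros k _. rewrite Nat.add_succ_r. ring.
    + apply is_lim_seq_minus'; [apply is_lim_seq_const|].
      apply (is_lim_seq_incr_n g (S N)). exact Hg.
Qed.

(** [Series] is total, so it is known to be a limit only once convergence is established; the
    majorant supplies this for both components. *)
Lemma CSeries_lim (a : nat -> C) (g : nat -> R) (N : nat) :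
  (forall n, (N <= n)%nat -> Cmod (a n) <= g n - g (S n)) -> is_lim_seq g 0 ->
  is_lim_seq (fun n => Cmod (CSeries a - csum a n)) 0.
Proof.
  intros Ha Hg.
  assert (H1 : ex_series (fun n => Re (a n))).
  { apply (ex_series_telescope _ g N); auto. intros n Hn.
    eapply Rle_trans; [apply re_le_Cmod|auto]. }
  assert (H2 : ex_series (fun n => Im (a n))).
  { apply (ex_series_telescope _ g N); auto. intros n Hn.
    eapply Rle_trans; [apply Im_le_Cmod|auto]. }
  apply rsum_lim in H1. apply rsum_lim in H2.
  apply (is_lim_seq_le_le (fun _ => 0) _ (fun n => Rabs (Series (fun n => Re (a n)) - rsum (fun k => Re (a k)) n)
     + Rabs (Series (fun n => Im (a n)) - rsum (fun k => Im (a k)) n))).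
  - intros n. split; [apply Cmod_ge_0|]. eapply Rle_trans; [apply Cmod_le_Re_Im|].
    rewrite <- Re_csum, <- Im_csum. apply Req_le. reflexivity.
  - apply is_lim_seq_const.
  - replace (Finite 0) with (Finite (Rabs (Series (fun n => Re (a n)) - Series (fun n => Re (a n)))
      + Rabs (Series (fun n => Im (a n)) - Series (fun n => Im (a n)))))
      by (f_equal; rewrite !Rminus_diag, Rabs_R0; ring).
    apply is_lim_seq_plus'; apply (is_lim_seq_abs _ (Finite _)); apply is_lim_seq_minus'; auto; apply is_lim_seq_const.
Qed.

Lemma telescope_nonneg (a : nat -> C) (g : nat -> R) (N : nat) (n : nat) :
  (forall n, (N <= n)%nat -> Cmod (a n) <= g n - g (S n)) -> is_lim_seq g 0 ->
  (N <= n)%nat -> 0 <= g n.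
Proof.
  intros Ha Hg Hn. apply (is_lim_seq_le (fun k => g (k + n)%nat) (fun _ => g n) 0 (g n)).
  - intros k. induction k as [|k IH]; [simpl; lra|].
    assert (H := Ha (k + n)%nat ltac:(lia)). assert (H0 := Cmod_ge_0 (a (k + n)%nat)).
    simpl. lra.
  - apply (is_lim_seq_incr_n g n). exact Hg.
  - apply is_lim_seq_const.
Qed.

Lemma csum_telescope_tail (a : nat -> C) (g : nat -> R) (N : nat) (n : nat) :
  (forall n, (N <= n)%nat -> Cmod (a n) <= g n - g (S n)) -> is_lim_seq g 0 ->
  (N <= n)%nat -> Cmod (csum a n - csum a N) <= g N.
Proof.
  intros Ha Hg Hn. replace n with (N + (n - N))%nat by lia. rewrite csum_add.
  match goal with |- Cmod (?x + ?y - ?x)%C <= _ => replace (x + y - x)%C with y by ring end.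
  eapply Rle_trans; [apply (Cmod_csum_le _ (fun k => (- g (N + S k)%nat) - (- g (N + k)%nat)))|].
  - intros k _. assert (H := Ha (N + k)%nat ltac:(lia)). rewrite Nat.add_succ_r. lra.
  - rewrite (rsum_telescope (fun k => - g (N + k)%nat)), Nat.add_0_r.
    assert (H := telescope_nonneg a g N (N + (n - N)) Ha Hg ltac:(lia)). lra.
Qed.

Lemma CSeries_tail (a : nat -> C) (g : nat -> R) (N : nat) :
  (forall n, (N <= n)%nat -> Cmod (a n) <= g n - g (S n)) -> is_lim_seq g 0 ->
  Cmod (CSeries a - csum a N) <= g N.
Proof.
  intros Ha Hg.
  apply (is_lim_seq_le_loc (fun _ => Cmod (CSeries a - csum a N))
    (fun n => Cmod (CSeries a - csum a n) + g N) (Cmod (CSeries a - csum a N)) (g N)).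
  - exists N. intros n Hn.
    replace (CSeries a - csum a N)%C with ((CSeries a - csum a n) + (csum a n - csum a N))%C by ring.
    eapply Rle_trans; [apply Cmod_triangle|].
    assert (H := csum_telescope_tail a g N n Ha Hg Hn). lra.
  - apply is_lim_seq_const.
  - replace (Finite (g N)) with (Finite (0 + g N)) by (f_equal; ring).
    apply is_lim_seq_plus'; [apply (CSeries_lim a g N Ha Hg)|apply is_lim_seq_const].
Qed.

(** * Finite approximations of zeta *)

Lemma Cmod_Rcpow (m : R) (w : C) : Cmod (Rcpow m w) = Rpower m (Re w).
Proof.
  unfold Rcpow. rewrite Cmod_Cexp, re_scal_l. unfold Rpower. f_equal. ring.
Qed.

Lemma Rcpow_plus (m : R) (w z : C) : Rcpow m (w + z) = (Rcpow m w * Rcpow m z)%C.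
Proof. unfold Rcpow. rewrite <- Cexp_plus. f_equal. ring. Qed.

Lemma Rcpow_1 (m : R) : 0 < m -> Rcpow m 1 = RtoC m.
Proof.
  intros Hm. unfold Rcpow, Cexp, RtoC, Cmult; simpl.
  replace (ln m * 1 - 0 * 0) with (ln m) by ring. replace (ln m * 0 + 0 * 1) with 0 by ring.
  rewrite exp_ln, cos_0, sin_0 by auto. f_equal; ring.
Qed.

Lemma Rcpow_base_1 (w : C) : Rcpow 1 w = 1%C.
Proof. unfold Rcpow. rewrite ln_1, Cmult_0_l. apply Cexp_0. Qed.

Lemma cder_Rcpow (m h : R) (w : C) : 0 < m + h ->
  cder (fun r => Rcpow (m + r) w) h (w * Rcpow (m + h) (w - 1))%C.
Proof.
  intros Hm. unfold Rcpow at 1. eapply cder_eq.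
  - apply cder_exp. apply cder_mult; [|apply cder_const].
    apply cder_RtoC. apply (is_derive_comp_R ln (fun r => m + r) h (/ (m + h)) 1).
    + apply is_derive_ln; auto.
    + auto_derive; auto.
  - cbv beta. fold (Rcpow (m + h) w).
    replace w with ((w - 1) + 1)%C at 2 by ring. rewrite Rcpow_plus, Rcpow_1 by auto.
    rewrite Rmult_1_l, RtoC_inv by lra. field; try apply RtoC_neq_0; lra.
Qed.

Lemma Rpower_le_base_neg (m h a : R) : 0 < m -> 0 <= h -> a <= 0 -> Rpower (m + h) a <= Rpower m a.
Proof.
  intros Hm Hh Ha. unfold Rpower. apply exp_le.
  assert (ln m <= ln (m + h)) by (apply ln_le; lra). nra.
Qed.

Definition zterm (s : C) (n : nat) : C :=
  let m := INR (S n) in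
  (Rcpow m (- s) - (Rcpow m (1 - s) - Rcpow (m + 1) (1 - s)) / (s - 1))%C.

(** The approximant for which contours are moved: holomorphic off s = 1, and uniformly close to zeta
    on bounded sets that avoid s = 1 and on which Re s is bounded below by a positive number. *)
Definition zetaN (N : nat) (s : C) : C := (/ (s - 1) + csum (zterm s) N)%C.

(** The mean value inequality is used twice: over an interval of length h the term has derivative
    m^(-s) - (m+h)^(-s), and this in turn is at most h |s| m^(-Re s - 1). *)
Lemma zterm_bound (s : C) (n : nat) : (s - 1)%C <> 0%C -> 0 <= Re s ->
  Cmod (zterm s n) <= Cmod s * Rpower (INR (S n)) (- Re s - 1).
Proof.
  intros Hs Hre. assert (Hm := INR_ge_1 (S n) ltac:(lia)).
  set (m := INR (S n)) in *. set (B := Cmod s * Rpower m (- Re s - 1)).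
  assert (HB : 0 <= B) by (apply Rmult_le_pos; [apply Cmod_ge_0|left; apply exp_pos]).
  assert (H1 : forall h, 0 <= h -> Cmod (Rcpow (m + h) (- s) - Rcpow (m + 0) (- s)) <= h * B - 0 * B).
  { intros h Hh.
    apply (cder_mvi (fun r => Rcpow (m + r) (- s)) (fun r => - s * Rcpow (m + r) (- s - 1))%C
      (fun r => r * B) (fun _ => B)); auto.
    - intros x Hx. apply cder_Rcpow. lra.
    - intros x _. auto_derive; auto. ring.
    - intros x Hx. rewrite Cmod_mult, Cmod_opp, Cmod_Rcpow. unfold B.
      apply Rmult_le_compat_l; [apply Cmod_ge_0|].
      replace (Re (- s - 1)) with (- Re s - 1) by (unfold Re; simpl; ring).
      apply Rpower_le_base_neg; lra. }
  (* [D h] is the term with the unit interval replaced by one of length h. *)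
  set (D := fun h => (RtoC h * Rcpow m (- s) - (Rcpow m (1 - s) - Rcpow (m + h) (1 - s)) / (s - 1))%C).
  replace (zterm s n) with (D 1 - D 0)%C.
  2:{ unfold D, zterm. cbv zeta. fold m. rewrite Rplus_0_r. unfold Cdiv. ring. }
  apply Rle_trans with (1 * B - 0 * B); [|lra].
  apply (cder_mvi D (fun h => Rcpow m (- s) - Rcpow (m + h) (- s))%C (fun r => r * B) (fun _ => B)); [lra| | |].
  - intros x Hx. unfold D. eapply cder_eq.
    + apply cder_minus.
      * apply cder_mult; [apply cder_id|apply cder_const].
      * unfold Cdiv. apply cder_mult; [|apply cder_const].
        apply cder_minus; [apply cder_const|apply cder_Rcpow; lra].
    + cbv beta. replace (1 - s - 1)%C with (- s)%C by ring. field. exact Hs.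
  - intros x _. auto_derive; auto. ring.
  - intros x Hx. specialize (H1 x ltac:(lra)). rewrite Rplus_0_r in H1.
    rewrite Cmod_minus_sym. nra.
Qed.

(** The integrals telescope, leaving the Dirichlet polynomial and one boundary power; sizes are read
    off from this form. *)
Lemma zetaN_explicit (N : nat) (s : C) : (s - 1)%C <> 0%C ->
  zetaN N s = (csum (fun n => Rcpow (INR (S n)) (- s)) N + Rcpow (INR (S N)) (1 - s) / (s - 1))%C.
Proof.
  intros Hs. unfold zetaN, zterm. cbv zeta. rewrite csum_minus.
  rewrite (csum_ext (fun n => (Rcpow (INR (S n)) (1 - s) - Rcpow (INR (S n) + 1) (1 - s)) / (s - 1))%C
    (fun n => (- / (s - 1)) * (Rcpow (INR (S (S n))) (1 - s) - Rcpow (INR (S n)) (1 - s)))%C).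
  - rewrite csum_scal, (csum_telescope (fun n => Rcpow (INR (S n)) (1 - s))).
    replace (INR 1) with 1 by reflexivity. rewrite Rcpow_base_1. field. exact Hs.
  - intros n _. rewrite (S_INR (S n)). field. exact Hs.
Qed.

(** Integral comparison for x^(-a-1), in the form required of a telescoping majorant. *)
Lemma Rpower_telescope (n : nat) (a : R) : (1 <= n)%nat -> 0 < a ->
  Rpower (INR (S n)) (- a - 1) <= Rpower (INR n) (- a) / a - Rpower (INR (S n)) (- a) / a.
Proof.
  intros Hn Ha. assert (Hm := INR_ge_1 n Hn). rewrite S_INR. set (m := INR n) in *.
  set (B := Rpower (m + 1) (- a - 1)).
  assert (H : - (Rpower (m + 0) (- a) / a) - 0 * B <= - (Rpower (m + 1) (- a) / a) - 1 * B).
  2:{ rewrite Rplus_0_r in H. lra. }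
  apply (incr_of_derive_nonneg (fun r => - (Rpower (m + r) (- a) / a) - r * B)
    (fun r => Rpower (m + r) (- a - 1) - B)); [lra| |].
  - intros x Hx. unfold Rpower at 1. auto_derive; [lra|].
    unfold Rpower. replace ((- a - 1) * ln (m + x)) with (- a * ln (m + x) + - ln (m + x)) by ring.
    rewrite exp_plus, exp_Ropp, exp_ln by lra. field. lra.
  - intros x Hx. assert (B <= Rpower (m + x) (- a - 1)); [|lra].
    unfold B. replace (m + 1) with (m + x + (1 - x)) by ring. apply Rpower_le_base_neg; lra.
Qed.

Lemma is_lim_seq_Rpower_neg (a : R) : 0 < a -> is_lim_seq (fun n => Rpower (INR n) (- a)) 0.
Proof.
  intros Ha. apply (is_lim_seq_spec _ 0). intros eps.
  destruct (nfloor_ex (exp (- ln eps / a))) as [N HN]; [left; apply exp_pos|].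
  exists (S N). intros n Hn. rewrite Rminus_0_r, Rabs_pos_eq by (left; apply exp_pos).
  assert (Hlt : exp (- ln eps / a) < INR n).
  { apply Rlt_le_trans with (INR N + 1); [lra|]. rewrite <- S_INR. apply le_INR; auto. }
  unfold Rpower. rewrite <- (exp_ln eps) at 1 by apply cond_pos. apply exp_increasing.
  assert (H : - ln eps / a < ln (INR n)).
  { rewrite <- (ln_exp (- ln eps / a)). apply ln_increasing; auto. apply exp_pos. }
  apply Rmult_lt_compat_l with (r := a) in H; auto.
  replace (a * (- ln eps / a)) with (- ln eps) in H by (field; lra). lra.
Qed.

Lemma zeta_approx (N : nat) (s : C) : (1 <= N)%nat -> (s - 1)%C <> 0%C -> 0 < Re s ->
  Cmod (zeta s - zetaN N s) <= Cmod s * Rpower (INR N) (- Re s) / Re s.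
Proof.
  intros HN Hs Hre.
  replace (zeta s - zetaN N s)%C with (CSeries (zterm s) - csum (zterm s) N)%C.
  2:{ unfold zeta, zetaN. change (CSeries _) with (CSeries (zterm s)) at 2. ring. }
  apply (CSeries_tail (zterm s) (fun n => Cmod s * Rpower (INR n) (- Re s) / Re s) N).
  - intros n Hn. eapply Rle_trans; [apply zterm_bound; auto; lra|].
    assert (H := Rpower_telescope n (Re s) ltac:(lia) Hre).
    assert (H0 := Cmod_ge_0 s). unfold Rdiv in *.
    rewrite !Rmult_assoc, <- Rmult_minus_distr_l. apply Rmult_le_compat_l; auto.
  - replace (Finite 0) with (Finite (Cmod s / Re s * 0)) by (f_equal; ring).
    apply (is_lim_seq_ext (fun n => Cmod s / Re s * Rpower (INR n) (- Re s))).
    + intros n. field. lra.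
    + apply (is_lim_seq_scal_l _ _ (Finite 0)). apply is_lim_seq_Rpower_neg; auto.
Qed.

Lemma Cmod_s_minus_1_ge (s : C) : Rabs (Im s) <= Cmod (s - 1).
Proof.
  eapply Rle_trans; [|apply Im_le_Cmod]. unfold Im; simpl. right; f_equal; ring.
Qed.

Lemma s_minus_1_neq (s : C) : Im s <> 0 -> (s - 1)%C <> 0%C.
Proof.
  intros H. apply Cmod_gt_0. eapply Rlt_le_trans; [|apply Cmod_s_minus_1_ge]. apply Rabs_pos_lt; auto.
Qed.

Lemma Rpower_neg_le_inv_sqrt (m a : R) : 1 <= m -> / 2 <= a -> Rpower m (- a) <= / sqrt m.
Proof.
  intros Hm Ha. rewrite <- Rpower_sqrt, <- Rpower_Ropp by lra.
  apply Rle_Rpower; lra.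
Qed.

(** N is taken just above |Im s|: the truncation error |s| N^(-1/2), the sum of n^(-1/2) and the
    boundary power are then at most of order sqrt |Im s|. The range of Re s covers 1/2 + sigma for
    sigma < 2. *)
Lemma zeta_bound_strip (s : C) : / 2 <= Re s <= 3 -> 1 <= Rabs (Im s) ->
  Cmod (zeta s) <= 13 * sqrt (Rabs (Im s)).
Proof.
  intros Hre Him. set (v := Rabs (Im s)) in *.
  assert (Hs : (s - 1)%C <> 0%C).
  { apply s_minus_1_neq. intros E. unfold v in Him. rewrite E, Rabs_R0 in Him. lra. }
  destruct (nfloor_ex v) as [b Hb]; [lra|].
  set (N := S b). assert (HN : v < INR N <= 2 * v) by (unfold N; rewrite S_INR; lra).
  assert (HN1 : (1 <= N)%nat) by (unfold N; lia).
  set (r := sqrt v).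
  assert (Hr : 1 <= r) by (unfold r; rewrite <- sqrt_1; apply sqrt_le_1; lra).
  assert (Hrr : r * r = v) by (apply sqrt_sqrt; lra).
  replace (zeta s) with ((zeta s - zetaN N s) + zetaN N s)%C by ring.
  eapply Rle_trans; [apply Cmod_triangle|].
  assert (Hcs : Cmod s <= 4 * v).
  { eapply Rle_trans; [apply Cmod_le_Re_Im|]. rewrite Rabs_pos_eq by lra. fold v. lra. }
  assert (Hcs0 := Cmod_ge_0 s).
  assert (HsN : r <= sqrt (INR N)) by (apply sqrt_le_1; lra).
  assert (H1 : Cmod (zeta s - zetaN N s) <= 8 * r).
  { eapply Rle_trans; [apply zeta_approx; auto; lra|].
    assert (Ha := Rpower_neg_le_inv_sqrt (INR N) (Re s) ltac:(lra) ltac:(lra)).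
    assert (Hb' : / sqrt (INR N) <= / r) by (apply Rinv_le_contravar; lra).
    assert (Hc : / Re s <= 2) by (rewrite <- (Rinv_inv 2); apply Rinv_le_contravar; lra).
    apply Rle_trans with (4 * v * / r * 2).
    - apply Rmult_le_compat; [|left; apply Rinv_0_lt_compat; lra| |lra].
      + apply Rmult_le_pos; [auto|left; apply exp_pos].
      + apply Rmult_le_compat; auto; [left; apply exp_pos|lra].
    - right. rewrite <- Hrr. field. lra. }
  assert (H2 : Cmod (zetaN N s) <= 5 * r).
  { rewrite zetaN_explicit by auto. eapply Rle_trans; [apply Cmod_triangle|].
    replace (5 * r) with (3 * r + 2 * r) by ring. apply Rplus_le_compat.
    - eapply Rle_trans; [apply (Cmod_csum_le _ (fun n => / sqrt (INR (S n))))|].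
      + intros k _. rewrite Cmod_Rcpow, re_opp. apply Rpower_neg_le_inv_sqrt; [apply INR_ge_1; lia|lra].
      + eapply Rle_trans; [apply inv_sqrt_sum|].
        assert (sqrt (INR N) <= 3 / 2 * r).
        { apply le_of_sq_le; [lra|]. rewrite sqrt_sqrt by lra. nra. }
        lra.
    - unfold Cdiv. rewrite Cmod_mult, Cmod_Rcpow.
      assert (Ha : Cmod (/ (s - 1)) <= / v).
      { apply Cmod_inv_le; [lra|apply Cmod_s_minus_1_ge]. }
      assert (Hb' : Rpower (INR (S N)) (Re (1 - s)) <= 2 * r).
      { apply Rle_trans with (sqrt (INR (S N))).
        - rewrite <- Rpower_sqrt by (apply lt_0_INR; lia).
          apply Rle_Rpower; [apply INR_ge_1; lia|]. unfold Re; simpl. unfold Re in Hre. lra.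
        - apply le_of_sq_le; [lra|]. rewrite sqrt_sqrt by apply pos_INR. rewrite S_INR. nra. }
      apply Rle_trans with (2 * r * / v).
      + apply Rmult_le_compat; auto; [left; apply exp_pos|apply Cmod_ge_0].
      + rewrite <- (Rmult_1_r (2 * r)) at 2. apply Rmult_le_compat_l; [lra|].
        rewrite <- Rinv_1. apply Rinv_le_contravar; lra. }
  lra.
Qed.

(** Valid at all heights on the line of integration of [U], for the tails. At low heights N = 1 is
    enough, the pole s = 1 being at distance at least 1/4. *)
Lemma zeta_bound_three_quarters (v : R) : Cmod (zeta (3 / 4, v)) <= 13 * (1 + Rabs v).
Proof.
  destruct (Rle_dec 1 (Rabs v)) as [H|H].
  - eapply Rle_trans; [apply zeta_bound_strip; simpl; lra|]. simpl Im.
    assert (sqrt (Rabs v) <= Rabs v).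
    { apply le_of_sq_le; [lra|]. rewrite sqrt_sqrt by lra. nra. }
    lra.
  - set (s := (3 / 4, v) : C).
    assert (Hs4 : / 4 <= Cmod (s - 1)).
    { eapply Rle_trans; [|apply re_le_Cmod]. unfold s, Re; simpl.
      rewrite Rabs_left; lra. }
    assert (Hs : (s - 1)%C <> 0%C) by (apply (Cmod_ge_neq_0 _ (/ 4)); lra).
    assert (Hcs : Cmod s <= 2).
    { eapply Rle_trans; [apply Cmod_le_Re_Im|]. unfold s; simpl. rewrite (Rabs_pos_eq (3 / 4)) by lra. lra. }
    replace (zeta s) with ((zeta s - zetaN 1 s) + zetaN 1 s)%C by ring.
    eapply Rle_trans; [apply Cmod_triangle|].
    assert (H1 : Cmod (zeta s - zetaN 1 s) <= 3).
    { eapply Rle_trans; [apply zeta_approx; auto; simpl; lra|].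
      replace (INR 1) with 1 by reflexivity. unfold Rpower. rewrite ln_1, Rmult_0_r, exp_0.
      unfold s at 2; simpl. lra. }
    assert (H2 : Cmod (zetaN 1 s) <= 6).
    { unfold zetaN. eapply Rle_trans; [apply Cmod_triangle|].
      assert (Ha := Cmod_inv_le _ (/ 4) ltac:(lra) Hs4). rewrite Rinv_inv in Ha.
      simpl csum. rewrite Cplus_0_l.
      assert (Hb := zterm_bound s 0 Hs ltac:(unfold s; simpl; lra)).
      replace (INR 1) with 1 in Hb by reflexivity. unfold Rpower in Hb. rewrite ln_1, Rmult_0_r, exp_0 in Hb. lra. }
    assert (0 <= Rabs v) by apply Rabs_pos. lra.
Qed.

(** * Weyl's bound on the critical line *)

Lemma zeta_dyadic_sum (p : R) (K : nat) : 1 <= p -> INR (2 ^ K) <= 2 * p ^ 12 ->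
  Cmod (csum (fun n => Rcpow (INR (S n)) (- (RtoC (/ 2) + Ci * RtoC (p ^ 6)))) (2 ^ K - 1)) <= INR K * (216 * p).
Proof.
  intros Hp. induction K as [|K IH]; intros HK.
  - simpl. rewrite Cmod_0; lra.
  - assert (H2K : (1 <= 2 ^ K)%nat) by (assert (H := Nat.pow_nonzero 2 K); lia).
    assert (HK2 : INR (2 ^ K) <= p ^ 12).
    { rewrite Nat.pow_succ_r', mult_INR in HK. simpl (INR 2) in HK. lra. }
    assert (H0 := pos_INR (2 ^ K)).
    replace (2 ^ S K - 1)%nat with ((2 ^ K - 1) + 2 ^ K)%nat by (rewrite Nat.pow_succ_r'; lia).
    rewrite csum_add, S_INR. eapply Rle_trans; [apply Cmod_triangle|].
    assert (IH' := IH ltac:(lra)).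
    assert (H := weyl_dyadic_block p (2 ^ K) (2 ^ K) Hp H2K HK2 (Nat.le_refl _)).
    rewrite (csum_ext (fun k => Rcpow (INR (S (2 ^ K - 1 + k))) (- (RtoC (/ 2) + Ci * RtoC (p ^ 6))))
      (fun n => Rcpow (INR (2 ^ K + n)) (- (RtoC (/ 2) + Ci * RtoC (p ^ 6)))))
      by (intros; f_equal; f_equal; lia).
    lra.
Qed.

Lemma ln_2_bounds : / 2 <= ln 2 <= 1.
Proof.
  assert (H := ln_quotient_bounds 2 1 ltac:(lra) ltac:(lra)). rewrite ln_1 in H.
  replace ((2 - 1) / 2) with (/ 2) in H by field. replace ((2 - 1) / 1) with 1 in H by field. lra.
Qed.

(** The sum is continued to a length of order t^2, where the truncation error, of order t N^(-1/2),
    is bounded. This takes about 2 log t/log 2 dyadic blocks and costs only a logarithm. *)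
Lemma zeta_weyl_log (p : R) : 1 <= p ->
  Cmod (zeta (RtoC (/ 2) + Ci * RtoC (p ^ 6))) <= 216 * p * (24 * ln p + 1) + 14.
Proof.
  intros Hp. set (t := p ^ 6).
  assert (Hln2 := ln_2_bounds).
  assert (Ht : 1 <= t) by (apply pow_R1_Rle; auto).
  assert (Ht12 : t * t = p ^ 12) by (unfold t; ring).
  assert (Hlp : 0 <= ln p) by (rewrite <- ln_1; apply ln_le; lra).
  set (x := 12 * ln p / ln 2).
  assert (Hx : 0 <= x) by (apply Rmult_le_pos; [lra|left; apply Rinv_0_lt_compat; lra]).
  (* n is the largest exponent with 2^n <= p^12 = t^2. *)
  destruct (nfloor_ex x Hx) as [n Hn].
  assert (Hpow : forall k, INR (2 ^ k) = exp (INR k * ln 2)).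
  { intros k. rewrite pow_INR. simpl (INR 2). replace (1 + 1) with 2 by ring.
    rewrite <- Rpower_pow by lra. reflexivity. }
  assert (Hp12 : p ^ 12 = exp (x * ln 2)).
  { unfold x. replace (12 * ln p / ln 2 * ln 2) with (INR 12 * ln p) by (simpl; field; lra).
    rewrite <- Rpower_pow by lra. reflexivity. }
  assert (Hlo : INR (2 ^ n) <= p ^ 12).
  { rewrite Hpow, Hp12. apply exp_le. apply Rmult_le_compat_r; lra. }
  assert (Hup : p ^ 12 <= INR (2 ^ S n)).
  { rewrite Hpow, Hp12. apply exp_le. rewrite S_INR. apply Rmult_le_compat_r; lra. }
  assert (E2 : INR (2 ^ S n) = 2 * INR (2 ^ n)).
  { rewrite Nat.pow_succ_r', mult_INR. simpl (INR 2). ring. }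
  set (s := (RtoC (/ 2) + Ci * RtoC t)%C).
  assert (Hres : Re s = / 2) by (unfold s, Re; simpl; ring).
  assert (Hims : Im s = t) by (unfold s, Im; simpl; ring).
  assert (Hs : (s - 1)%C <> 0%C) by (apply s_minus_1_neq; lra).
  assert (Hcs : Cmod s <= 2 * t).
  { eapply Rle_trans; [apply Cmod_le_Re_Im|]. rewrite Hres, Hims, !Rabs_pos_eq; lra. }
  assert (Hcs0 := Cmod_ge_0 s).
  set (N := (2 ^ S n - 1)%nat).
  assert (H2n : (1 <= 2 ^ n)%nat) by (assert (H := Nat.pow_nonzero 2 n); lia).
  assert (HN : (2 ^ n <= N)%nat) by (unfold N; rewrite Nat.pow_succ_r'; lia).
  assert (HSN : S N = (2 ^ S n)%nat) by (unfold N; rewrite Nat.pow_succ_r'; lia).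
  assert (HNr : t * t / 2 <= INR N) by (apply Rle_trans with (INR (2 ^ n)); [lra|apply le_INR; auto]).
  assert (HN1 := INR_ge_1 N ltac:(lia)).
  replace (zeta s) with ((zeta s - zetaN N s) + zetaN N s)%C by ring.
  eapply Rle_trans; [apply Cmod_triangle|].
  assert (H1 : Cmod (zeta s - zetaN N s) <= 8).
  { eapply Rle_trans; [apply zeta_approx; auto; [lia|lra]|]. rewrite Hres.
    assert (Ha := Rpower_neg_le_inv_sqrt (INR N) (/ 2) HN1 ltac:(lra)).
    assert (Hq : t / 2 <= sqrt (INR N)).
    { apply le_of_sq_le; [apply sqrt_pos|]. rewrite sqrt_sqrt by lra. nra. }
    assert (Hb : / sqrt (INR N) <= / (t / 2)) by (apply Rinv_le_contravar; lra).
    assert (Hc : Cmod s * Rpower (INR N) (- / 2) <= 2 * t * / (t / 2)).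
    { apply Rmult_le_compat; auto; [left; apply exp_pos|lra]. }
    replace (2 * t * / (t / 2)) with 4 in Hc by (field; lra). lra. }
  assert (H2 : Cmod (zetaN N s) <= INR (S n) * (216 * p) + 2).
  { rewrite zetaN_explicit by auto. eapply Rle_trans; [apply Cmod_triangle|]. apply Rplus_le_compat.
    - apply zeta_dyadic_sum; auto. lra.
    - unfold Cdiv. rewrite Cmod_mult, Cmod_Rcpow, HSN.
      replace (Re (1 - s)) with (/ 2) by (change (Re (1 - s)) with (1 + - Re s); lra).
      rewrite Rpower_sqrt by (apply lt_0_INR; rewrite <- HSN; lia).
      assert (Ha : Cmod (/ (s - 1)) <= / t).
      { apply Cmod_inv_le; [lra|]. assert (H := Cmod_s_minus_1_ge s). rewrite Hims, Rabs_pos_eq in H; lra. }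
      assert (Hb : sqrt (INR (2 ^ S n)) <= 2 * t).
      { apply le_of_sq_le; [lra|]. rewrite sqrt_sqrt by apply pos_INR. nra. }
      apply Rle_trans with (2 * t * / t); [|right; field; lra].
      apply Rmult_le_compat; auto; [apply sqrt_pos|apply Cmod_ge_0]. }
  assert (Hxle : x <= 24 * ln p).
  { unfold x. apply Rmult_le_reg_r with (ln 2); [lra|]. unfold Rdiv. rewrite Rmult_assoc, Rinv_l by lra. nra. }
  rewrite S_INR in H2.
  assert ((INR n + 1) * (216 * p) <= (24 * ln p + 1) * (216 * p)) by (apply Rmult_le_compat_r; lra).
  lra.
Qed.

(** Weyl's bound is kappa = 1/6; the Lindelof hypothesis supplies kappa = 0. *)
Definition critical_line_bound (kappa : R) : Prop :=
  forall delta : R, 0 < delta -> exists K T : R, 0 < T /\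
    forall t : R, T <= t -> Cmod (zeta (RtoC (/ 2) + Ci * RtoC t)) <= K * Rpower t (kappa + delta).

(** The logarithm is absorbed into t^d through d ln t <= t^d. *)
Lemma critical_line_bound_weyl : critical_line_bound (1 / 6).
Proof.
  intros d Hd. exists (216 * (4 / d + 1) + 14), 1. split; [lra|]. intros t Ht.
  set (p := Rpower t (/ 6)).
  assert (Hp6 : p ^ 6 = t).
  { unfold p. rewrite <- Rpower_pow by apply exp_pos. rewrite Rpower_mult.
    replace (/ 6 * INR 6) with 1 by (simpl; field). apply Rpower_1; lra. }
  assert (Hlt : 0 <= ln t) by (rewrite <- ln_1; apply ln_le; lra).
  assert (Hlp : ln p = ln t / 6) by (unfold p, Rpower; rewrite ln_exp; field).
  assert (Hp : 1 <= p) by (rewrite <- exp_0; apply exp_le; nra).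
  assert (H := zeta_weyl_log p Hp). rewrite Hp6 in H.
  eapply Rle_trans; [exact H|].
  set (q := Rpower t d).
  assert (Hq : 1 <= q) by (rewrite <- exp_0; apply exp_le; nra).
  assert (Hlq : ln t <= q / d).
  { assert (H0 := exp_ineq1_le (d * ln t)). unfold q, Rpower.
    apply Rmult_le_reg_r with d; auto. unfold Rdiv. rewrite Rmult_assoc, Rinv_l by lra. lra. }
  replace (1 / 6 + d) with (/ 6 + d) by field. rewrite Rpower_plus. fold p q.
  rewrite Hlp. replace (24 * (ln t / 6) + 1) with (4 * ln t + 1) by field.
  assert (H1 : 4 * ln t + 1 <= (4 / d + 1) * q).
  { replace ((4 / d + 1) * q) with (4 * (q / d) + q) by (field; lra). lra. }
  assert (H2 : p * (4 * ln t + 1) <= p * ((4 / d + 1) * q)) by (apply Rmult_le_compat_l; lra).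
  assert (H3 : 1 <= p * q) by nra. nra.
Qed.

(** * Second-order expansion of the theta function *)

(** Lets an auxiliary truncation parameter tend to infinity, here for partial Euler products and
    later for [zetaN]. *)
Lemma le_of_le_plus_inv (x y c : R) (N0 : nat) :
  (forall N, (N0 <= N)%nat -> (1 <= N)%nat -> x <= y + c / INR N) -> x <= y.
Proof.
  intros H. apply Rnot_lt_le. intros Hlt.
  destruct (nfloor_ex (Rabs c / (x - y))) as [n Hn].
  { apply Rmult_le_pos; [apply Rabs_pos|left; apply Rinv_0_lt_compat; lra]. }
  set (N := (S n + N0)%nat).
  assert (HN : Rabs c / (x - y) < INR N).
  { apply Rlt_le_trans with (INR n + 1); [lra|]. rewrite <- S_INR. apply le_INR. unfold N; lia. }
  assert (HN1 := INR_ge_1 N ltac:(unfold N; lia)).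
  specialize (H N ltac:(unfold N; lia) ltac:(unfold N; lia)).
  assert (Rabs c < INR N * (x - y)).
  { apply Rmult_lt_reg_r with (/ (x - y)); [apply Rinv_0_lt_compat; lra|].
    rewrite Rmult_assoc, Rinv_r by lra. unfold Rdiv in HN. lra. }
  assert (c / INR N < x - y).
  { apply Rmult_lt_reg_r with (INR N); [lra|]. unfold Rdiv. rewrite Rmult_assoc, Rinv_l by lra.
    assert (Hc := Rle_abs c). lra. }
  lra.
Qed.

Definition lgterm (z : C) (n : nat) : C :=
  let k := INR (S n) in (z * RtoC (ln (1 + / k)) - CLog (1 + z / RtoC k))%C.

Definition lgN (N : nat) (z : C) : C := (- CLog z + csum (lgterm z) N)%C.

Lemma ln_1_plus_inv (k : R) : 1 <= k -> Rabs (ln (1 + / k) - / k) <= / k ^ 2.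
Proof.
  intros Hk. assert (H0 : 0 < / k) by (apply Rinv_0_lt_compat; lra).
  assert (H := ln_quotient_bounds (1 + / k) 1 ltac:(lra) ltac:(lra)). rewrite ln_1 in H.
  replace ((1 + / k - 1) / (1 + / k)) with (/ (k + 1)) in H by (field; lra).
  replace ((1 + / k - 1) / 1) with (/ k) in H by (field; lra).
  assert (/ k - / (k + 1) <= / k ^ 2).
  { replace (/ k - / (k + 1)) with (/ (k * (k + 1))) by (field; lra). apply Rinv_le_contravar; nra. }
  apply Rabs_le. lra.
Qed.

(** The parts z/k cancel; what is left is z times ln(1 + 1/k) - 1/k and the second-order remainder
    of the complex logarithm, both O(1/k^2). *)
Lemma lgterm_bound (z : C) (n : nat) : 2 * Cmod z <= INR (S n) ->
  Cmod (lgterm z n) <= (Cmod z + Cmod z ^ 2) / INR (S n) ^ 2.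
Proof.
  intros Hk. assert (Hk1 := INR_ge_1 (S n) ltac:(lia)). unfold lgterm. cbv zeta.
  set (k := INR (S n)) in *.
  assert (Hkc : RtoC k <> 0%C) by (apply RtoC_neq_0; lra).
  assert (Hm : Cmod (z / RtoC k) = Cmod z / k) by (rewrite Cmod_div, Cmod_R, Rabs_pos_eq; auto; lra).
  assert (Hw : Cmod (z / RtoC k) <= / 2).
  { rewrite Hm. apply Rmult_le_reg_r with k; [lra|]. unfold Rdiv. rewrite Rmult_assoc, Rinv_l; lra. }
  assert (H1 := CLog_taylor1 _ Hw). rewrite Hm in H1.
  assert (H2 := ln_1_plus_inv k Hk1).
  replace (z * RtoC (ln (1 + / k)) - CLog (1 + z / RtoC k))%C
    with (z * RtoC (ln (1 + / k) - / k) - (CLog (1 + z / RtoC k) - z / RtoC k))%C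
    by (rewrite RtoC_minus, RtoC_inv by lra; field; auto).
  eapply Rle_trans; [apply Cmod_minus_le|]. rewrite Cmod_mult, Cmod_R.
  replace ((Cmod z + Cmod z ^ 2) / k ^ 2) with (Cmod z * / k ^ 2 + (Cmod z / k) ^ 2) by (field; lra).
  apply Rplus_le_compat; auto. apply Rmult_le_compat_l; auto. apply Cmod_ge_0.
Qed.

Lemma is_lim_seq_div_INR (c : R) : is_lim_seq (fun n => c / INR n) 0.
Proof.
  replace (Finite 0) with (Rbar_mult c 0) by (simpl; f_equal; ring).
  apply is_lim_seq_scal_l.
  apply (is_lim_seq_ext (fun n => / INR n)); [reflexivity|].
  replace (Finite 0) with (Rbar_inv p_infty) by reflexivity.
  apply is_lim_seq_inv; [apply is_lim_seq_INR|discriminate].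
Qed.

Lemma lnGamma_approx (N : nat) (z : C) : (1 <= N)%nat -> 2 * Cmod z <= INR N ->
  Cmod (lnGamma z - lgN N z) <= (Cmod z + Cmod z ^ 2) / INR N.
Proof.
  intros HN Hz.
  replace (lnGamma z - lgN N z)%C with (CSeries (lgterm z) - csum (lgterm z) N)%C.
  2:{ unfold lnGamma, lgN. change (CSeries _) with (CSeries (lgterm z)) at 2. ring. }
  set (c := Cmod z + Cmod z ^ 2).
  assert (Hc : 0 <= c) by (assert (H := Cmod_ge_0 z); unfold c; nra).
  apply (CSeries_tail (lgterm z) (fun n => c / INR n) N); [|apply is_lim_seq_div_INR].
  intros n Hn. assert (Hn1 := INR_ge_1 n ltac:(lia)).
  eapply Rle_trans; [apply lgterm_bound|].
  - rewrite S_INR. assert (INR N <= INR n) by (apply le_INR; auto). lra.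
  - fold c. rewrite S_INR.
    replace (c / INR n - c / (INR n + 1)) with (c * / (INR n * (INR n + 1))) by (field; lra).
    apply Rmult_le_compat_l; auto. apply Rinv_le_contravar; nra.
Qed.

Lemma RtoC_ln_telescope (N : nat) :
  csum (fun n => RtoC (ln (1 + / INR (S n)))) N = RtoC (ln (INR (S N))).
Proof.
  rewrite (csum_ext _ (fun n => RtoC (ln (INR (S (S n)))) - RtoC (ln (INR (S n))))%C).
  - rewrite (csum_telescope (fun n => RtoC (ln (INR (S n))))).
    replace (INR 1) with 1 by reflexivity. rewrite ln_1. ring.
  - intros n _. rewrite <- RtoC_minus. f_equal.
    assert (H := INR_ge_1 (S n) ltac:(lia)). rewrite (S_INR (S n)). set (k := INR (S n)) in *.
    replace (1 + / k) with ((k + 1) * / k) by (field; lra).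
    rewrite ln_mult, ln_Rinv; [ring|lra|lra|apply Rinv_0_lt_compat; lra].
Qed.

(** * Increments of log Gamma from the truncated Euler product *)

Lemma Cmod_z_plus_ge (z : C) (k : R) : 0 <= Re z -> 0 <= k ->
  Rabs (Im z) + k <= 3 / 2 * Cmod (z + RtoC k).
Proof.
  intros Hz Hk. apply le_of_sq_le.
  { assert (H := Cmod_ge_0 (z + RtoC k)). lra. }
  replace (3 / 2 * Cmod (z + RtoC k) * (3 / 2 * Cmod (z + RtoC k)))
    with (9 / 4 * (Cmod (z + RtoC k) * Cmod (z + RtoC k))) by field.
  rewrite Cmod_sq.
  replace (Re (z + RtoC k)) with (Re z + k) by (unfold Re; simpl; ring).
  replace (Im (z + RtoC k)) with (Im z) by (unfold Im; simpl; ring).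
  assert (Rabs (Im z) * Rabs (Im z) = Im z * Im z) by (rewrite <- Rabs_mult, Rabs_pos_eq; nra).
  assert (HY := Rabs_pos (Im z)). set (Y := Rabs (Im z)) in *.
  assert (k * k <= (Re z + k) * (Re z + k)) by nra.
  assert (0 <= (Y - k) * (Y - k)) by apply Rle_0_sqr.
  assert (0 <= Y * Y) by apply Rle_0_sqr. assert (0 <= k * k) by apply Rle_0_sqr. lra.
Qed.

(** |z + k| is comparable to |Im z| + k, and its inverse cube is dominated by 1/|Im z| times a
    telescoping difference. This is the source of the order t^(-2) of the error in theta. *)
Lemma sum_inv_cube (z : C) (n : nat) : 0 <= Re z -> 2 <= Rabs (Im z) ->
  rsum (fun k => Cmod (/ (z + RtoC (INR k))) ^ 3) n <= 7 / Im z ^ 2.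
Proof.
  intros Hz Hy. rewrite <- (pow2_abs (Im z)). set (y := Rabs (Im z)) in *.
  apply Rle_trans with (rsum (fun k => 27 / 8 * / y * (- / (y + INR (S k) - 1) - - / (y + INR k - 1))) n).
  - apply rsum_le. intros k _. assert (Hk := pos_INR k).
    assert (H := Cmod_z_plus_ge z (INR k) Hz Hk). fold y in H.
    assert (H1 : Cmod (/ (z + RtoC (INR k))) <= 3 / 2 * / (y + INR k)).
    { replace (3 / 2 * / (y + INR k)) with (/ (2 / 3 * (y + INR k))) by (field; lra).
      apply Cmod_inv_le; lra. }
    assert (H2 := pow_incr _ _ 3 (conj (Cmod_ge_0 _) H1)).
    eapply Rle_trans; [exact H2|]. rewrite S_INR.
    replace (- / (y + (INR k + 1) - 1) - - / (y + INR k - 1)) with (/ ((y + INR k) * (y + INR k - 1)))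
      by (field; lra).
    replace ((3 / 2 * / (y + INR k)) ^ 3) with (27 / 8 * / (y + INR k) * / (y + INR k) ^ 2) by (field; lra).
    apply Rmult_le_compat.
    + assert (0 < / (y + INR k)) by (apply Rinv_0_lt_compat; lra). lra.
    + left; apply Rinv_0_lt_compat; nra.
    + apply Rmult_le_compat_l; [lra|]. apply Rinv_le_contravar; lra.
    + apply Rinv_le_contravar; nra.
  - rewrite rsum_scal, (rsum_telescope (fun k => - / (y + INR k - 1))).
    assert (Hn := pos_INR n).
    assert (H1 : 0 < / (y + INR n - 1)) by (apply Rinv_0_lt_compat; lra).
    assert (H2 : / (y + INR 0 - 1) <= 2 * / y).
    { simpl INR. replace (2 * / y) with (/ (y / 2)) by (field; lra). apply Rinv_le_contravar; lra. }
    assert (H3 : 0 < / y) by (apply Rinv_0_lt_compat; lra).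
    apply Rle_trans with (27 / 8 * / y * (2 * / y)).
    + apply Rmult_le_compat_l; lra.
    + replace (7 / y ^ 2) with (7 * (/ y * / y)) by (field; lra). nra.
Qed.

(** log w - 1/(2w) is the beginning of the asymptotic expansion of the digamma function, whose
    increment from w to w + 1 is exactly 1/w; the truncation costs O(|w|^(-3)). Sums of 1/(z + k)
    thus telescope up to cubes. *)
Lemma digamma_step (w : C) : 2 <= Cmod w -> 0 < Re w ->
  Cmod ((CLog (w + 1) - / (2 * (w + 1))) - (CLog w - / (2 * w)) - / w) <= 2 * Cmod (/ w) ^ 3.
Proof.
  intros Hw Hre. assert (Hw0 : w <> 0%C) by (apply (Cmod_ge_neq_0 _ 2); lra).
  assert (Ho := Cmod_inv_le w 2 ltac:(lra) Hw).
  set (o := (/ w)%C) in *.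
  assert (E1 : CLog (w + 1) = (CLog w + CLog (1 + o))%C).
  { unfold o. replace (/ w)%C with (1 / w)%C by (unfold Cdiv; ring). apply CLog_quotient; auto.
    - rewrite re_plus. simpl. lra.
    - unfold Cdiv. rewrite Cmult_1_l. exact Ho. }
  assert (Ho2 := Cmod_one_plus_ge o 1 Ho ltac:(lra)). rewrite Cmult_1_l in Ho2.
  assert (Hn : (1 + o)%C <> 0%C) by (apply (Cmod_ge_neq_0 _ (/ 2)); lra).
  assert (Hw1 : (w + 1)%C <> 0%C).
  { replace (w + 1)%C with (w * (1 + o))%C by (unfold o; field; auto). apply Cmult_neq_0; auto. }
  assert (E : ((CLog (w + 1) - / (2 * (w + 1))) - (CLog w - / (2 * w)) - o)%C
     = ((CLog (1 + o) - o + o * o / 2) - o * (o * o) * (/ (1 + o) * / 2))%C).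
  { rewrite E1. unfold o in *. field. repeat split; auto. }
  rewrite E. eapply Rle_trans; [apply Cmod_minus_le|].
  assert (H1 := CLog_taylor2 o Ho). rewrite !Cmod_mult.
  assert (H2 := Cmod_inv_le _ (/ 2) ltac:(lra) Ho2). rewrite Rinv_inv in H2.
  assert (H3 : Cmod (/ 2) = / 2) by (rewrite Cmod_inv, Cmod_R, Rabs_pos_eq; [auto|lra|apply RtoC_neq_0; lra]).
  rewrite H3. assert (H0 := Cmod_ge_0 o).
  assert (0 <= Cmod o * (Cmod o * Cmod o)) by (repeat apply Rmult_le_pos; auto).
  replace (2 * Cmod o ^ 3) with (Cmod o ^ 3 + Cmod o * (Cmod o * Cmod o)) by ring. nra.
Qed.

(** The analogue for 1/w^2, with -1/w as approximate primitive. *)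
Lemma inv_step (w : C) : 2 <= Cmod w ->
  Cmod (/ w - / (w + 1) - / w * / w) <= 2 * Cmod (/ w) ^ 3.
Proof.
  intros Hw. assert (Hw0 : w <> 0%C) by (apply (Cmod_ge_neq_0 _ 2); lra).
  assert (Ho := Cmod_inv_le w 2 ltac:(lra) Hw).
  set (o := (/ w)%C) in *.
  assert (Ho2 := Cmod_one_plus_ge o 1 Ho ltac:(lra)). rewrite Cmult_1_l in Ho2.
  assert (Hn : (1 + o)%C <> 0%C) by (apply (Cmod_ge_neq_0 _ (/ 2)); lra).
  assert (Hw1 : (w + 1)%C <> 0%C).
  { replace (w + 1)%C with (w * (1 + o))%C by (unfold o; field; auto). apply Cmult_neq_0; auto. }
  assert (E : (o - / (w + 1) - o * o)%C = (- (o * (o * o) * / (1 + o)))%C).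
  { unfold o in *. field. repeat split; auto. }
  rewrite E, Cmod_opp, !Cmod_mult.
  assert (H2 := Cmod_inv_le _ (/ 2) ltac:(lra) Ho2). rewrite Rinv_inv in H2.
  assert (H0 := Cmod_ge_0 o).
  assert (0 <= Cmod o * (Cmod o * Cmod o)) by (repeat apply Rmult_le_pos; auto).
  replace (2 * Cmod o ^ 3) with (Cmod o * (Cmod o * Cmod o) * 2) by ring.
  apply Rmult_le_compat_l; auto.
Qed.

(** All points lie in the right half plane and |h/(z + k)| <= 1/2, so [CLog_quotient] splits the
    principal logarithms without any multiple of 2 PI i. The term -log z supplies k = 0, whence N +
    1 summands. *)
Lemma lgN_shift (N : nat) (z h : C) : 0 < Re z -> 0 < Re (z + h) -> 2 * Cmod h <= Rabs (Im z) ->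
  0 < Rabs (Im z) ->
  (lgN N (z + h) - lgN N z)%C =
  (h * RtoC (ln (INR (S N))) - csum (fun k => CLog (1 + h / (z + RtoC (INR k)))) (S N))%C.
Proof.
  intros Hz Hzh Hh Hy.
  assert (Hle : forall k, 0 <= k -> Rabs (Im z) <= Cmod (z + RtoC k)).
  { intros k Hk. eapply Rle_trans; [|apply Im_le_Cmod]. unfold Im; simpl. rewrite Rplus_0_r; lra. }
  assert (Hquot : forall k, 0 <= k -> Cmod (h / (z + RtoC k)) <= / 2).
  { intros k Hk. specialize (Hle k Hk).
    rewrite Cmod_div by (apply (Cmod_ge_neq_0 _ (Rabs (Im z))); auto).
    apply Rmult_le_reg_r with (Cmod (z + RtoC k)); [lra|].
    unfold Rdiv. rewrite Rmult_assoc, Rinv_l; lra. }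
  assert (E0 : csum (fun k => CLog (1 + h / (z + RtoC (INR k)))) (S N) =
    (CLog (1 + h / z) + csum (fun k => CLog (1 + h / (z + RtoC (INR (S k))))) N)%C).
  { change (S N) with (1 + N)%nat. rewrite csum_add. simpl csum at 1. simpl INR at 1.
    rewrite !Cplus_0_r, Cplus_0_l. f_equal. }
  rewrite E0. unfold lgN. rewrite <- RtoC_ln_telescope, <- csum_scal.
  assert (Hz0 := Hquot 0 ltac:(lra)). rewrite Cplus_0_r in Hz0.
  rewrite (CLog_quotient z h) by auto.
  replace (- (CLog z + CLog (1 + h / z)) + csum (lgterm (z + h)) N - (- CLog z + csum (lgterm z) N))%C
    with (- CLog (1 + h / z) + (csum (lgterm (z + h)) N - csum (lgterm z) N))%C by ring.
  rewrite <- csum_minus.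
  match goal with |- (?a + _ = ?x - (?b + ?y))%C => replace (x - (b + y))%C with (a + (x - y))%C by ring end.
  f_equal. rewrite <- csum_minus. apply csum_ext. intros n _. unfold lgterm. cbv zeta.
  assert (Hk := INR_ge_1 (S n) ltac:(lia)). set (k := INR (S n)) in *.
  assert (Hkc : RtoC k <> 0%C) by (apply RtoC_neq_0; lra).
  assert (Hzk : (z + RtoC k)%C <> 0%C) by (apply (Cmod_ge_neq_0 _ (Rabs (Im z))); auto; apply Hle; lra).
  assert (Hqk := Hquot k ltac:(lra)).
  assert (Hs : forall w, 0 < Re w -> 0 < Re (1 + w / RtoC k)).
  { intros w Hw. rewrite re_plus. unfold Cdiv. rewrite <- RtoC_inv by lra. rewrite re_scal_r. simpl.
    assert (0 < / k) by (apply Rinv_0_lt_compat; lra). nra. }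
  assert (Eq : (h / RtoC k / (1 + z / RtoC k))%C = (h / (z + RtoC k))%C).
  { field. repeat split; auto. }
  assert (E : CLog (1 + (z + h) / RtoC k) = (CLog (1 + z / RtoC k) + CLog (1 + h / (z + RtoC k)))%C).
  { rewrite <- Eq. rewrite <- CLog_quotient; [f_equal; field; auto|apply Hs; auto| |].
    - replace (1 + z / RtoC k + h / RtoC k)%C with (1 + (z + h) / RtoC k)%C by (field; auto). apply Hs; auto.
    - rewrite Eq; auto. }
  rewrite E. ring.
Qed.

Definition digamma_main (w : C) : C := (CLog w - / (2 * w))%C.

Lemma Re_RtoC (x : R) : Re (RtoC x) = x.
Proof. reflexivity. Qed.

(** Each logarithm is expanded to second order in h/(z + k), and the sums of 1/(z + k) and of its
    square are replaced by telescoped expressions. All three errors are bounded by multiples of the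
    sum of |z + k|^(-3). *)
Lemma log_sum_expansion (z h : C) (n : nat) : 0 < Re z -> 2 <= Rabs (Im z) -> 2 * Cmod h <= Rabs (Im z) ->
  Cmod (csum (fun k => CLog (1 + h / (z + RtoC (INR k)))) n
    - (h * (digamma_main (z + RtoC (INR n)) - digamma_main z)
       - h * h / 2 * (/ z - / (z + RtoC (INR n)))))
  <= 7 * (Cmod h ^ 3 + Cmod h ^ 2 + 2 * Cmod h) / Im z ^ 2.
Proof.
  intros Hz Hy Hh.
  set (w := fun k : nat => (z + RtoC (INR k))%C).
  assert (Hw : forall k, Rabs (Im z) <= Cmod (w k)).
  { intros k. eapply Rle_trans; [|apply Im_le_Cmod]. unfold w, Im; simpl. rewrite Rplus_0_r; lra. }
  assert (Hwre : forall k, 0 < Re (w k)).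
  { intros k. unfold w. rewrite re_plus, Re_RtoC. assert (H := pos_INR k). lra. }
  assert (HwS : forall k, w (S k) = (w k + 1)%C).
  { intros k. unfold w. rewrite S_INR, RtoC_plus. ring. }
  assert (Hw0 : w 0%nat = z) by (unfold w; simpl; ring).
  assert (Hwne : forall k, w k <> 0%C) by (intros k; apply (Cmod_ge_neq_0 _ 2); [lra|specialize (Hw k); lra]).
  set (e0 := fun k => (CLog (1 + h / w k) - h / w k + (h / w k) * (h / w k) / 2)%C).
  set (e1 := fun k => (digamma_main (w (S k)) - digamma_main (w k) - / w k)%C).
  set (e2 := fun k => (/ w k - / w (S k) - / w k * / w k)%C).
  set (B := rsum (fun k => Cmod (/ w k) ^ 3) n).
  assert (HB : B <= 7 / Im z ^ 2) by (apply sum_inv_cube; lra).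
  assert (H0 : Cmod (csum e0 n) <= Cmod h ^ 3 * B).
  { unfold B. rewrite <- rsum_scal. apply Cmod_csum_le. intros k _. unfold e0.
    assert (Hq : Cmod (h / w k) <= / 2).
    { rewrite Cmod_div by auto. specialize (Hw k).
      apply Rmult_le_reg_r with (Cmod (w k)); [lra|]. unfold Rdiv. rewrite Rmult_assoc, Rinv_l; lra. }
    eapply Rle_trans; [apply CLog_taylor2; auto|]. unfold Cdiv. rewrite Cmod_mult. right; ring. }
  assert (H1 : Cmod (csum e1 n) <= 2 * B).
  { unfold B. rewrite <- rsum_scal. apply Cmod_csum_le. intros k _. unfold e1, digamma_main. rewrite HwS.
    apply digamma_step; auto. specialize (Hw k); lra. }
  assert (H2 : Cmod (csum e2 n) <= 2 * B).
  { unfold B. rewrite <- rsum_scal. apply Cmod_csum_le. intros k _. unfold e2. rewrite HwS.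
    apply inv_step; auto. specialize (Hw k); lra. }
  assert (E1 : csum (fun k => / w k)%C n = (digamma_main (w n) - digamma_main (w 0%nat) - csum e1 n)%C).
  { unfold e1. rewrite csum_minus, (csum_telescope (fun k => digamma_main (w k))). ring. }
  assert (E2 : csum (fun k => / w k * / w k)%C n = (/ w 0%nat - / w n - csum e2 n)%C).
  { unfold e2. rewrite csum_minus.
    rewrite (csum_ext (fun k => / w k - / w (S k))%C (fun k => (- / w (S k)) - (- / w k))%C) by (intros; ring).
    rewrite (csum_telescope (fun k => - / w k)%C). ring. }
  assert (E : csum (fun k => CLog (1 + h / w k)) n =
    (csum e0 n + (h * csum (fun k => / w k) n - h * h / 2 * csum (fun k => / w k * / w k) n))%C).
  { rewrite <- !csum_scal, <- csum_minus, <- csum_plus. apply csum_ext. intros k _. unfold e0. field.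
    apply Hwne. }
  fold (w n). rewrite <- Hw0.
  rewrite (csum_ext _ (fun k => CLog (1 + h / w k))) by (intros; rewrite Hw0; reflexivity).
  rewrite E, E1, E2.
  match goal with |- Cmod ?x <= _ => replace x with (csum e0 n + (- h * csum e1 n + h * h / 2 * csum e2 n))%C by ring end.
  eapply Rle_trans; [apply Cmod_triangle|].
  eapply Rle_trans; [apply Rplus_le_compat_l, Cmod_triangle|].
  rewrite !Cmod_mult, Cmod_opp.
  assert (Hc2 : Cmod (h * h / 2) = Cmod h * Cmod h / 2).
  { unfold Cdiv. rewrite !Cmod_mult, Cmod_inv, Cmod_R, Rabs_pos_eq; [field|lra|apply RtoC_neq_0; lra]. }
  rewrite Hc2. assert (Hh0 := Cmod_ge_0 h). rewrite Hw0.
  assert (Cmod h * Cmod (csum e1 n) <= Cmod h * (2 * B)) by (apply Rmult_le_compat_l; auto).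
  assert (Cmod h * Cmod h / 2 * Cmod (csum e2 n) <= Cmod h * Cmod h / 2 * (2 * B))
    by (apply Rmult_le_compat_l; [nra|auto]).
  assert (0 <= Cmod h ^ 3 + Cmod h ^ 2 + 2 * Cmod h).
  { assert (0 <= Cmod h ^ 3) by (apply pow_le; auto). assert (0 <= Cmod h ^ 2) by (apply pow_le; auto). lra. }
  assert ((Cmod h ^ 3 + Cmod h ^ 2 + 2 * Cmod h) * B <= (Cmod h ^ 3 + Cmod h ^ 2 + 2 * Cmod h) * (7 / Im z ^ 2))
    by (apply Rmult_le_compat_l; auto).
  unfold Rdiv in *. lra.
Qed.

(** The ln n of the Euler product cancels the upper end of the telescoped sum as n tends to
    infinity. *)
Lemma digamma_main_asymp (z : C) (n : R) : 0 < Re z -> 2 * Cmod z <= n -> 1 <= n ->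
  Cmod (RtoC (ln n) - digamma_main (z + RtoC n)) <= (2 * Cmod z + 1) / n.
Proof.
  intros Hz Hn Hn1. unfold digamma_main.
  assert (Hnc : RtoC n <> 0%C) by (apply RtoC_neq_0; lra).
  assert (Hm : Cmod (z / RtoC n) = Cmod z / n) by (rewrite Cmod_div, Cmod_R, Rabs_pos_eq; auto; lra).
  assert (Hw : Cmod (z / RtoC n) <= / 2).
  { rewrite Hm. apply Rmult_le_reg_r with n; [lra|]. unfold Rdiv. rewrite Rmult_assoc, Rinv_l; lra. }
  assert (Hre : / 2 <= Re (1 + z / RtoC n)).
  { assert (H := Re_one_plus _ 1 Hw ltac:(lra)). rewrite Cmult_1_l in H. exact H. }
  assert (E : CLog (z + RtoC n) = (RtoC (ln n) + CLog (1 + z / RtoC n))%C).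
  { rewrite <- CLog_scal by lra. f_equal. field; auto. }
  rewrite E.
  replace (RtoC (ln n) - (RtoC (ln n) + CLog (1 + z / RtoC n) - / (2 * (z + RtoC n))))%C
    with (- ((CLog (1 + z / RtoC n) - z / RtoC n) + z / RtoC n) + / (2 * (z + RtoC n)))%C by ring.
  eapply Rle_trans; [apply Cmod_triangle|]. rewrite Cmod_opp.
  assert (H1 := CLog_taylor1 _ Hw).
  assert (H2 := Cmod_triangle (CLog (1 + z / RtoC n) - z / RtoC n) (z / RtoC n)).
  assert (H3 : Cmod (/ (2 * (z + RtoC n))) <= / n).
  { apply Cmod_inv_le; [lra|]. rewrite Cmod_mult, Cmod_R, Rabs_pos_eq by lra.
    assert (H := Re_le_Cmod (z + RtoC n)). rewrite re_plus, Re_RtoC in H. lra. }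
  assert (H4 := Cmod_ge_0 (z / RtoC n)).
  assert (Cmod (z / RtoC n) ^ 2 <= Cmod (z / RtoC n)) by nra.
  replace ((2 * Cmod z + 1) / n) with (2 * (Cmod z / n) + / n) by (field; lra). rewrite <- Hm. lra.
Qed.

(** The main part is h psi(z) + h^2 psi'(z)/2, with the digamma function psi and its derivative
    replaced by their leading terms. The increment is expanded on truncated Euler products at fixed
    z and h, and N tends to infinity. *)
Lemma lnGamma_shift (z h : C) : 0 < Re z -> 0 < Re (z + h) -> 2 <= Rabs (Im z) -> 2 * Cmod h <= Rabs (Im z) ->
  Cmod (lnGamma (z + h) - lnGamma z - (h * digamma_main z + h * h / 2 * / z))
    <= 7 * (Cmod h ^ 3 + Cmod h ^ 2 + 2 * Cmod h) / Im z ^ 2.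
Proof.
  intros Hz Hzh Hy Hh.
  set (cz := Cmod z). set (cw := Cmod (z + h)). set (ch := Cmod h).
  assert (Hcz : 0 <= cz) by apply Cmod_ge_0. assert (Hcw : 0 <= cw) by apply Cmod_ge_0.
  assert (Hch : 0 <= ch) by apply Cmod_ge_0.
  destruct (nfloor_ex (2 * cz + 2 * cw)) as [N0 HN0]; [lra|].
  (* The constant collects the two truncation errors and the terms at the upper end; it may depend
     on z and h. *)
  apply (le_of_le_plus_inv _ _ (cw + cw ^ 2 + (cz + cz ^ 2) + (ch * (2 * cz + 1) + ch * ch)) (S N0)).
  intros N HN HN1. assert (HNr := INR_ge_1 N HN1).
  assert (HNb : 2 * cz + 2 * cw <= INR N).
  { apply Rle_trans with (INR N0 + 1); [lra|]. rewrite <- S_INR. apply le_INR; auto. }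
  assert (HA := lnGamma_approx N (z + h) HN1 ltac:(fold cw; lra)).
  assert (HB := lnGamma_approx N z HN1 ltac:(fold cz; lra)).
  fold cw in HA. fold cz in HB.
  assert (HS := lgN_shift N z h Hz Hzh Hh ltac:(lra)).
  assert (HE := log_sum_expansion z h (S N) Hz Hy Hh). fold ch in HE. fold ch.
  set (n := INR (S N)) in *.
  assert (Hn : INR N <= n) by (apply le_INR; lia).
  assert (HD := digamma_main_asymp z n Hz ltac:(fold cz; lra) ltac:(lra)). fold cz in HD.
  set (L := csum (fun k => CLog (1 + h / (z + RtoC (INR k)))) (S N)) in *.
  set (A := (lnGamma (z + h) - lgN N (z + h))%C) in *.
  set (B := (lnGamma z - lgN N z)%C) in *.
  match type of HE with Cmod ?e <= _ => set (Er := e) in * end.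
  set (P := (RtoC (ln n) - digamma_main (z + RtoC n))%C) in *.
  set (Q := (/ (z + RtoC n))%C) in *.
  assert (HQ : Cmod Q <= / n).
  { unfold Q. apply Cmod_inv_le; [lra|].
    assert (H := Re_le_Cmod (z + RtoC n)). rewrite re_plus, Re_RtoC in H. lra. }
  assert (E : (lnGamma (z + h) - lnGamma z - (h * digamma_main z + h * h / 2 * / z))%C
    = (A - B + (h * P - h * h / 2 * Q) - Er)%C).
  { transitivity (A - B + (lgN N (z + h) - lgN N z) - (h * digamma_main z + h * h / 2 * / z))%C.
    - unfold A, B. ring.
    - rewrite HS. unfold Er, P, Q. ring. }
  rewrite E. eapply Rle_trans; [apply Cmod_minus_le|].
  rewrite Rplus_comm. apply Rplus_le_compat; [exact HE|].
  eapply Rle_trans; [apply Cmod_triangle|].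
  assert (H1 := Cmod_minus_le A B). assert (H2 := Cmod_minus_le (h * P) (h * h / 2 * Q)).
  assert (Hc2 : Cmod (h * h / 2) = ch * ch / 2).
  { unfold Cdiv. rewrite !Cmod_mult, Cmod_inv, Cmod_R, Rabs_pos_eq; [fold ch; field|lra|apply RtoC_neq_0; lra]. }
  rewrite !(Cmod_mult _ P), (Cmod_mult _ Q), Hc2 in H2. fold ch in H2.
  assert (Hin : / n <= / INR N) by (apply Rinv_le_contravar; lra).
  assert (H3 : ch * Cmod P <= ch * ((2 * cz + 1) / INR N)).
  { apply Rmult_le_compat_l; auto. eapply Rle_trans; [exact HD|]. apply Rmult_le_compat_l; lra. }
  assert (H4 : ch * ch / 2 * Cmod Q <= ch * ch / 2 * / INR N).
  { apply Rmult_le_compat_l; [nra|lra]. }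
  assert (H5 : 0 < / INR N) by (apply Rinv_0_lt_compat; lra).
  assert (0 <= ch * ch * / INR N) by (apply Rmult_le_pos; nra).
  unfold Rdiv in *. lra.
Qed.

Lemma Ci_theta (z : C) :
  (Ci * theta z)%C = (- (Ci * z / 2) * RtoC (ln PI)
     + (lnGamma (/ 4 + Ci * z / 2) - lnGamma (/ 4 - Ci * z / 2)) / 2)%C.
Proof. unfold theta. field. apply Ci_nz. Qed.

Lemma Ci_sq : (Ci * Ci)%C = (- (1))%C.
Proof. unfold Ci, RtoC, Cmult, Copp; simpl. f_equal; ring. Qed.

Lemma CLog_conj_sum (a b : R) : 0 < a -> (CLog (a, b) + CLog (a, (- b)%R))%C = RtoC (ln (a ^ 2 + b ^ 2)).
Proof.
  intros Ha. rewrite !CLog_Re_pos by (simpl; lra). unfold Cplus, RtoC; simpl. f_equal.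
  - replace (- b * (- b * 1)) with (b * (b * 1)) by ring. field.
  - replace (- b / a) with (- (b / a)) by (field; lra). rewrite atan_opp. ring.
Qed.

(** The Gamma factors sit at the conjugate points z = 1/4 + it/2 and zm. In the combination, log z +
    log zm is real and leads to log(t/2pi), 1/z + 1/zm is O(t^(-2)), and 1/z - 1/zm is -4i/t up to
    O(t^(-3)), the source of i x^2/(4t). *)
Lemma theta_diff (t : R) (x : C) : 4 <= t -> Rabs (Im x) < / 2 -> Cmod x <= t / 2 ->
  Cmod (Ci * theta (RtoC t + x) - Ci * theta (RtoC t)
     - (Ci * x / 2 * RtoC (ln (t / (2 * PI))) + Ci * (x * x) / (4 * RtoC t)))
  <= 57 * (Cmod x + Cmod x ^ 2 + Cmod x ^ 3) / t ^ 2.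
Proof.
  intros Ht Hxi Hx. assert (HP := PI_RGT_0).
  set (h := (Ci * x / 2)%C).
  assert (Hhm : Cmod h = Cmod x / 2).
  { unfold h, Cdiv. rewrite !Cmod_mult, Cmod_Ci, Cmod_inv, Cmod_R, Rabs_pos_eq; [field|lra|apply RtoC_neq_0; lra]. }
  assert (Hhre : Re h = - Im x / 2).
  { unfold h, Ci, Cdiv, Cinv, RtoC, Cmult, Re, Im; simpl. field. }
  set (z := (/ 4, t / 2) : C). set (zm := (/ 4, - (t / 2)) : C).
  assert (Ez : (/ 4 + Ci * RtoC t / 2)%C = z).
  { unfold z, Ci, Cdiv, Cinv, RtoC, Cmult, Cplus; simpl. f_equal; field. }
  assert (Ezm : (/ 4 - Ci * RtoC t / 2)%C = zm).
  { unfold zm, Cminus, Ci, Cdiv, Cinv, RtoC, Cmult, Cplus, Copp; simpl. f_equal; field. }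
  assert (Ezh : (/ 4 + Ci * (RtoC t + x) / 2)%C = (z + h)%C) by (rewrite <- Ez; unfold h, Cdiv; ring).
  assert (Ezmh : (/ 4 - Ci * (RtoC t + x) / 2)%C = (zm + - h)%C) by (rewrite <- Ezm; unfold h, Cdiv; ring).
  assert (Hxi' := Rabs_def2 _ _ Hxi).
  assert (Hhb : 2 * Cmod h <= t / 2) by lra.
  assert (H1 : Cmod (lnGamma (z + h) - lnGamma z - (h * digamma_main z + h * h / 2 * / z))
    <= 7 * (Cmod h ^ 3 + Cmod h ^ 2 + 2 * Cmod h) / (t / 2) ^ 2).
  { apply (lnGamma_shift z h); try (simpl Im; rewrite Rabs_pos_eq; lra).
    - simpl; lra.
    - rewrite re_plus, Hhre. simpl Re. lra. }
  assert (H2 : Cmod (lnGamma (zm + - h) - lnGamma zm - (- h * digamma_main zm + - h * - h / 2 * / zm))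
    <= 7 * (Cmod h ^ 3 + Cmod h ^ 2 + 2 * Cmod h) / (t / 2) ^ 2).
  { assert (H := lnGamma_shift zm (- h)). rewrite Cmod_opp in H. simpl Im in H.
    replace ((- (t / 2)) ^ 2) with ((t / 2) ^ 2) in H by ring.
    rewrite Rabs_Ropp, Rabs_pos_eq in H by lra. apply H; try lra.
    - simpl; lra.
    - rewrite re_plus, re_opp, Hhre. simpl Re. lra. }
  set (R0 := (/ 4) ^ 2 + (t / 2) ^ 2).
  assert (HR0 : t ^ 2 / 4 <= R0) by (unfold R0; nra).
  assert (Ht2 : 0 < t ^ 2) by (apply pow_lt; lra).
  assert (HR0c : RtoC R0 <> 0%C) by (apply RtoC_neq_0; lra).
  assert (Ezz : (z * zm)%C = RtoC R0).
  { unfold z, zm, R0, Cmult, RtoC; simpl. f_equal; field. }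
  assert (Hz0 : z <> 0%C) by (intros E; apply HR0c; rewrite <- Ezz, E; ring).
  assert (Hzm0 : zm <> 0%C) by (intros E; apply HR0c; rewrite <- Ezz, E; ring).
  assert (Eadd : (/ z + / zm)%C = RtoC (/ (2 * R0))).
  { replace (/ z + / zm)%C with ((z + zm) / (z * zm))%C by (field; auto). rewrite Ezz.
    replace (z + zm)%C with (RtoC (/ 2)) by (unfold z, zm, Cplus, RtoC; simpl; f_equal; field).
    unfold Cdiv. rewrite <- RtoC_inv, <- RtoC_mult by lra. f_equal. field. lra. }
  assert (Esub : (/ z - / zm)%C = (- (Ci * RtoC (t / R0)))%C).
  { replace (/ z - / zm)%C with ((zm - z) / (z * zm))%C by (field; auto). rewrite Ezz.
    replace (zm - z)%C with (- (Ci * RtoC t))%C by (unfold z, zm, Ci, Cminus, Cmult, Copp, Cplus, RtoC; simpl; f_equal; field).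
    unfold Cdiv, Rdiv. rewrite RtoC_mult, RtoC_inv by lra. ring. }
  assert (Elog : (CLog z + CLog zm)%C = RtoC (ln R0)) by (apply CLog_conj_sum; lra).
  set (e1 := (lnGamma (z + h) - lnGamma z - (h * digamma_main z + h * h / 2 * / z))%C) in *.
  set (e2 := (lnGamma (zm + - h) - lnGamma zm - (- h * digamma_main zm + - h * - h / 2 * / zm))%C) in *.
  (* [r1] and [r2] measure how far the coefficients of h and of i h^2 are from their stated values;
     both are O(t^(-2)). *)
  set (r1 := / 2 * ln R0 - / (8 * R0) - ln PI - ln (t / (2 * PI))).
  set (r2 := / t - t / (4 * R0)).
  assert (E : (Ci * theta (RtoC t + x) - Ci * theta (RtoC t)
     - (h * RtoC (ln (t / (2 * PI))) + Ci * (x * x) / (4 * RtoC t)))%C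
     = (h * RtoC r1 + Ci * (h * h) * RtoC r2 + / 2 * (e1 - e2))%C).
  { rewrite !Ci_theta, Ez, Ezm, Ezh, Ezmh.
    transitivity (- h * RtoC (ln PI) + / 2 * (e1 - e2 + (h * (CLog z + CLog zm) - h / 2 * (/ z + / zm) + h * h / 2 * (/ z - / zm)))
      - (h * RtoC (ln (t / (2 * PI))) + Ci * (x * x) / (4 * RtoC t)))%C.
    - unfold e1, e2, digamma_main, h. field. repeat split; auto. apply RtoC_neq_0; lra.
    - rewrite Elog, Eadd, Esub.
      assert (Ehh : (h * h)%C = (- (x * x / 4))%C).
      { unfold h. transitivity ((Ci * Ci) * (x * x) / 4)%C; [field|rewrite Ci_sq; field]. }
      replace (Ci * (x * x) / (4 * RtoC t))%C with (- (Ci * (h * h) * RtoC (/ t)))%C.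
      2:{ rewrite Ehh, RtoC_inv by lra. field. apply RtoC_neq_0; lra. }
      assert (Er1 : RtoC r1 = (/ 2 * RtoC (ln R0) - / 4 * RtoC (/ (2 * R0)) - RtoC (ln PI) - RtoC (ln (t / (2 * PI))))%C).
      { unfold r1. rewrite !RtoC_minus, RtoC_mult. replace (/ (8 * R0)) with (/ 4 * / (2 * R0)) by (field; lra).
        rewrite RtoC_mult, !RtoC_inv; try lra. reflexivity. }
      assert (Er2 : RtoC r2 = (RtoC (/ t) - / 4 * RtoC (t / R0))%C).
      { unfold r2. rewrite RtoC_minus. replace (t / (4 * R0)) with (/ 4 * (t / R0)) by (field; lra).
        rewrite RtoC_mult, (RtoC_inv 4); [reflexivity|lra]. }
      rewrite Er1, Er2. field. }
  fold h. rewrite E.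
  assert (Hr1 : Rabs r1 <= / t ^ 2).
  { assert (Hlt : ln (t / (2 * PI)) = ln (t / 2) - ln PI).
    { replace (t / (2 * PI)) with (t / 2 * / PI) by (field; lra).
      rewrite ln_mult, ln_Rinv; [ring|lra|lra|apply Rinv_0_lt_compat; lra]. }
    assert (Hsq : ln (t / 2) = / 2 * ln ((t / 2) ^ 2)).
    { rewrite ln_pow by lra. simpl INR. field. }
    assert (Hq := ln_quotient_bounds R0 ((t / 2) ^ 2) ltac:(lra) ltac:(apply pow_lt; lra)).
    replace (R0 - (t / 2) ^ 2) with (/ 16) in Hq by (unfold R0; field).
    assert (0 < / 16 / R0) by (apply Rdiv_lt_0_compat; lra).
    replace (/ 16 / (t / 2) ^ 2) with (/ 4 * / t ^ 2) in Hq by (field; lra).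
    assert (H8 : 0 < / (8 * R0) <= / 2 * / t ^ 2).
    { split; [apply Rinv_0_lt_compat; lra|]. rewrite <- Rinv_mult. apply Rinv_le_contravar; lra. }
    unfold r1. rewrite Hlt, Hsq. apply Rabs_le. lra. }
  assert (Hr2 : Rabs r2 <= / t ^ 2).
  { unfold r2. replace (/ t - t / (4 * R0)) with (/ (t * (16 * R0))) by (unfold R0; field; split; [nra|lra]).
    rewrite Rabs_pos_eq by (left; apply Rinv_0_lt_compat; nra).
    apply Rinv_le_contravar; nra. }
  assert (Hh0 := Cmod_ge_0 h). assert (Hx0 := Cmod_ge_0 x).
  eapply Rle_trans; [apply Cmod_triangle|]. eapply Rle_trans; [apply Rplus_le_compat_r, Cmod_triangle|].
  rewrite !Cmod_mult, Cmod_Ci, !Cmod_R, (Cmod_inv 2), Cmod_R, (Rabs_pos_eq 2) by (try apply RtoC_neq_0; lra).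
  assert (H3 := Cmod_minus_le e1 e2).
  set (B := Cmod h ^ 3 + Cmod h ^ 2 + 2 * Cmod h) in *.
  replace (7 * B / (t / 2) ^ 2) with (28 * B * / t ^ 2) in H1, H2 by (field; lra).
  assert (H4 : Cmod h * Rabs r1 <= Cmod h * / t ^ 2) by (apply Rmult_le_compat_l; auto).
  assert (H5 : 1 * (Cmod h * Cmod h) * Rabs r2 <= Cmod h ^ 2 * / t ^ 2).
  { replace (1 * (Cmod h * Cmod h)) with (Cmod h ^ 2) by ring. apply Rmult_le_compat_l; [nra|auto]. }
  assert (Hit : 0 < / t ^ 2) by (apply Rinv_0_lt_compat; auto).
  assert (HB : Cmod h + Cmod h ^ 2 + 28 * B <= 57 * (Cmod x + Cmod x ^ 2 + Cmod x ^ 3)).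
  { unfold B. rewrite Hhm.
    assert (0 <= Cmod x ^ 2) by (apply pow_le; auto). assert (0 <= Cmod x ^ 3) by (apply pow_le; auto).
    replace ((Cmod x / 2) ^ 2) with (Cmod x ^ 2 / 4) by field.
    replace ((Cmod x / 2) ^ 3) with (Cmod x ^ 3 / 8) by field. lra. }
  apply Rmult_le_compat_r with (r := / t ^ 2) in HB; [|lra].
  unfold Rdiv. lra.
Qed.

(** * Growth and continuity of the theta factor *)

Lemma Re_CLog (z : C) : Re (CLog z) = ln (Cmod z).
Proof. reflexivity. Qed.

Lemma Cmod_pair (a b : R) : Cmod (a, b) = sqrt (a ^ 2 + b ^ 2).
Proof. reflexivity. Qed.

Lemma one_plus_div (a b k : R) : k <> 0 -> (1 + (a, b) / RtoC k)%C = (1 + a / k, b / k).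
Proof.
  intros Hk. unfold Cdiv, Cinv, RtoC, Cmult, Cplus; simpl. f_equal; field; auto.
Qed.

Lemma Re_lgterm (a b : R) (n : nat) :
  Re (lgterm (a, b) n) = a * ln (1 + / INR (S n)) - ln (sqrt ((1 + a / INR (S n)) ^ 2 + (b / INR (S n)) ^ 2)).
Proof.
  unfold lgterm. cbv zeta. assert (Hk := INR_ge_1 (S n) ltac:(lia)). set (k := INR (S n)) in *.
  rewrite one_plus_div by lra.
  unfold CLog. rewrite Cmod_pair. unfold Re, RtoC; simpl. ring.
Qed.

(** The real parts involve b only through the squares inside the moduli, so they agree term by
    term. *)
Lemma Re_lnGamma_conj (a b : R) : Re (lnGamma (a, b)) = Re (lnGamma (a, (- b)%R)).
Proof.
  unfold lnGamma.
  change (Re (- CLog (a, b) + CSeries (lgterm (a, b))) = Re (- CLog (a, (- b)%R) + CSeries (lgterm (a, (- b)%R)))).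
  rewrite !re_plus, !re_opp, !Re_CLog, !Cmod_pair.
  replace ((- b) ^ 2) with (b ^ 2) by ring. f_equal.
  unfold CSeries. change (Series (fun n => Re (lgterm (a, b) n)) = Series (fun n => Re (lgterm (a, (- b)%R) n))).
  apply Series_ext. intros n. rewrite !Re_lgterm.
  replace ((- b / INR (S n)) ^ 2) with ((b / INR (S n)) ^ 2); [reflexivity|].
  assert (Hk := INR_ge_1 (S n) ltac:(lia)). field. lra.
Qed.

Lemma Re_half (z : C) : Re (z / 2) = Re z / 2.
Proof. unfold Cdiv, Cinv, RtoC, Cmult, Re; simpl. field. Qed.

Lemma quarter_plus (v e : R) : (/ 4 + Ci * (v, e) / 2)%C = (/ 4 - e / 2, v / 2).
Proof. unfold Ci, Cdiv, Cinv, RtoC, Cmult, Cplus; simpl. f_equal; field. Qed.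

Lemma quarter_minus (v e : R) : (/ 4 - Ci * (v, e) / 2)%C = (/ 4 + e / 2, (- (v / 2))%R).
Proof. unfold Cminus, Ci, Cdiv, Cinv, RtoC, Cmult, Cplus, Copp; simpl. f_equal; field. Qed.

Lemma Re_Ci_theta (v e : R) : Re (Ci * theta (v, e)) =
  e / 2 * ln PI + (Re (lnGamma (/ 4 - e / 2, v / 2)) - Re (lnGamma (/ 4 + e / 2, (- (v / 2))%R))) / 2.
Proof.
  rewrite Ci_theta, quarter_plus, quarter_minus, re_plus, Re_half. unfold Cminus at 1.
  rewrite re_plus, re_opp, re_scal_r. f_equal.
  unfold Ci, Cdiv, Cinv, RtoC, Cmult, Copp, Re; simpl. field.
Qed.

(** For real t the two Gamma factors are at conjugate points and have equal modulus. *)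
Lemma Cexp_theta_real (t : R) : Cmod (Cexp (Ci * theta (RtoC t))) = 1.
Proof.
  rewrite Cmod_Cexp. unfold RtoC at 1. rewrite Re_Ci_theta, <- exp_0. f_equal.
  replace (/ 4 + 0 / 2) with (/ 4 - 0 / 2) by field. rewrite <- Re_lnGamma_conj. field.
Qed.

(** Every factor 1 + z/k has the larger modulus at the larger abscissa, so the logarithms compare
    with a favourable sign. There remain the convergence factors, which telescope to the right-hand
    side. *)
Lemma Re_lgN_diff_le (N : nat) (a a' y : R) : 0 < a' <= a ->
  Re (lgN N (a, y)) - Re (lgN N (a', (- y)%R)) <= (a - a') * ln (INR (S N)).
Proof.
  intros Ha. unfold lgN. rewrite !re_plus, !re_opp, !Re_CLog, !Re_csum, !Cmod_pair.
  assert (Hmono : forall c c' b, 0 < c' <= c -> ln (sqrt (c' ^ 2 + (- b) ^ 2)) <= ln (sqrt (c ^ 2 + b ^ 2))).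
  { intros c c' b Hc. apply ln_le; [apply sqrt_lt_R0; nra|]. apply sqrt_le_1; nra. }
  assert (H0 := Hmono a a' y Ha).
  assert (HS : rsum (fun k => Re (lgterm (a, y) k)) N - rsum (fun k => Re (lgterm (a', (- y)%R) k)) N
     <= (a - a') * ln (INR (S N))).
  { induction N as [|N IH].
    - simpl rsum. replace (INR 1) with 1 by reflexivity. rewrite ln_1. lra.
    - rewrite !rsum_S, !Re_lgterm.
      assert (Hk := INR_ge_1 (S N) ltac:(lia)). rewrite (S_INR (S N)). set (k := INR (S N)) in *.
      assert (Hik : 0 < / k) by (apply Rinv_0_lt_compat; lra).
      assert (Hm := Hmono (1 + a / k) (1 + a' / k) (y / k) ltac:(unfold Rdiv; nra)).
      replace (- (y / k)) with (- y / k) in Hm by (field; lra).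
      assert (El : ln (k + 1) = ln k + ln (1 + / k)).
      { rewrite <- ln_mult by lra. f_equal. field; lra. }
      rewrite El. lra. }
  lra.
Qed.

(** Valid for all v, for the tails, which the expansion of theta does not reach. A truncation at
    about 4 V^2 makes each error of log Gamma at most 1/2, and the rest is at most N + 1. *)
Lemma Cexp_theta_growth (v : R) : Cmod (Cexp (Ci * theta (v, (- / 4)%R))) <= 12 * (1 + Rabs v) ^ 2.
Proof.
  rewrite Cmod_Cexp, Re_Ci_theta.
  replace (/ 4 - - / 4 / 2) with (3 / 8) by field. replace (/ 4 + - / 4 / 2) with (/ 8) by field.
  set (y := v / 2). set (V := 1 + Rabs v).
  assert (HV : 1 <= V) by (unfold V; assert (H := Rabs_pos v); lra).
  assert (Hy : Rabs y = Rabs v / 2).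
  { unfold y, Rdiv. rewrite Rabs_mult, (Rabs_pos_eq (/ 2)) by lra. reflexivity. }
  assert (Ha : Cmod (3 / 8, y) <= V).
  { eapply Rle_trans; [apply Cmod_le_Re_Im|]. simpl. rewrite (Rabs_pos_eq (3 / 8)), Hy by lra.
    unfold V. assert (H := Rabs_pos v). lra. }
  assert (Hb : Cmod (/ 8, (- y)%R) <= V).
  { eapply Rle_trans; [apply Cmod_le_Re_Im|]. simpl. rewrite (Rabs_pos_eq (/ 8)), Rabs_Ropp, Hy by lra.
    unfold V. assert (H := Rabs_pos v). lra. }
  destruct (nfloor_ex (4 * V ^ 2)) as [n Hn]; [nra|].
  set (N := S n).
  assert (HN : 4 * V ^ 2 <= INR N <= 4 * V ^ 2 + 1) by (unfold N; rewrite S_INR; lra).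
  assert (HN1 : (1 <= N)%nat) by (unfold N; lia).
  assert (Htail : forall z, Cmod z <= V -> Rabs (Re (lnGamma z) - Re (lgN N z)) <= / 2).
  { intros z Hz. assert (Hz0 := Cmod_ge_0 z).
    assert (H := lnGamma_approx N z HN1 ltac:(nra)).
    assert (H' := re_le_Cmod (lnGamma z - lgN N z)). unfold Cminus in H' at 1.
    rewrite re_plus, re_opp in H'. eapply Rle_trans; [exact H'|]. eapply Rle_trans; [exact H|].
    apply Rmult_le_reg_r with (INR N); [nra|]. unfold Rdiv. rewrite Rmult_assoc, Rinv_l by nra. nra. }
  assert (H1 := Htail _ Ha). assert (H2 := Htail _ Hb).
  apply Rabs_le_between in H1. apply Rabs_le_between in H2.
  assert (H3 := Re_lgN_diff_le N (3 / 8) (/ 8) y ltac:(lra)).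
  assert (HlP : 0 <= ln PI) by (rewrite <- ln_1; apply ln_le; [lra|assert (H := PI2_1); lra]).
  assert (HlN : 0 <= ln (INR (S N))) by (rewrite <- ln_1; apply ln_le; [lra|apply INR_ge_1; lia]).
  apply Rle_trans with (exp (ln (INR (S N)) + ln 2)).
  - apply exp_le. assert (H := ln_2_bounds). fold y. lra.
  - rewrite exp_plus, !exp_ln by (try lra; apply lt_0_INR; lia). rewrite S_INR. nra.
Qed.

(** * Continuity of complex-valued functions *)

Definition ccont {T : UniformSpace} (f : T -> C) (x : T) : Prop :=
  continuous (fun r => Re (f r)) x /\ continuous (fun r => Im (f r)) x.

Lemma cder_ccont (f : R -> C) (x : R) (l : C) : cder f x l -> ccont f x.
Proof.
  intros [H1 H2]. split.
  - apply (ex_derive_continuous (fun r => Re (f r)) x). eexists; exact H1.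
  - apply (ex_derive_continuous (fun r => Im (f r)) x). eexists; exact H2.
Qed.

(** Continuity passes to locally uniform limits; log Gamma and zeta inherit it from their finite
    approximations in this way. *)
Lemma continuous_approx {T : UniformSpace} (f : T -> R) (x : T) :
  (forall eps : posreal, exists g : T -> R, continuous g x /\
     locally x (fun y => Rabs (f y - g y) <= eps)) -> continuous f x.
Proof.
  intros H. apply filterlim_locally. intros eps. assert (he := cond_pos eps).
  destruct (H (mkposreal (eps / 4) ltac:(lra))) as [g [Hg Hl]].
  simpl in Hl.
  assert (Hg' := proj1 (filterlim_locally g (g x)) Hg (mkposreal (eps / 4) ltac:(lra))).
  assert (Hx := locally_singleton _ _ Hl).
  apply (filter_imp (fun y => Rabs (f y - g y) <= eps / 4 /\ ball (g x) (eps / 4) (g y)));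
    [|apply filter_and; assumption].
  intros y [Ha Hb]. change (Rabs (g y - g x) < eps / 4) in Hb. change (Rabs (f y - f x) < eps).
  replace (f y - f x) with ((f y - g y) + (g y - g x) + - (f x - g x)) by ring.
  eapply Rle_lt_trans; [apply Rabs_triang|]. rewrite Rabs_Ropp.
  assert (Ht := Rabs_triang (f y - g y) (g y - g x)). lra.
Qed.

Lemma ccont_approx {T : UniformSpace} (f : T -> C) (x : T) :
  (forall eps : posreal, exists g : T -> C, ccont g x /\
     locally x (fun y => Cmod (f y - g y) <= eps)) -> ccont f x.
Proof.
  intros H. split; apply continuous_approx; intros eps; destruct (H eps) as [g [[Hg1 Hg2] Hl]].
  - exists (fun r => Re (g r)). split; auto.
    apply (filter_imp (fun y => Cmod (f y - g y) <= eps)); [|exact Hl]. intros y Hy.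
    eapply Rle_trans; [|exact Hy]. eapply Rle_trans; [|apply re_le_Cmod]. right. reflexivity.
  - exists (fun r => Im (g r)). split; auto.
    apply (filter_imp (fun y => Cmod (f y - g y) <= eps)); [|exact Hl]. intros y Hy.
    eapply Rle_trans; [|exact Hy]. eapply Rle_trans; [|apply Im_le_Cmod]. right. reflexivity.
Qed.

Lemma ccont_plus {T : UniformSpace} (f g : T -> C) (x : T) : ccont f x -> ccont g x -> ccont (fun r => f r + g r)%C x.
Proof.
  intros [H1 H2] [H3 H4]. split.
  - apply (continuous_plus (fun r => Re (f r)) (fun r => Re (g r)) x H1 H3).
  - apply (continuous_plus (fun r => Im (f r)) (fun r => Im (g r)) x H2 H4).
Qed.

Lemma ccont_mult {T : UniformSpace} (f g : T -> C) (x : T) : ccont f x -> ccont g x -> ccont (fun r => f r * g r)%C x.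
Proof.
  intros [H1 H2] [H3 H4]. split.
  - apply (continuous_minus (fun r => Re (f r) * Re (g r)) (fun r => Im (f r) * Im (g r)) x);
      apply (continuous_mult (K := R_AbsRing)); auto.
  - apply (continuous_plus (fun r => Re (f r) * Im (g r)) (fun r => Im (f r) * Re (g r)) x);
      apply (continuous_mult (K := R_AbsRing)); auto.
Qed.

Lemma ccont_const {T : UniformSpace} (c : C) (x : T) : ccont (fun _ => c) x.
Proof. split; apply continuous_const. Qed.

Lemma ccont_minus {T : UniformSpace} (f g : T -> C) (x : T) : ccont f x -> ccont g x -> ccont (fun r => f r - g r)%C x.
Proof.
  intros [H1 H2] [H3 H4]. split.
  - apply (continuous_minus (fun r => Re (f r)) (fun r => Re (g r)) x H1 H3).
  - apply (continuous_minus (fun r => Im (f r)) (fun r => Im (g r)) x H2 H4).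
Qed.

Lemma ccont_exp {T : UniformSpace} (f : T -> C) (x : T) : ccont f x -> ccont (fun r => Cexp (f r)) x.
Proof.
  intros [H1 H2].
  assert (He : continuous (fun r => exp (Re (f r))) x).
  { apply (continuous_comp (fun r => Re (f r)) exp); auto. apply continuous_exp. }
  split.
  - apply (continuous_mult (K := R_AbsRing) (fun r => exp (Re (f r))) (fun r => cos (Im (f r)))); auto.
    apply (continuous_comp (fun r => Im (f r)) cos); auto. apply continuous_cos.
  - apply (continuous_mult (K := R_AbsRing) (fun r => exp (Re (f r))) (fun r => sin (Im (f r)))); auto.
    apply (continuous_comp (fun r => Im (f r)) sin); auto. apply continuous_sin.
Qed.

Lemma ccont_ext {T : UniformSpace} (f g : T -> C) (x : T) : (forall r, f r = g r) -> ccont f x -> ccont g x.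
Proof.
  intros H [H1 H2]. split.
  - apply (continuous_ext (fun r => Re (f r))); [intros; rewrite H; auto|auto].
  - apply (continuous_ext (fun r => Im (f r))); [intros; rewrite H; auto|auto].
Qed.

Lemma ccont_csum {T : UniformSpace} (f : T -> nat -> C) (x : T) (n : nat) :
  (forall k, (k < n)%nat -> ccont (fun r => f r k) x) -> ccont (fun r => csum (f r) n) x.
Proof.
  induction n as [|n IH]; intros H; simpl; [apply ccont_const|].
  apply ccont_plus; [apply IH; intros; apply H; lia|apply H; lia].
Qed.

(** On the unit ball around x the arguments have modulus at most V, so a single truncation serves
    for given eps. *)
Lemma ccont_lnGamma (a c x : R) : 0 < a -> ccont (fun r => lnGamma (a, c * r)) x.
Proof.
  intros Ha. apply ccont_approx. intros eps.
  set (V := a + Rabs c * (Rabs x + 1)).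
  assert (Hc0 := Rabs_pos c). assert (Hx0 := Rabs_pos x).
  assert (HV : 0 < V) by (unfold V; nra).
  assert (he := cond_pos eps).
  destruct (nfloor_ex (2 * V + (V + V ^ 2) / eps)) as [n Hn].
  { apply Rplus_le_le_0_compat; [lra|]. apply Rlt_le, Rdiv_lt_0_compat; nra. }
  exists (fun r => lgN (S n) (a, c * r)). split.
  - assert (Hd : cder (fun r => (a, c * r)) x (0, c)).
    { apply cder_pair; [apply @is_derive_const|]. auto_derive; auto. ring. }
    unfold lgN. apply ccont_plus.
    + apply (ccont_ext (fun r => (- (1)) * CLog (a, (c * r)%R))%C); [intros; ring|].
      apply ccont_mult; [apply ccont_const|].
      eapply cder_ccont. apply cder_log; [simpl; lra|exact Hd].
    + apply ccont_csum. intros k _. unfold lgterm. cbv zeta.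
      assert (Hk := INR_ge_1 (S k) ltac:(lia)).
      apply ccont_minus.
      * apply ccont_mult; [|apply ccont_const]. eapply cder_ccont; exact Hd.
      * eapply cder_ccont. apply cder_log.
        -- rewrite one_plus_div by lra. simpl. assert (0 < a / INR (S k)) by (apply Rdiv_lt_0_compat; lra). simpl in *; lra.
        -- apply cder_plus; [apply cder_const|]. unfold Cdiv. apply cder_mult; [exact Hd|apply cder_const].
  - exists (mkposreal 1 Rlt_0_1). intros y Hy.
    assert (Hyx : Rabs y <= Rabs x + 1).
    { change (Rabs (y - x) < 1) in Hy. replace y with (x + (y - x)) by ring.
      eapply Rle_trans; [apply Rabs_triang|]. lra. }
    assert (Hz : Cmod (a, c * y) <= V).
    { eapply Rle_trans; [apply Cmod_le_Re_Im|]. simpl. rewrite (Rabs_pos_eq a), Rabs_mult by lra.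
      unfold V. apply Rplus_le_compat_l. apply Rmult_le_compat_l; auto. }
    assert (Hz0 := Cmod_ge_0 (a, (c * y)%R)).
    assert (Hq : 0 < (V + V ^ 2) / eps) by (apply Rdiv_lt_0_compat; nra).
    assert (HN : INR n + 1 = INR (S n)) by (rewrite S_INR; ring).
    eapply Rle_trans; [apply lnGamma_approx; [lia|lra]|].
    apply Rmult_le_reg_r with (INR (S n)); [lra|]. unfold Rdiv. rewrite Rmult_assoc, Rinv_l by lra.
    assert ((V + V ^ 2) / eps * eps = V + V ^ 2) by (field; lra). nra.
Qed.

Lemma ccont_Cexp_theta (x : R) : ccont (fun v => Cexp (Ci * theta (v, (- / 4)%R))) x.
Proof.
  apply ccont_exp.
  apply (ccont_ext (fun v => (RtoC (- ln PI) * (Ci * (v, (- / 4)%R) / 2)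
    + (lnGamma ((3 / 8)%R, (/ 2 * v)%R) - lnGamma ((/ 8)%R, (- / 2 * v)%R)) * / 2))%C).
  - intros v. rewrite Ci_theta, quarter_plus, quarter_minus.
    replace (/ 4 - - / 4 / 2) with (3 / 8) by field. replace (/ 4 + - / 4 / 2) with (/ 8) by field.
    replace (v / 2) with (/ 2 * v) by field. replace (- (/ 2 * v)) with (- / 2 * v) by ring.
    rewrite RtoC_opp. unfold Cdiv. ring.
  - apply ccont_plus; apply ccont_mult; try apply ccont_const.
    + unfold Cdiv. apply ccont_mult; [|apply ccont_const]. apply ccont_mult; [apply ccont_const|].
      split; simpl; [apply continuous_id|apply continuous_const].
    + apply ccont_minus; apply ccont_lnGamma; lra.
Qed.

(** * Holomorphic functions and shifting contours *)

Lemma ccont_inv {T : UniformSpace} (f : T -> C) (x : T) :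
  f x <> 0%C -> ccont f x -> ccont (fun r => / f r)%C x.
Proof.
  intros Hn [H1 H2]. assert (Hp := Csqmod_pos _ Hn).
  assert (Hd : continuous (fun r => / (Re (f r) ^ 2 + Im (f r) ^ 2)) x).
  { apply (continuous_comp (fun r => Re (f r) ^ 2 + Im (f r) ^ 2) Rinv).
    - apply (continuous_ext (fun r => plus (mult (Re (f r)) (Re (f r))) (mult (Im (f r)) (Im (f r))))).
      + intros r. unfold plus, mult; simpl. ring.
      + apply (continuous_plus (fun r => mult (Re (f r)) (Re (f r))) (fun r => mult (Im (f r)) (Im (f r))));
          apply (continuous_mult (K := R_AbsRing)); auto.
    - apply continuous_Rinv. lra. }
  split.
  - apply (continuous_mult (K := R_AbsRing) (fun r => Re (f r)) (fun r => / (Re (f r) ^ 2 + Im (f r) ^ 2))); auto.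
  - apply (continuous_mult (K := R_AbsRing) (fun r => - Im (f r)) (fun r => / (Re (f r) ^ 2 + Im (f r) ^ 2))); auto.
    apply (continuous_opp (fun r => Im (f r))); auto.
Qed.

Lemma ccont_id (z : C) : ccont (fun w : C => w) z.
Proof. destruct z as [a b]. split; [apply continuous_fst|apply continuous_snd]. Qed.

(* [D] is not required to be open; the derivative is only asserted along the two axes. *)
Definition Hol (D : C -> Prop) (f : C -> C) : Prop :=
  exists f' : C -> C, forall u y, D (u, y) ->
    cder (fun r => f (r, y)) u (f' (u, y)) /\ cder (fun r => f (u, r)) y (Ci * f' (u, y))%C /\
    ccont f (u, y) /\ ccont f' (u, y).

Lemma Hol_const (D : C -> Prop) (c : C) : Hol D (fun _ => c).
Proof.
  exists (fun _ => 0%C). intros u y _. split; [apply cder_const|]. split; [|split; apply ccont_const].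
  eapply cder_eq; [apply cder_const|ring].
Qed.

Lemma Hol_id (D : C -> Prop) : Hol D (fun z => z).
Proof.
  exists (fun _ => 1%C). intros u y _. split; [|split; [|split; [apply ccont_id|apply ccont_const]]].
  - apply cder_pair; [apply @is_derive_id|apply @is_derive_const].
  - eapply cder_eq; [apply cder_pair; [apply @is_derive_const|apply @is_derive_id]|].
    unfold Ci, RtoC, Cmult, zero, one; simpl. f_equal; ring.
Qed.

Lemma Hol_plus (D : C -> Prop) (f g : C -> C) : Hol D f -> Hol D g -> Hol D (fun z => f z + g z)%C.
Proof.
  intros [f' Hf] [g' Hg]. exists (fun z => f' z + g' z)%C. intros u y Hd.
  destruct (Hf u y Hd) as [F1 [F2 [F3 F4]]]. destruct (Hg u y Hd) as [G1 [G2 [G3 G4]]].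
  split; [apply cder_plus; auto|]. split; [|split; apply ccont_plus; auto].
  eapply cder_eq; [apply cder_plus; eauto|]. ring.
Qed.

Lemma Hol_minus (D : C -> Prop) (f g : C -> C) : Hol D f -> Hol D g -> Hol D (fun z => f z - g z)%C.
Proof.
  intros [f' Hf] [g' Hg]. exists (fun z => f' z - g' z)%C. intros u y Hd.
  destruct (Hf u y Hd) as [F1 [F2 [F3 F4]]]. destruct (Hg u y Hd) as [G1 [G2 [G3 G4]]].
  split; [apply cder_minus; auto|]. split; [|split; apply ccont_minus; auto].
  eapply cder_eq; [apply cder_minus; eauto|]. ring.
Qed.

Lemma Hol_mult (D : C -> Prop) (f g : C -> C) : Hol D f -> Hol D g -> Hol D (fun z => f z * g z)%C.
Proof.
  intros [f' Hf] [g' Hg]. exists (fun z => f' z * g z + f z * g' z)%C. intros u y Hd.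
  destruct (Hf u y Hd) as [F1 [F2 [F3 F4]]]. destruct (Hg u y Hd) as [G1 [G2 [G3 G4]]].
  split; [apply (cder_mult (fun r => f (r, y)) (fun r => g (r, y))); auto|]. split.
  - eapply cder_eq; [apply (cder_mult (fun r => f (u, r)) (fun r => g (u, r))); eauto|]. cbv beta; ring.
  - split; [apply ccont_mult; auto|]. apply ccont_plus; apply ccont_mult; auto.
Qed.

Lemma Hol_exp (D : C -> Prop) (f : C -> C) : Hol D f -> Hol D (fun z => Cexp (f z)).
Proof.
  intros [f' Hf]. exists (fun z => f' z * Cexp (f z))%C. intros u y Hd.
  destruct (Hf u y Hd) as [F1 [F2 [F3 F4]]].
  split; [apply (cder_exp (fun r => f (r, y))); auto|]. split.
  - eapply cder_eq; [apply (cder_exp (fun r => f (u, r))); eauto|]. cbv beta; ring.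
  - split; [apply ccont_exp; auto|]. apply ccont_mult; auto. apply ccont_exp; auto.
Qed.

Lemma Hol_inv (D : C -> Prop) (f : C -> C) : (forall z, D z -> f z <> 0%C) ->
  Hol D f -> Hol D (fun z => / f z)%C.
Proof.
  intros Hn [f' Hf]. exists (fun z => - (1) * f' z * (/ (f z * f z)))%C. intros u y Hd.
  specialize (Hn _ Hd). destruct (Hf u y Hd) as [F1 [F2 [F3 F4]]].
  split; [|split].
  - eapply cder_eq; [apply (cder_inv (fun r => f (r, y))); eauto|]. cbv beta. field. auto.
  - eapply cder_eq; [apply (cder_inv (fun r => f (u, r))); eauto|]. cbv beta. field. auto.
  - split; [apply ccont_inv; auto|].
    apply ccont_mult; [apply ccont_mult; [apply ccont_const|auto]|].
    apply ccont_inv; [apply Cmult_neq_0; auto|apply ccont_mult; auto].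
Qed.

Lemma Hol_csum (D : C -> Prop) (f : nat -> C -> C) (n : nat) :
  (forall k, Hol D (f k)) -> Hol D (fun z => csum (fun k => f k z) n).
Proof.
  intros H. induction n as [|n IH]; simpl; [apply Hol_const|apply Hol_plus; auto].
Qed.

Lemma Hol_ext (D : C -> Prop) (f g : C -> C) : (forall z, f z = g z) -> Hol D f -> Hol D g.
Proof.
  intros E [f' Hf]. exists f'. intros u y Hd. destruct (Hf u y Hd) as [F1 [F2 [F3 F4]]].
  split; [apply (cder_ext (fun r => f (r, y))); auto|].
  split; [apply (cder_ext (fun r => f (u, r))); auto|]. split; auto.
  apply (ccont_ext f); auto.
Qed.

(** * Integrals of complex-valued functions over an interval *)

Definition CInt (f : R -> C) (a b : R) : C :=
  (RInt (fun r => Re (f r)) a b, RInt (fun r => Im (f r)) a b).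

Lemma ex_RInt_Re (f : R -> C) (a b : R) : a <= b -> (forall x, a <= x <= b -> ccont f x) ->
  ex_RInt (fun r => Re (f r)) a b.
Proof.
  intros Hab H. apply (ex_RInt_continuous (fun r => Re (f r))).
  rewrite Rmin_left, Rmax_right by auto. intros z Hz. apply (H z Hz).
Qed.

Lemma ex_RInt_Im (f : R -> C) (a b : R) : a <= b -> (forall x, a <= x <= b -> ccont f x) ->
  ex_RInt (fun r => Im (f r)) a b.
Proof.
  intros Hab H. apply (ex_RInt_continuous (fun r => Im (f r))).
  rewrite Rmin_left, Rmax_right by auto. intros z Hz. apply (H z Hz).
Qed.

Lemma is_RInt_CInt (f : R -> C) (a b : R) : a <= b -> (forall x, a <= x <= b -> ccont f x) ->
  @is_RInt C_R_NormedModule f a b (CInt f a b).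
Proof.
  intros Hab H. apply (is_RInt_fct_extend_pair (U := R_NormedModule) (V := R_NormedModule) f a b).
  - apply (RInt_correct (fun r => Re (f r))). apply ex_RInt_Re; auto.
  - apply (RInt_correct (fun r => Im (f r))). apply ex_RInt_Im; auto.
Qed.

Lemma RInt_CInt (f : R -> C) (a b : R) : a <= b -> (forall x, a <= x <= b -> ccont f x) ->
  @RInt C_R_CompleteNormedModule f a b = CInt f a b.
Proof.
  intros Hab H. apply (@is_RInt_unique C_R_CompleteNormedModule f a b).
  apply is_RInt_CInt; auto.
Qed.

Lemma Cmod_CInt_le (f : R -> C) (g : R -> R) (a b : R) : a <= b -> (forall x, a <= x <= b -> ccont f x) ->
  (forall x, a <= x <= b -> Cmod (f x) <= g x) -> ex_RInt g a b -> Cmod (CInt f a b) <= RInt g a b.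
Proof.
  intros Hab Hc Hle Hg. rewrite Cmod_norm.
  apply (@norm_RInt_le C_R_NormedModule f g a b (CInt f a b) (RInt g a b) Hab).
  - intros x Hx. specialize (Hle x Hx). rewrite Cmod_norm in Hle. exact Hle.
  - apply is_RInt_CInt; auto.
  - apply (RInt_correct g); auto.
Qed.

Lemma Cmod_CInt_le_const (f : R -> C) (M a b : R) : a <= b -> (forall x, a <= x <= b -> ccont f x) ->
  (forall x, a <= x <= b -> Cmod (f x) <= M) -> Cmod (CInt f a b) <= (b - a) * M.
Proof.
  intros Hab Hc Hle. eapply Rle_trans; [apply (Cmod_CInt_le f (fun _ => M)); auto|].
  - apply ex_RInt_const.
  - rewrite RInt_const. right. reflexivity.
Qed.

Lemma CInt_minus (f g : R -> C) (a b : R) : a <= b -> (forall x, a <= x <= b -> ccont f x) ->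
  (forall x, a <= x <= b -> ccont g x) ->
  CInt (fun x => f x - g x)%C a b = (CInt f a b - CInt g a b)%C.
Proof.
  intros Hab Hf Hg. unfold CInt. unfold Cminus at 3, Cplus, Copp; simpl. f_equal.
  - apply (RInt_minus (fun r => Re (f r)) (fun r => Re (g r))); apply ex_RInt_Re; auto.
  - apply (RInt_minus (fun r => Im (f r)) (fun r => Im (g r))); apply ex_RInt_Im; auto.
Qed.

Lemma CInt_ext (f g : R -> C) (a b : R) : a <= b -> (forall x, a <= x <= b -> f x = g x) ->
  CInt f a b = CInt g a b.
Proof.
  intros Hab H. unfold CInt. f_equal; apply RInt_ext; intros x Hx;
    rewrite Rmin_left, Rmax_right in Hx by auto; rewrite H; auto; lra.
Qed.

Lemma CInt_scal (k : C) (f : R -> C) (a b : R) : a <= b -> (forall x, a <= x <= b -> ccont f x) ->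
  CInt (fun x => k * f x)%C a b = (k * CInt f a b)%C.
Proof.
  intros Hab Hf. assert (H1 := ex_RInt_Re f a b Hab Hf). assert (H2 := ex_RInt_Im f a b Hab Hf).
  assert (Hs : forall (c : R) (g : R -> R), ex_RInt g a b -> is_RInt (fun x => c * g x) a b (c * RInt g a b)).
  { intros c g Hg. apply (is_RInt_scal g a b c). apply (RInt_correct g); auto. }
  unfold CInt. unfold Cmult at 3; simpl. f_equal.
  - apply is_RInt_unique. apply (is_RInt_minus (fun x => Re k * Re (f x)) (fun x => Im k * Im (f x))); apply Hs; auto.
  - apply is_RInt_unique. apply (is_RInt_plus (fun x => Re k * Im (f x)) (fun x => Im k * Re (f x))); apply Hs; auto.
Qed.

(** Differentiation under the integral sign, with all conditions gathered on one open box around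
    [a, b] and x0. *)
Lemma is_derive_RInt_param_2d (G dG : R -> R -> R) (a b x0 m : R) : a <= b -> 0 < m ->
  (forall x u, Rabs (x - x0) < m -> a - m < u < b + m ->
     is_derive (fun z => G z u) x (dG x u) /\ continuity_2d_pt dG x u /\ continuous (G x) u) ->
  is_derive (fun x => RInt (G x) a b) x0 (RInt (dG x0) a b).
Proof.
  intros Hab Hm H.
  assert (H0 : Rabs (x0 - x0) < m) by (rewrite Rminus_diag, Rabs_R0; auto).
  rewrite (RInt_ext (dG x0) (fun u => Derive (fun z => G z u) x0)).
  2:{ intros u Hu. rewrite Rmin_left, Rmax_right in Hu by auto.
      symmetry. apply is_derive_unique. apply H; auto; lra. }
  apply (is_derive_RInt_param G a b x0).
  - exists (mkposreal m Hm). intros x Hx u Hu. rewrite Rmin_left, Rmax_right in Hu by auto.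
    exists (dG x u). apply H; [exact Hx|lra].
  - intros u Hu. rewrite Rmin_left, Rmax_right in Hu by auto.
    apply (continuity_2d_pt_ext_loc dG).
    + exists (mkposreal m Hm). intros x v Hx Hv. simpl in Hx, Hv.
      symmetry. apply is_derive_unique. apply H; auto. apply Rabs_def2 in Hv. lra.
    + apply H; auto; lra.
  - exists (mkposreal m Hm). intros x Hx. apply (ex_RInt_continuous (G x)).
    intros u Hu. rewrite Rmin_left, Rmax_right in Hu by auto. apply H; [exact Hx|lra].
Qed.

Lemma continuous_line (f : C -> R) (u y : R) : continuous f (u, y) -> continuous (fun r : R => f (r, y)) u.
Proof.
  intros H. apply (continuous_comp_2 (fun r : R => r) (fun _ : R => y) (fun a b => f (a, b)) u).
  - apply continuous_id.
  - apply continuous_const.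
  - apply (continuous_ext f); [intros [p q]; reflexivity|exact H].
Qed.

Lemma ccont_line (f : C -> C) (u y : R) : ccont f (u, y) -> ccont (fun r : R => f (r, y)) u.
Proof. intros [H1 H2]. split; [apply (continuous_line (fun z => Re (f z)))|apply (continuous_line (fun z => Im (f z)))]; auto. Qed.

Lemma continuity_2d_pt_swap_opp (g : C -> R) (x u : R) : continuous g (u, (- x)%R) ->
  continuity_2d_pt (fun a b => g (b, (- a)%R)) x u.
Proof.
  intros H. apply continuity_2d_pt_filterlim.
  apply (continuous_comp_2 (fun z : R * R => snd z) (fun z : R * R => - fst z) (fun a b => g (a, b)) (x, u)).
  - apply continuous_snd.
  - apply (continuous_opp (fun z : R * R => fst z)). apply continuous_fst.
  - apply (continuous_ext g); [intros [p q]; reflexivity|exact H].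
Qed.

(** Cauchy's theorem for a rectangle, in differential form: the integral at depth x has x-derivative
    -i (f(b - ix) - f(-b - ix)), because the vertical derivative of f is i f' and f' integrates
    exactly along the horizontal. The mean value inequality then bounds the change by the edge
    values. The margin m provides the open box for differentiation. *)
Lemma contour_shift (D : C -> Prop) (f : C -> C) (b m e1 e2 B : R) : Hol D f -> 0 < b -> 0 < m -> e1 <= e2 ->
  (forall u x, - b - m < u < b + m -> e1 - m < x < e2 + m -> D (u, (- x)%R)) ->
  (forall x, e1 <= x <= e2 -> Cmod (f (b, (- x)%R)) <= B /\ Cmod (f ((- b)%R, (- x)%R)) <= B) ->
  Cmod (CInt (fun u => f (u, (- e2)%R)) (- b) b - CInt (fun u => f (u, (- e1)%R)) (- b) b) <= 2 * B * (e2 - e1).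
Proof.
  intros [f' Hf] Hb Hm He HD HB.
  replace (2 * B * (e2 - e1)) with (2 * B * e2 - 2 * B * e1) by ring.
  apply (cder_mvi (fun x => CInt (fun u => f (u, (- x)%R)) (- b) b)
    (fun x => - Ci * (f (b, (- x)%R) - f ((- b)%R, (- x)%R)))%C (fun x => 2 * B * x) (fun _ => 2 * B)); auto.
  - intros x0 Hx0.
    assert (HF : forall x u, Rabs (x - x0) < m -> - b - m < u < b + m ->
      cder (fun r => f (r, (- x)%R)) u (f' (u, (- x)%R)) /\ cder (fun r => f (u, r)) (- x) (Ci * f' (u, (- x)%R))%C /\
      ccont f (u, (- x)%R) /\ ccont f' (u, (- x)%R)).
    { intros x u Hx Hu. apply Hf. apply HD; auto. apply Rabs_def2 in Hx. lra. }
    assert (H00 : Rabs (x0 - x0) < m) by (rewrite Rminus_diag, Rabs_R0; auto).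
    assert (Hopp : forall x : R, is_derive (fun r => - r) x (-1)) by (intros; auto_derive; auto; ring).
    split.
    + eapply is_derive_eq.
      * apply (is_derive_RInt_param_2d (fun x u => Re (f (u, (- x)%R))) (fun x u => Im (f' (u, (- x)%R))) (- b) b x0 m); [lra|auto|].
        intros x u Hx Hu. destruct (HF x u Hx Hu) as [F1 [F2 [F3 F4]]]. split; [|split].
        -- eapply is_derive_eq; [apply (is_derive_comp_R (fun r => Re (f (u, r))) (fun r => - r)); [apply F2|apply Hopp]|].
           unfold Ci, Cmult, Re, Im; simpl. ring.
        -- apply (continuity_2d_pt_swap_opp (fun z => Im (f' z))). apply F4.
        -- apply (continuous_line (fun z => Re (f z))). apply F3.
      * assert (HR : is_RInt (fun u => Im (f' (u, (- x0)%R))) (- b) b (Im (f (b, (- x0)%R)) - Im (f ((- b)%R, (- x0)%R)))).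
        { apply (is_RInt_derive (fun u => Im (f (u, (- x0)%R)))).
          - intros u Hu. rewrite Rmin_left, Rmax_right in Hu by lra. apply HF; auto; lra.
          - intros u Hu. rewrite Rmin_left, Rmax_right in Hu by lra.
            apply (continuous_line (fun z => Im (f' z))). apply HF; auto; lra. }
        rewrite (is_RInt_unique _ _ _ _ HR). unfold Ci, Cminus, Copp, Cplus, Cmult, Re, Im; simpl. ring.
    + eapply is_derive_eq.
      * apply (is_derive_RInt_param_2d (fun x u => Im (f (u, (- x)%R))) (fun x u => - Re (f' (u, (- x)%R))) (- b) b x0 m); [lra|auto|].
        intros x u Hx Hu. destruct (HF x u Hx Hu) as [F1 [F2 [F3 F4]]]. split; [|split].
        -- eapply is_derive_eq; [apply (is_derive_comp_R (fun r => Im (f (u, r))) (fun r => - r)); [apply F2|apply Hopp]|].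
           unfold Ci, Cmult, Re, Im; simpl. ring.
        -- apply continuity_2d_pt_opp. apply (continuity_2d_pt_swap_opp (fun z => Re (f' z))). apply F4.
        -- apply (continuous_line (fun z => Im (f z))). apply F3.
      * assert (HR : is_RInt (fun u => - Re (f' (u, (- x0)%R))) (- b) b ((- Re (f (b, (- x0)%R))) - (- Re (f ((- b)%R, (- x0)%R))))).
        { apply (is_RInt_derive (fun u => - Re (f (u, (- x0)%R)))).
          - intros u Hu. rewrite Rmin_left, Rmax_right in Hu by lra.
            apply (is_derive_opp (fun u => Re (f (u, (- x0)%R)))). apply HF; auto; lra.
          - intros u Hu. rewrite Rmin_left, Rmax_right in Hu by lra.
            apply (continuous_opp (fun u => Re (f' (u, (- x0)%R)))).
            apply (continuous_line (fun z => Re (f' z))). apply HF; auto; lra. }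
        rewrite (is_RInt_unique _ _ _ _ HR). unfold Ci, Cminus, Copp, Cplus, Cmult, Re, Im; simpl. ring.
  - intros x _. auto_derive; auto. ring.
  - intros x Hx. destruct (HB x Hx) as [H1 H2]. rewrite Cmod_mult, Cmod_opp, Cmod_Ci.
    assert (H := Cmod_minus_le (f (b, (- x)%R)) (f ((- b)%R, (- x)%R))). lra.
Qed.

(** * The kernel and contour integrals with zeta *)

Definition zs (t : R) (x : C) : C := (/ 2 + Ci * (RtoC t + x))%C.

Lemma zs_pair (t u y : R) : zs t (u, y) = (/ 2 - y, t + u).
Proof. unfold zs, Ci, Cinv, RtoC, Cmult, Cplus; simpl. f_equal; field. Qed.

Lemma Hol_zs (D : C -> Prop) (t : R) : Hol D (zs t).
Proof.
  unfold zs. apply Hol_plus; [apply Hol_const|]. apply Hol_mult; [apply Hol_const|].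
  apply Hol_plus; [apply Hol_const|apply Hol_id].
Qed.

Lemma Hol_Rcpow (D : C -> Prop) (m : R) (f : C -> C) : Hol D f -> Hol D (fun z => Rcpow m (f z)).
Proof. intros H. unfold Rcpow. apply Hol_exp. apply Hol_mult; [apply Hol_const|auto]. Qed.

Lemma Hol_zetaN (D : C -> Prop) (t : R) (N : nat) : (forall z, D z -> (zs t z - 1)%C <> 0%C) ->
  Hol D (fun z => zetaN N (zs t z)).
Proof.
  intros HD.
  assert (Hm : Hol D (fun z => zs t z - 1)%C) by (apply Hol_minus; [apply Hol_zs|apply Hol_const]).
  assert (Hi : Hol D (fun z => / (zs t z - 1))%C).
  { apply Hol_inv; auto. }
  assert (Hp : Hol D (fun z => 1 - zs t z)%C) by (apply Hol_minus; [apply Hol_const|apply Hol_zs]).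
  assert (Hn : Hol D (fun z => - zs t z)%C).
  { apply (Hol_ext D (fun z => 0 - zs t z)%C); [intros; ring|].
    apply Hol_minus; [apply Hol_const|apply Hol_zs]. }
  unfold zetaN. apply Hol_plus; auto.
  apply (Hol_csum D (fun k z => zterm (zs t z) k)). intros k. unfold zterm. cbv zeta.
  apply Hol_minus; [apply Hol_Rcpow; auto|]. unfold Cdiv. apply Hol_mult; auto.
  apply Hol_minus; apply Hol_Rcpow; auto.
Qed.

Lemma zeta_approx_half (N : nat) (s : C) (S0 a : R) : (1 <= N)%nat -> (s - 1)%C <> 0%C -> 0 < a <= Re s ->
  Cmod s <= S0 -> Cmod (zeta s - zetaN N s) <= S0 / a * Rpower (INR N) (- a).
Proof.
  intros HN Hi Ha HS. eapply Rle_trans; [apply zeta_approx; auto; lra|].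
  assert (HN1 := INR_ge_1 N HN). assert (H0 := Cmod_ge_0 s).
  assert (H1 : Rpower (INR N) (- Re s) <= Rpower (INR N) (- a)) by (apply Rle_Rpower; lra).
  assert (H2 : / Re s <= / a) by (apply Rinv_le_contravar; lra).
  assert (H3 : 0 < Rpower (INR N) (- Re s)) by apply exp_pos.
  replace (S0 / a * Rpower (INR N) (- a)) with (S0 * Rpower (INR N) (- a) * / a) by (field; lra).
  apply Rmult_le_compat; auto.
  - apply Rmult_le_pos; lra.
  - left; apply Rinv_0_lt_compat; lra.
  - apply Rmult_le_compat; auto; lra.
Qed.

Lemma zs_minus_1_neq (t : R) (z : C) : - t < Re z -> (zs t z - 1)%C <> 0%C.
Proof. destruct z as [u y]. intros H. apply s_minus_1_neq. rewrite zs_pair. simpl in *. lra. Qed.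

(** Since y < 1/4, all points within 1/8 have Re s >= 1/8; there [zetaN N] is within 8 S0 N^(-1/8)
    of zeta. *)
Lemma ccont_zeta_gen (t u y r0 : R) : 0 < r0 -> y < / 4 ->
  (forall u' y', Rabs (u' - u) < r0 -> Rabs (y' - y) < r0 -> (zs t (u', y') - 1)%C <> 0%C) ->
  ccont (fun z => zeta (zs t z)) (u, y).
Proof.
  intros Hr0 Hy Hn. apply ccont_approx. intros eps. assert (he := cond_pos eps).
  set (S0 := 2 + Rabs y + (Rabs t + Rabs u)).
  assert (Hy0 := Rabs_pos y). assert (Ht0 := Rabs_pos t). assert (Hu0 := Rabs_pos u).
  assert (HS0 : 0 < S0) by (unfold S0; lra).
  assert (Hlim := is_lim_seq_Rpower_neg (/ 8) ltac:(lra)).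
  apply (is_lim_seq_spec _ 0) in Hlim.
  assert (Hq : 0 < eps / (8 * S0)) by (apply Rdiv_lt_0_compat; lra).
  destruct (Hlim (mkposreal _ Hq)) as [N0 HN0]. simpl in HN0.
  set (N := S N0). specialize (HN0 N ltac:(unfold N; lia)).
  rewrite Rminus_0_r, Rabs_pos_eq in HN0 by (left; apply exp_pos).
  exists (fun z => zetaN N (zs t z)). split.
  - destruct (Hol_zetaN (fun z => (zs t z - 1)%C <> 0%C) t N) as [f' Hf]; [auto|]. apply (Hf u y).
    apply Hn; rewrite Rminus_diag, Rabs_R0; auto.
  - set (r := Rmin (/ 8) r0).
    assert (Hr : 0 < r) by (apply Rmin_glb_lt; lra).
    assert (Hr1 : r <= / 8) by apply Rmin_l. assert (Hr2 : r <= r0) by apply Rmin_r.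
    exists (mkposreal r Hr). intros [u' y'] [B1 B2]. simpl in B1, B2.
    change (Rabs (u' - u) < r) in B1. change (Rabs (y' - y) < r) in B2.
    apply Rle_trans with (S0 / / 8 * Rpower (INR N) (- / 8)).
    + assert (B1' := Rabs_def2 _ _ B1). assert (B2' := Rabs_def2 _ _ B2).
      apply zeta_approx_half; [unfold N; lia|apply Hn; lra| |]; rewrite ?zs_pair; simpl Re; simpl Im.
      * lra.
      * eapply Rle_trans; [apply Cmod_le_Re_Im|]. simpl.
        replace (/ 2 - y') with (/ 2 + - (y' - y) + - y) by ring.
        replace (t + u') with (t + u + (u' - u)) by ring.
        assert (T1 := Rabs_triang (/ 2 + - (y' - y)) (- y)). assert (T2 := Rabs_triang (/ 2) (- (y' - y))).
        assert (T3 := Rabs_triang (t + u) (u' - u)). assert (T4 := Rabs_triang t u).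
        rewrite !Rabs_Ropp in *. rewrite (Rabs_pos_eq (/ 2)) in T2 by lra. unfold S0. lra.
    + apply Rlt_le. replace (S0 / / 8) with (8 * S0) by field.
      apply Rmult_lt_reg_l with (/ (8 * S0)); [apply Rinv_0_lt_compat; lra|].
      rewrite <- Rmult_assoc, Rinv_l, Rmult_1_l by lra. unfold Rdiv in HN0. lra.
Qed.

Lemma ccont_zeta (t u y : R) : - t < u -> y < / 4 -> ccont (fun z => zeta (zs t z)) (u, y).
Proof.
  intros Hu Hy. apply (ccont_zeta_gen t u y (t + u)); [lra|auto|].
  intros u' y' H _. apply zs_minus_1_neq. simpl. apply Rabs_def2 in H. lra.
Qed.

Lemma ccont_zeta_line (t u : R) : ccont (fun r : R => zeta (zs t (r, (- / 4)%R))) u.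
Proof.
  apply (ccont_line (fun z => zeta (zs t z))). apply (ccont_zeta_gen t u (- / 4) (/ 8)); [lra|lra|].
  intros u' y' _ H E. apply Rabs_def2 in H. rewrite zs_pair in E. injection E as E1 E2. lra.
Qed.

Lemma Hol_ccont (D : C -> Prop) (f : C -> C) (u y : R) : Hol D f -> D (u, y) -> ccont f (u, y).
Proof. intros [f' Hf] H. apply (Hf u y H). Qed.

(** The shift is made for P times [zetaN N]. As Re s >= 1/2 on the rectangle, the approximation
    error is of order N^(-1/2) uniformly, for the two integrals and for the edge values alike, and
    disappears in the limit. *)
Lemma zeta_contour_shift (D : C -> Prop) (P : C -> C) (t b m e1 e2 B kappa : R) :
  Hol D P -> 0 < b -> 0 < m -> 0 <= e1 <= e2 ->
  (forall u x, - b - m < u < b + m -> e1 - m < x < e2 + m -> D (u, (- x)%R)) ->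
  (forall z, D z -> - t < Re z) ->
  (forall u x, - b <= u <= b -> e1 <= x <= e2 -> Cmod (P (u, (- x)%R)) <= kappa) ->
  (forall x, e1 <= x <= e2 -> Cmod (P (b, (- x)%R) * zeta (zs t (b, (- x)%R)))%C <= B /\
     Cmod (P ((- b)%R, (- x)%R) * zeta (zs t ((- b)%R, (- x)%R)))%C <= B) ->
  Cmod (CInt (fun u => P (u, (- e2)%R) * zeta (zs t (u, (- e2)%R)))%C (- b) b
      - CInt (fun u => P (u, (- e1)%R) * zeta (zs t (u, (- e1)%R)))%C (- b) b) <= 2 * B * (e2 - e1).
Proof.
  intros HP Hb Hm He HD Ht Hk HB.
  set (f := fun z => (P z * zeta (zs t z))%C).
  set (S0 := 1 + e2 + (Rabs t + b)).
  assert (Ht0 := Rabs_pos t). assert (HS0 : 0 < S0) by (unfold S0; lra).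
  assert (Hk0 : 0 <= kappa).
  { eapply Rle_trans; [apply Cmod_ge_0|apply (Hk 0 e1); lra]. }
  assert (Htu : forall u, - b <= u <= b -> - t < u).
  { intros u Hu. apply (Ht (u, (- e1)%R)). apply HD; lra. }
  apply (le_of_le_plus_inv _ _ (2 * (kappa * (S0 * 2)) * (e2 - e1) + 2 * (2 * b * (kappa * (S0 * 2)))) 0).
  intros M _ HM. assert (HMr := INR_ge_1 M HM).
  (* A square, so that N^(-1/2) is exactly 1/M. *)
  set (N := (M * M)%nat). set (fN := fun z => (P z * zetaN N (zs t z))%C).
  set (c := kappa * (S0 * 2) / INR M).
  assert (HfN : Hol D fN) by (apply Hol_mult; auto; apply Hol_zetaN; intros; apply zs_minus_1_neq; auto).
  assert (Hdiff : forall u x, - b <= u <= b -> e1 <= x <= e2 -> Cmod (f (u, (- x)%R) - fN (u, (- x)%R)) <= c).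
  { intros u x Hu Hx. unfold f, fN.
    match goal with |- Cmod (?p * ?a - ?p * ?b)%C <= _ => replace (p * a - p * b)%C with (p * (a - b))%C by ring end.
    rewrite Cmod_mult. unfold c.
    replace (kappa * (S0 * 2) / INR M) with (kappa * (S0 / / 2 * / INR M)) by (field; lra).
    apply Rmult_le_compat; try apply Cmod_ge_0; [apply Hk; auto|].
    assert (E : / INR M = Rpower (INR N) (- / 2)).
    { unfold N. rewrite mult_INR, Rpower_Ropp, Rpower_sqrt by nra. rewrite sqrt_square; lra. }
    rewrite E. specialize (Htu u Hu).
    apply zeta_approx_half; [unfold N; nia|apply zs_minus_1_neq; auto| |]; rewrite ?zs_pair; simpl Re; simpl Im; [lra|].
    eapply Rle_trans; [apply Cmod_le_Re_Im|]. simpl.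
    rewrite (Rabs_pos_eq (/ 2 - - x)) by lra.
    assert (T := Rabs_triang t u). assert (Rabs u <= b) by (apply Rabs_le; lra). unfold S0. lra. }
  assert (HB' : forall x, e1 <= x <= e2 -> Cmod (fN (b, (- x)%R)) <= B + c /\ Cmod (fN ((- b)%R, (- x)%R)) <= B + c).
  { intros x Hx. destruct (HB x Hx) as [B1 B2].
    assert (D1 := Hdiff b x ltac:(lra) Hx). assert (D2 := Hdiff (- b) x ltac:(lra) Hx).
    rewrite Cmod_minus_sym in D1, D2.
    assert (G1 := Cmod_minus_ge (fN (b, (- x)%R)) (f (b, (- x)%R))).
    assert (G2 := Cmod_minus_ge (fN ((- b)%R, (- x)%R)) (f ((- b)%R, (- x)%R))).
    change (Cmod (f (b, (- x)%R)) <= B) in B1. change (Cmod (f ((- b)%R, (- x)%R)) <= B) in B2. lra. }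
  assert (HS := contour_shift D fN b m e1 e2 (B + c) HfN Hb Hm ltac:(lra) HD HB').
  assert (Hcf : forall u x, - b <= u <= b -> e1 <= x <= e2 -> ccont (fun r => f (r, (- x)%R)) u).
  { intros u x Hu Hx. apply ccont_line. unfold f. apply ccont_mult.
    - apply (Hol_ccont D); auto. apply HD; lra.
    - apply ccont_zeta; [auto|lra]. }
  assert (HcN : forall u x, - b <= u <= b -> e1 <= x <= e2 -> ccont (fun r => fN (r, (- x)%R)) u).
  { intros u x Hu Hx. apply ccont_line. apply (Hol_ccont D); auto. apply HD; lra. }
  assert (Hd : forall x, e1 <= x <= e2 ->
    Cmod (CInt (fun u => f (u, (- x)%R)) (- b) b - CInt (fun u => fN (u, (- x)%R)) (- b) b) <= 2 * b * c).
  { intros x Hx. rewrite <- CInt_minus; [|lra|intros; apply Hcf; auto|intros; apply HcN; auto].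
    eapply Rle_trans; [apply (Cmod_CInt_le_const _ c); [lra| |]|].
    - intros u Hu. apply ccont_minus; [apply Hcf|apply HcN]; auto.
    - intros u Hu. apply Hdiff; auto.
    - right; ring. }
  assert (D1 := Hd e1 ltac:(lra)). assert (D2 := Hd e2 ltac:(lra)).
  change (Cmod (CInt (fun u => f (u, (- e2)%R)) (- b) b - CInt (fun u => f (u, (- e1)%R)) (- b) b) <=
    2 * B * (e2 - e1) + (2 * (kappa * (S0 * 2)) * (e2 - e1) + 2 * (2 * b * (kappa * (S0 * 2)))) / INR M).
  set (A1 := CInt (fun u => f (u, (- e1)%R)) (- b) b) in *. set (A2 := CInt (fun u => f (u, (- e2)%R)) (- b) b) in *.
  set (N1 := CInt (fun u => fN (u, (- e1)%R)) (- b) b) in *. set (N2 := CInt (fun u => fN (u, (- e2)%R)) (- b) b) in *.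
  replace (A2 - A1)%C with ((A2 - N2) + (N2 - N1) - (A1 - N1))%C by ring.
  eapply Rle_trans; [apply Cmod_minus_le|].
  assert (T := Cmod_triangle (A2 - N2) (N2 - N1)).
  replace ((2 * (kappa * (S0 * 2)) * (e2 - e1) + 2 * (2 * b * (kappa * (S0 * 2)))) / INR M)
    with (2 * c * (e2 - e1) + 2 * (2 * b * c)) by (unfold c; field; lra).
  lra.
Qed.

(** * The kernel: decay and cancellation of its pole at 0 *)

Definition kap (z : C) : C := (RtoC PI / (2 * Csinh (RtoC PI * z / 2)))%C.

Lemma Cmod_Csinh_sq (a b : R) : Cmod (Csinh (a, b)) ^ 2 = sinh a ^ 2 + sin b ^ 2.
Proof.
  rewrite Cmod2_alt. unfold Csinh, Cexp, Cminus, Copp, Cdiv, Cinv, Cplus, Cmult, RtoC, Re, Im; simpl.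
  rewrite cos_neg, sin_neg. unfold sinh.
  assert (He : exp a * exp (- a) = 1) by (rewrite <- exp_plus, Rplus_opp_r; apply exp_0).
  assert (Hsc := sin2_cos2 b). unfold Rsqr in Hsc.
  set (E := exp a) in *. set (F := exp (- a)) in *. set (s := sin b) in *. set (c := cos b) in *.
  match goal with |- ?l = _ => transitivity (((E - F) * (E - F) * (c * c) + (E + F) * (E + F) * (s * s)) / 4); [field|] end.
  replace (c * c) with (1 - s * s) by lra.
  transitivity (((E - F) * (E - F) + 4 * (E * F) * (s * s)) / 4); [field|]. rewrite He. field.
Qed.

Lemma PI_half_pair (u y : R) : (RtoC PI * (u, y) / 2)%C = (PI * u / 2, PI * y / 2).
Proof. unfold Cdiv, Cinv, Cmult, RtoC; simpl. f_equal; field. Qed.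

Lemma Csinh_ge_of_sq (z : C) (c : R) : 0 <= c -> c ^ 2 <= Cmod (Csinh z) ^ 2 -> c <= Cmod (Csinh z).
Proof. intros Hc H. apply le_of_sq_le; [apply Cmod_ge_0|]. simpl in H. lra. Qed.

Lemma Cmod_kap_le (u y c : R) : 0 < c -> c ^ 2 <= sinh (PI * u / 2) ^ 2 + sin (PI * y / 2) ^ 2 ->
  Cmod (kap (u, y)) <= 2 / c.
Proof.
  intros Hc H. unfold kap. rewrite PI_half_pair. rewrite <- Cmod_Csinh_sq in H.
  apply Csinh_ge_of_sq in H; [|lra]. assert (HP := PI_RGT_0). assert (HP4 := PI_4).
  unfold Cdiv. rewrite Cmod_mult, Cmod_R, Rabs_pos_eq by lra.
  assert (Hi : Cmod (/ (2 * Csinh ((PI * u / 2)%R, (PI * y / 2)%R))) <= / (2 * c)).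
  { apply Cmod_inv_le; [lra|]. rewrite Cmod_mult, Cmod_R, Rabs_pos_eq by lra. lra. }
  apply Rle_trans with (4 * / (2 * c)); [|right; field; lra].
  apply Rmult_le_compat; auto; [lra|apply Cmod_ge_0].
Qed.

Lemma sinh_sq_abs (a : R) : sinh a ^ 2 = sinh (Rabs a) ^ 2.
Proof.
  unfold Rabs. destruct (Rcase_abs a); [|reflexivity]. unfold sinh. rewrite Ropp_involutive. field.
Qed.

Lemma Rabs_half_pi (u : R) : Rabs (PI * u / 2) = PI * Rabs u / 2.
Proof.
  assert (HP := PI_RGT_0). unfold Rdiv. rewrite !Rabs_mult, (Rabs_pos_eq PI), (Rabs_pos_eq (/ 2)) by lra. ring.
Qed.

(** The true rate is PI/2. The rate 3/2 leaves a factor exp(-|u|/2) to absorb powers of |u| while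
    exp(-|u|) is kept for integration. *)
Lemma kap_bound_far (u y : R) : 1 <= Rabs u -> Cmod (kap (u, y)) <= 8 * exp (- (3 / 2 * Rabs u)).
Proof.
  intros Hu. assert (HP := PI2_3_2). set (a := PI * Rabs u / 2).
  assert (Ha : 3 / 2 * Rabs u <= a) by (unfold a; nra).
  assert (He : 0 < exp (3 / 2 * Rabs u)) by apply exp_pos.
  replace (8 * exp (- (3 / 2 * Rabs u))) with (2 / (exp (3 / 2 * Rabs u) / 4)) by (rewrite exp_Ropp; field; lra).
  apply Cmod_kap_le; [lra|].
  rewrite sinh_sq_abs, Rabs_half_pi. fold a.
  assert (Hs : exp (3 / 2 * Rabs u) / 4 <= sinh a).
  { apply Rle_trans with (exp a / 4); [assert (H := exp_le _ _ Ha); lra|]. unfold sinh.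
    assert (H1 := exp_ineq1_le a). assert (H2 : exp (- a) <= 1) by (rewrite <- exp_0; apply exp_le; lra). lra. }
  assert (H0 := pow2_ge_0 (sin (PI * y / 2))).
  assert (Hp : 0 <= exp (3 / 2 * Rabs u) / 4) by lra.
  assert (H1 := pow_incr _ _ 2 (conj Hp Hs)). lra.
Qed.

(** The sine accounts for the poles 0 and -2i. As s <= 1, sinh^2 a + s^2 >= s^2 cosh^2 a, and cosh a
    is at least e^a/2. *)
Lemma kap_bound_line (u x : R) : 0 < x < 2 ->
  Cmod (kap (u, (- x)%R)) <= 4 / sin (PI * x / 2) * exp (- (3 / 2 * Rabs u)).
Proof.
  intros Hx. assert (HP := PI2_3_2). set (a := PI * Rabs u / 2). set (s := sin (PI * x / 2)).
  assert (Hs : 0 < s) by (apply sin_gt_0; nra).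
  assert (Hs1 : s <= 1) by apply SIN_bound.
  assert (Hu0 := Rabs_pos u).
  assert (Ha : 3 / 2 * Rabs u <= a) by (unfold a; nra).
  assert (He : 0 < exp (3 / 2 * Rabs u)) by apply exp_pos.
  replace (4 / s * exp (- (3 / 2 * Rabs u))) with (2 / (s * exp (3 / 2 * Rabs u) / 2)) by (rewrite exp_Ropp; field; lra).
  apply Cmod_kap_le; [nra|].
  rewrite sinh_sq_abs, Rabs_half_pi. fold a.
  replace (PI * - x / 2) with (- (PI * x / 2)) by field. rewrite sin_neg. fold s.
  assert (H1 := exp_le _ _ Ha). unfold sinh.
  assert (Hef : exp a * exp (- a) = 1) by (rewrite <- exp_plus, Rplus_opp_r; apply exp_0).
  assert (Hf : 0 < exp (- a)) by apply exp_pos.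
  set (E := exp a) in *. set (F := exp (- a)) in *. set (G := exp (3 / 2 * Rabs u)) in *.
  replace (((E - F) / 2) ^ 2 + (- s) ^ 2) with ((E * E + F * F - 2 * (E * F)) / 4 + s * s) by field. rewrite Hef.
  replace ((s * G / 2) ^ 2) with (s * s * (G * G) / 4) by field.
  assert (HGE : G * G <= E * E) by nra.
  assert (HEE : 1 <= E * E).
  { assert (1 <= E) by (unfold E; rewrite <- exp_0; apply exp_le; lra). nra. }
  assert (Hss : 0 < s * s <= 1) by nra.
  assert (s * s * (G * G) <= s * s * (E * E)) by (apply Rmult_le_compat_l; lra).
  assert (0 <= (1 - s * s) * (E * E + F * F - 2)).
  { apply Rmult_le_pos; [lra|]. assert (0 <= (E - F) * (E - F)) by apply Rle_0_sqr. lra. }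
  nra.
Qed.

Lemma sinh_ge_id (a : R) : 0 <= a -> a <= sinh a.
Proof.
  intros Ha. assert (H : sinh 0 - 0 <= sinh a - a).
  { apply (incr_of_derive_nonneg (fun x => sinh x - x) (fun x => cosh x - 1)); auto.
    - intros x _. unfold sinh, cosh. auto_derive; auto. field.
    - intros x _. unfold cosh.
      assert (Hp := exp_ineq1_le x). assert (Hq := exp_ineq1_le (- x)). lra. }
  rewrite sinh_0 in H. lra.
Qed.

(** From sinh a >= a with PI/2 >= 1, and Jordan's inequality: near 0 the kernel is at most 2/|z|. *)
Lemma Csinh_ge_near (u y : R) : Rabs y <= 1 ->
  Cmod (u, y) ^ 2 <= sinh (PI * u / 2) ^ 2 + sin (PI * y / 2) ^ 2.
Proof.
  intros Hy. assert (HP := PI2_3_2). assert (Hu0 := Rabs_pos u). assert (Hy0 := Rabs_pos y).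
  rewrite Cmod2_alt. simpl Re. simpl Im. apply Rplus_le_compat.
  - rewrite sinh_sq_abs, Rabs_half_pi, <- (pow2_abs u). apply pow_incr. split; auto.
    eapply Rle_trans; [|apply sinh_ge_id; nra]. nra.
  - assert (H : forall r, 0 <= r <= 1 -> r ^ 2 <= sin (PI * r / 2) ^ 2).
    { intros r Hr. apply pow_incr. split; [lra|]. eapply Rle_trans; [|apply sin_ge_linear; nra].
      right; field; lra. }
    unfold Rabs in Hy. destruct (Rcase_abs y) as [Hneg|Hpos].
    + specialize (H (- y) ltac:(lra)). replace (PI * - y / 2) with (- (PI * y / 2)) in H by field.
      rewrite sin_neg in H. nra.
    + apply H; lra.
Qed.

Lemma sq_kap_bound_near (z : C) : Rabs (Im z) <= 1 -> Cmod (z * z * kap z) <= 2 * Cmod z.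
Proof.
  intros Hy. destruct z as [u y]. simpl in Hy.
  (* At 0 the factor z^2 makes the product 0 whatever the division by zero returns, and 0 is the
     value of the continuous extension. *)
  destruct (Ceq_dec (u, y) 0%C) as [E|Hn].
  - rewrite E. rewrite !Cmult_0_l, Cmod_0. lra.
  - assert (Hp : 0 < Cmod (u, y)) by (apply Cmod_gt_0; auto).
    assert (Hk := Cmod_kap_le u y (Cmod (u, y)) Hp (Csinh_ge_near u y Hy)).
    rewrite !Cmod_mult.
    apply Rle_trans with (Cmod (u, y) * Cmod (u, y) * (2 / Cmod (u, y))).
    + apply Rmult_le_compat_l; auto. nra.
    + right; field; lra.
Qed.

Lemma Hol_kap (D : C -> Prop) : (forall u y, D (u, y) -> 0 < sinh (PI * u / 2) ^ 2 + sin (PI * y / 2) ^ 2) ->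
  Hol D kap.
Proof.
  intros HD. unfold kap, Cdiv. apply Hol_mult; [apply Hol_const|].
  assert (Hlin : Hol D (fun z => RtoC PI * z * / 2)%C)
    by (apply Hol_mult; [apply Hol_mult; [apply Hol_const|apply Hol_id]|apply Hol_const]).
  apply Hol_inv.
  - intros [u y] Hz. specialize (HD u y Hz). rewrite <- Cmod_Csinh_sq in HD.
    apply Cmult_neq_0; [apply RtoC_neq_0; lra|].
    assert (E := PI_half_pair u y). unfold Cdiv in E. rewrite E.
    apply Cmod_gt_0. assert (H0 := Cmod_ge_0 (Csinh ((PI * u / 2)%R, (PI * y / 2)%R))). nra.
  - apply Hol_mult; [apply Hol_const|]. unfold Csinh, Cdiv. apply Hol_mult; [|apply Hol_const].
    apply Hol_minus; apply Hol_exp; auto.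
    apply (Hol_ext D (fun z => 0 - RtoC PI * z * / 2)%C); [intros; ring|].
    apply Hol_minus; [apply Hol_const|auto].
Qed.

Lemma ccont_sq_kap (u y : R) : Rabs y < 1 -> ccont (fun z => z * z * kap z)%C (u, y).
Proof.
  intros Hy. destruct (Ceq_dec (u, y) 0%C) as [E|Hn].
  - injection E as -> ->. apply ccont_approx. intros eps. assert (he := cond_pos eps).
    exists (fun _ => 0%C). split; [apply ccont_const|].
    set (r := Rmin 1 (eps / 4)). assert (Hr : 0 < r) by (apply Rmin_glb_lt; lra).
    assert (Hr1 : r <= 1) by apply Rmin_l. assert (Hr2 : r <= eps / 4) by apply Rmin_r.
    exists (mkposreal r Hr). intros [u' y'] [B1 B2]. simpl in B1, B2.
    change (Rabs (u' - 0) < r) in B1. change (Rabs (y' - 0) < r) in B2. rewrite Rminus_0_r in B1, B2.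
    match goal with |- Cmod (?x - _)%C <= _ => replace (x - 0)%C with x by ring end.
    eapply Rle_trans; [apply sq_kap_bound_near; simpl; lra|].
    assert (H := Cmod_le_Re_Im (u', y')). simpl in H. lra.
  - apply (Hol_ccont (fun z => Rabs (Im z) < 1 /\ z <> 0%C)); [|simpl; auto].
    apply Hol_mult; [apply Hol_mult; apply Hol_id|]. apply Hol_kap. intros u' y' [H1 H2]. simpl in H1.
    eapply Rlt_le_trans; [|apply Csinh_ge_near; lra]. apply pow_lt. apply Cmod_gt_0; auto.
Qed.

(** Contours are moved only below the real axis, inside the strip where the kernel is holomorphic;
    the axis itself is reached from depth e by uniform continuity. *)
Lemma CInt_line_limit (f : C -> C) (b : R) : 0 < b ->
  (forall u, - b <= u <= b -> ccont f (u, 0)) ->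
  forall eps, 0 < eps -> exists d, 0 < d /\ forall e, 0 < e < d ->
    (forall u, - b <= u <= b -> ccont f (u, (- e)%R)) ->
    Cmod (CInt (fun u => f (u, (- e)%R)) (- b) b - CInt (fun u => f (u, 0)) (- b) b) <= eps.
Proof.
  intros Hb Hf eps Heps.
  assert (Hq : 0 < eps / (4 * b)) by (apply Rdiv_lt_0_compat; lra).
  assert (Hu : forall g : C -> R, (forall u, - b <= u <= b -> continuous g (u, 0)) ->
    exists d : posreal, forall u e, - b <= u <= b -> 0 < e < d -> Rabs (g (u, (- e)%R) - g (u, 0)) < eps / (4 * b)).
  { intros g Hg. destruct (uniform_continuity_2d_1d (fun a c => g (a, c)) (- b) b 0) with (eps := mkposreal _ Hq) as [d Hd].
    - intros x Hx. apply continuity_2d_pt_filterlim.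
      apply (continuous_ext g (fun z => g (fst z, snd z))); [intros [p q]; reflexivity|]. apply Hg; auto.
    - exists d. intros u e Hu He. assert (hd := cond_pos d). simpl in Hd.
      apply (Hd u 0 u (- e)); try lra. rewrite Rminus_diag, Rabs_R0; lra. }
  destruct (Hu (fun z => Re (f z))) as [d1 H1]; [intros; apply Hf; auto|].
  destruct (Hu (fun z => Im (f z))) as [d2 H2]; [intros; apply Hf; auto|].
  assert (hd1 := cond_pos d1). assert (hd2 := cond_pos d2).
  exists (Rmin d1 d2). split; [apply Rmin_glb_lt; auto|]. intros e He Hc.
  assert (Hm1 := Rmin_l d1 d2). assert (Hm2 := Rmin_r d1 d2).
  assert (Hl0 : forall u, - b <= u <= b -> ccont (fun r : R => f (r, 0)) u) by (intros; apply ccont_line; auto).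
  assert (Hle : forall u, - b <= u <= b -> ccont (fun r : R => f (r, (- e)%R)) u) by (intros; apply ccont_line; auto).
  rewrite <- CInt_minus by (auto; lra).
  eapply Rle_trans; [apply (Cmod_CInt_le_const _ (2 * (eps / (4 * b)))); [lra| |]|].
  - intros u Hu'. apply ccont_minus; auto.
  - intros u Hu'. eapply Rle_trans; [apply Cmod_le_Re_Im|].
    specialize (H1 u e Hu' ltac:(lra)). specialize (H2 u e Hu' ltac:(lra)).
    unfold Cminus. rewrite re_plus, im_plus, re_opp, im_opp. unfold Rminus in H1, H2. lra.
  - right. field. lra.
Qed.

(** * Integrals with exponential decay *)

(** The inequality 1 + y/k <= e^(y/k) raised to the power k = n + 1. *)
Lemma pow_le_exp (n : nat) (y : R) : 0 <= y -> y ^ S n <= INR (S n) ^ S n * exp y.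
Proof.
  intros Hy. assert (Hn := INR_ge_1 (S n) ltac:(lia)). set (k := INR (S n)) in *.
  assert (E : exp y = exp (y / k) ^ S n).
  { rewrite <- Rpower_pow by apply exp_pos. unfold Rpower. rewrite ln_exp. f_equal. fold k. field. lra. }
  rewrite E, <- Rpow_mult_distr. apply pow_incr. split; auto.
  assert (H := exp_ineq1_le (y / k)).
  apply Rle_trans with (k * (1 + y / k)); [|apply Rmult_le_compat_l; lra].
  replace (k * (1 + y / k)) with (k + y) by (field; lra). lra.
Qed.

Lemma CInt_Chasles (f : R -> C) (a b c : R) : a <= b <= c -> (forall x, a <= x <= c -> ccont f x) ->
  CInt f a c = (CInt f a b + CInt f b c)%C.
Proof.
  intros H Hf. unfold CInt, Cplus; simpl. f_equal; symmetry.
  - apply (RInt_Chasles (fun r => Re (f r))); apply ex_RInt_Re; try lra; intros; apply Hf; lra.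
  - apply (RInt_Chasles (fun r => Im (f r))); apply ex_RInt_Im; try lra; intros; apply Hf; lra.
Qed.

Lemma CInt_tail_right (f : R -> C) (A M c : R) : 0 <= M <= c -> (forall x, M <= x <= c -> ccont f x) ->
  (forall u, M <= u <= c -> Cmod (f u) <= A * exp (- Rabs u)) -> 0 <= A -> Cmod (CInt f M c) <= A * exp (- M).
Proof.
  intros HM Hc Hf HA.
  assert (HI : is_RInt (fun u => A * exp (- u)) M c ((- (A * exp (- c))) - (- (A * exp (- M))))).
  { apply (is_RInt_derive (fun u => - (A * exp (- u)))).
    - intros x _. auto_derive; auto. ring.
    - intros x _. apply (ex_derive_continuous (fun u => A * exp (- u))). auto_derive; auto. }
  eapply Rle_trans; [apply (Cmod_CInt_le f (fun u => A * exp (- u))); [lra|auto| |eexists; exact HI]|].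
  - intros x Hx. specialize (Hf x Hx). rewrite Rabs_pos_eq in Hf by lra. exact Hf.
  - rewrite (is_RInt_unique _ _ _ _ HI). assert (H := exp_pos (- c)). nra.
Qed.

Lemma CInt_tail_left (f : R -> C) (A M c : R) : 0 <= M <= c -> (forall x, - c <= x <= - M -> ccont f x) ->
  (forall u, - c <= u <= - M -> Cmod (f u) <= A * exp (- Rabs u)) -> 0 <= A -> Cmod (CInt f (- c) (- M)) <= A * exp (- M).
Proof.
  intros HM Hc Hf HA.
  assert (HI : is_RInt (fun u => A * exp u) (- c) (- M) (A * exp (- M) - A * exp (- c))).
  { apply (is_RInt_derive (fun u => A * exp u)).
    - intros x _. auto_derive; auto. ring.
    - intros x _. apply (ex_derive_continuous (fun u => A * exp u)). auto_derive; auto. }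
  eapply Rle_trans; [apply (Cmod_CInt_le f (fun u => A * exp u)); [lra|auto| |eexists; exact HI]|].
  - intros x Hx. specialize (Hf x Hx). rewrite Rabs_left1, Ropp_involutive in Hf by lra. exact Hf.
  - rewrite (is_RInt_unique _ _ _ _ HI). assert (H := exp_pos (- c)). nra.
Qed.

Lemma CInt_exp_bound (f : R -> C) (A b : R) : 0 <= b -> (forall x, - b <= x <= b -> ccont f x) ->
  (forall u, - b <= u <= b -> Cmod (f u) <= A * exp (- Rabs u)) -> Cmod (CInt f (- b) b) <= 2 * A.
Proof.
  intros Hb Hc Hf.
  assert (HA : 0 <= A).
  { assert (H := Hf 0 ltac:(lra)). rewrite Rabs_R0, Ropp_0, exp_0 in H. assert (H0 := Cmod_ge_0 (f 0)). lra. }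
  rewrite (CInt_Chasles f (- b) 0 b) by (auto; lra).
  eapply Rle_trans; [apply Cmod_triangle|].
  assert (H1 : Cmod (CInt f 0 b) <= A * exp (- 0)) by (apply CInt_tail_right; auto; try lra; intros; [apply Hc|apply Hf]; lra).
  assert (H2 : Cmod (CInt f (- b) (- 0)) <= A * exp (- 0)) by (apply CInt_tail_left; auto; try lra; intros; [apply Hc|apply Hf]; lra).
  rewrite Ropp_0, exp_0 in H1, H2. lra.
Qed.

Lemma CInt_extend (f : R -> C) (A M a c : R) : (forall x, ccont f x) -> (forall u, Cmod (f u) <= A * exp (- Rabs u)) ->
  0 <= M -> a <= - M -> M <= c -> Cmod (CInt f a c - CInt f (- M) M) <= 2 * (A * exp (- M)).
Proof.
  intros Hc Hf HM Ha Hcc.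
  assert (HA : 0 <= A).
  { assert (H := Hf 0). rewrite Rabs_R0, Ropp_0, exp_0 in H. assert (H0 := Cmod_ge_0 (f 0)). lra. }
  rewrite (CInt_Chasles f a (- M) c), (CInt_Chasles f (- M) M c) by (auto; lra).
  match goal with |- Cmod (?x + (?y + ?z) - ?y)%C <= _ => replace (x + (y + z) - y)%C with (x + z)%C by ring end.
  eapply Rle_trans; [apply Cmod_triangle|].
  assert (H1 : Cmod (CInt f M c) <= A * exp (- M)) by (apply CInt_tail_right; auto; lra).
  assert (H2 : Cmod (CInt f (- - a) (- M)) <= A * exp (- M)) by (apply CInt_tail_left; auto; lra).
  rewrite Ropp_involutive in H2. lra.
Qed.

Lemma exp_neg_small (A eps : R) : 0 < eps -> exists M, 0 <= M /\ A * exp (- M) < eps.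
Proof.
  intros He. exists (Rabs A / eps). assert (HA := Rabs_pos A).
  assert (Hq : 0 <= Rabs A / eps) by (apply Rmult_le_pos; [auto|left; apply Rinv_0_lt_compat; auto]).
  split; auto. rewrite exp_Ropp. assert (H := exp_ineq1_le (Rabs A / eps)).
  set (E := exp (Rabs A / eps)) in *.
  apply Rmult_lt_reg_r with E; [lra|]. rewrite Rmult_assoc, Rinv_l by lra.
  assert (Rabs A / eps * eps = Rabs A) by (field; lra). assert (Ha := Rle_abs A). nra.
Qed.

Lemma Cmod_lt_ball (x y : C) (eps : R) : Cmod (y - x) < eps -> @ball C_R_NormedModule x eps y.
Proof. intros H. apply (C_NormedModule_mixin_compat1 x y eps). exact H. Qed.

(** [RInt_gen] is known to be the integral only once the limit exists; the exponential bound gives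
    existence by the Cauchy criterion, and the truncation error by the same tail estimate. *)
Lemma RInt_gen_tail (f : R -> C) (A b : R) : (forall x, ccont f x) -> (forall u, Cmod (f u) <= A * exp (- Rabs u)) ->
  0 <= b ->
  Cmod (@RInt_gen C_R_CompleteNormedModule f (Rbar_locally m_infty) (Rbar_locally p_infty) - CInt f (- b) b)
    <= 2 * (A * exp (- b)).
Proof.
  intros Hc Hf Hb.
  set (F := filter_prod (Rbar_locally m_infty) (Rbar_locally p_infty)).
  assert (HFP : forall M, 0 <= M -> F (fun ab : R * R => fst ab < - M /\ M < snd ab)).
  { intros M HM. exists (fun a => a < - M) (fun c => M < c).
    - exists (- M). auto.
    - exists M. auto.
    - intros; auto. }
  assert (Huniq : forall (ab : R * R) (y1 y2 : C_R_NormedModule), is_RInt f (fst ab) (snd ab) y1 -> is_RInt f (fst ab) (snd ab) y2 -> y1 = y2).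
  { intros ab y1 y2 H1 H2. apply (@is_RInt_unique C_R_CompleteNormedModule) in H1.
    apply (@is_RInt_unique C_R_CompleteNormedModule) in H2. rewrite <- H1. exact H2. }
  assert (HCI : forall a c, a <= c -> @is_RInt C_R_NormedModule f a c (CInt f a c)) by (intros; apply is_RInt_CInt; auto).
  assert (Hex : F (fun ab : R * R => (exists y : C_R_NormedModule, is_RInt f (fst ab) (snd ab) y) /\
     (forall y1 y2 : C_R_NormedModule, is_RInt f (fst ab) (snd ab) y1 -> is_RInt f (fst ab) (snd ab) y2 -> y1 = y2))).
  { apply (filter_imp (fun ab : R * R => fst ab < - 0 /\ 0 < snd ab)); [|apply HFP; lra].
    intros ab Hab. split; [|apply Huniq]. exists (CInt f (fst ab) (snd ab)). apply HCI. lra. }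
  destruct (proj1 (filterlimi_locally_cauchy (U := C_R_CompleteNormedModule) (F := F)
     (fun ab : R * R => @is_RInt C_R_NormedModule f (fst ab) (snd ab)) Hex)) as [l Hl].
  { intros eps. assert (he := cond_pos eps).
    destruct (exp_neg_small (4 * A) eps he) as [M [HM0 HM]].
    exists (fun ab : R * R => fst ab < - M /\ M < snd ab). split; [apply HFP; auto|].
    intros p q Hp Hq p' q' Hp' Hq'.
    assert (Ep : p' = CInt f (fst p) (snd p)) by (apply (Huniq p); auto; apply HCI; lra).
    assert (Eq : q' = CInt f (fst q) (snd q)) by (apply (Huniq q); auto; apply HCI; lra).
    rewrite Ep, Eq. apply Cmod_lt_ball.
    assert (H1 := CInt_extend f A M (fst p) (snd p) Hc Hf HM0 ltac:(lra) ltac:(lra)).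
    assert (H2 := CInt_extend f A M (fst q) (snd q) Hc Hf HM0 ltac:(lra) ltac:(lra)).
    replace (CInt f (fst q) (snd q) - CInt f (fst p) (snd p))%C with
      ((CInt f (fst q) (snd q) - CInt f (- M) M) - (CInt f (fst p) (snd p) - CInt f (- M) M))%C by ring.
    eapply Rle_lt_trans; [apply Cmod_minus_le|]. lra. }
  assert (HG : @is_RInt_gen C_R_NormedModule f (Rbar_locally m_infty) (Rbar_locally p_infty) l) by exact Hl.
  rewrite (@is_RInt_gen_unique C_R_CompleteNormedModule _ _ _ _ f l HG).
  apply le_epsilon. intros eps Heps.
  assert (Hsq : 0 < eps / 2) by lra.
  destruct (proj1 (filterlimi_locally _ l) Hl (mkposreal _ Hsq)) as [Q1 Q2 HQ1 HQ2 HQ].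
  destruct HQ1 as [m1 Hm1]. destruct HQ2 as [m2 Hm2].
  (* Far enough out for the limit, and outside [-b, b]. *)
  set (a := Rmin (m1 - 1) (- b)). set (c := Rmax (m2 + 1) b).
  assert (Ha1 := Rmin_l (m1 - 1) (- b)). assert (Ha2 := Rmin_r (m1 - 1) (- b)).
  assert (Hc1 := Rmax_l (m2 + 1) b). assert (Hc2 := Rmax_r (m2 + 1) b).
  fold a in Ha1, Ha2. fold c in Hc1, Hc2.
  destruct (HQ a c (Hm1 a ltac:(lra)) (Hm2 c ltac:(lra))) as [w [Hw HB]].
  assert (Ew : w = CInt f a c) by (apply (Huniq (a, c)); auto; apply HCI; simpl; lra).
  rewrite Ew in HB. destruct HB as [B1 B2]. simpl in B1, B2.
  change (Rabs (Re (CInt f a c) - Re l) < eps / 2) in B1. change (Rabs (Im (CInt f a c) - Im l) < eps / 2) in B2.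
  assert (HX := CInt_extend f A b a c Hc Hf Hb ltac:(lra) ltac:(lra)).
  assert (HY : Cmod (l - CInt f a c) <= eps).
  { rewrite Cmod_minus_sym. eapply Rle_trans; [apply Cmod_le_Re_Im|].
    unfold Cminus. rewrite re_plus, im_plus, re_opp, im_opp. unfold Rminus in B1, B2. lra. }
  match goal with |- Cmod ?x <= _ => replace x with ((l - CInt f a c) + (CInt f a c - CInt f (- b) b))%C by ring end.
  eapply Rle_trans; [apply Cmod_triangle|]. lra.
Qed.

(** * The main integrand and its first correction *)

Definition twist (t : R) (z : C) : C := Cexp (Ci * z / 2 * RtoC (ln (t / (2 * PI)))).

Lemma Cmod_twist (t u x : R) : Cmod (twist t (u, (- x)%R)) = exp (x / 2 * ln (t / (2 * PI))).
Proof.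
  unfold twist. rewrite Cmod_Cexp. f_equal. rewrite re_scal_r, Re_half. f_equal.
  unfold Ci, Cmult, Re; simpl. field.
Qed.

Lemma ln_t_2pi_bounds (t : R) : 8 <= t -> 0 <= ln (t / (2 * PI)) <= ln t.
Proof.
  intros Ht. assert (HP := PI2_3_2). assert (HP4 := PI_4).
  split.
  - rewrite <- ln_1. apply ln_le; [lra|]. apply Rmult_le_reg_r with (2 * PI); [lra|].
    unfold Rdiv. rewrite Rmult_assoc, Rinv_l by lra. lra.
  - apply ln_le; [apply Rdiv_lt_0_compat; lra|]. apply Rmult_le_reg_r with (2 * PI); [lra|].
    unfold Rdiv. rewrite Rmult_assoc, Rinv_l by lra. nra.
Qed.

Lemma twist_le (t u x : R) : 8 <= t -> 0 <= x <= 2 -> Cmod (twist t (u, (- x)%R)) <= t.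
Proof.
  intros Ht Hx. rewrite Cmod_twist. rewrite <- (exp_ln t) at 2 by lra. apply exp_le.
  assert (H := ln_t_2pi_bounds t Ht). nra.
Qed.

Lemma twist_le_sqrt (t u x : R) : 8 <= t -> 0 <= x <= 1 -> Cmod (twist t (u, (- x)%R)) <= sqrt t.
Proof.
  intros Ht Hx. rewrite Cmod_twist, <- Rpower_sqrt by lra. apply exp_le.
  assert (H := ln_t_2pi_bounds t Ht). nra.
Qed.

Lemma Hol_twist (D : C -> Prop) (t : R) : Hol D (twist t).
Proof.
  unfold twist, Cdiv. apply Hol_exp. apply Hol_mult; [|apply Hol_const]. apply Hol_mult; [|apply Hol_const].
  apply Hol_mult; [apply Hol_const|apply Hol_id].
Qed.

Lemma zeta_near (t u x : R) : 8 <= t -> Rabs u <= t / 4 -> 0 <= x <= 2 ->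
  Cmod (zeta (zs t (u, (- x)%R))) <= 26 * sqrt t.
Proof.
  intros Ht Hu Hx. apply Rabs_le_between in Hu.
  eapply Rle_trans; [apply zeta_bound_strip; rewrite zs_pair; simpl; [lra|rewrite Rabs_pos_eq; lra]|].
  rewrite zs_pair. simpl Im. rewrite Rabs_pos_eq by lra.
  assert (Hs : 0 <= sqrt t) by apply sqrt_pos.
  assert (sqrt (t + u) <= 2 * sqrt t); [|lra].
  apply le_of_sq_le; [lra|]. rewrite sqrt_sqrt by lra.
  replace (2 * sqrt t * (2 * sqrt t)) with (4 * (sqrt t * sqrt t)) by ring. rewrite sqrt_sqrt by lra. lra.
Qed.

(** Ensures (1 + b)^2 <= t/16 for b = c log t, so that the expansion of theta holds up to the ends
    of the segment. With q = t^(1/4), 1 + c ln t <= (1 + 4c) q, whose square is A sqrt t; the choice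
    of T makes this at most t/16. *)
Lemma log_square_small (c : R) : 0 < c ->
  exists T, 256 <= T /\ forall t, T <= t -> (1 + c * ln t) ^ 2 <= t / 16 /\ 1 <= ln t.
Proof.
  intros Hc. set (A := (1 + 4 * c) ^ 2). assert (HA : 1 <= A) by (unfold A; nra).
  exists ((16 * A) ^ 2). split; [nra|]. intros t Ht.
  assert (Ht0 : 256 <= t) by nra.
  set (r := sqrt t). assert (Hrr : r * r = t) by (apply sqrt_sqrt; lra).
  assert (Hr0 : 0 <= r) by apply sqrt_pos.
  assert (Hr : 16 * A <= r) by (apply le_of_sq_le; nra).
  set (q := sqrt r). assert (Hqq : q * q = r) by (apply sqrt_sqrt; lra).
  assert (Hq0 : 0 <= q) by apply sqrt_pos.
  assert (Hq : 1 <= q) by (apply le_of_sq_le; lra).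
  assert (Hl : ln t = 4 * ln q).
  { rewrite <- Hrr, <- Hqq. rewrite !ln_mult by nra. ring. }
  assert (Hlq := ln_le_sub1 q ltac:(lra)).
  assert (Hl1 : 1 <= ln t).
  { rewrite <- (ln_exp 1). apply ln_le; [apply exp_pos|]. assert (H := exp_le_3). lra. }
  split; auto.
  assert (Hb : 0 <= 1 + c * ln t <= (1 + 4 * c) * q) by (split; nra).
  assert (H1 : (1 + c * ln t) ^ 2 <= ((1 + 4 * c) * q) ^ 2) by (apply pow_incr; auto).
  replace (((1 + 4 * c) * q) ^ 2) with (A * (q * q)) in H1 by (unfold A; ring).
  rewrite Hqq in H1. assert (0 <= (r - 16 * A) * r) by (apply Rmult_le_pos; lra). lra.
Qed.

Lemma sqrt_le_self (t : R) : 1 <= t -> sqrt t <= t.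
Proof. intros H. apply le_of_sq_le; [lra|]. rewrite sqrt_sqrt by lra. nra. Qed.

Lemma exp_half_shift (u : R) : exp ((1 + u) / 2) <= 2 * exp (u / 2).
Proof.
  replace ((1 + u) / 2) with (/ 2 + u / 2) by field. rewrite exp_plus.
  apply Rmult_le_compat_r; [left; apply exp_pos|].
  assert (H : exp (/ 2) * exp (/ 2) <= 3) by (rewrite <- exp_plus; replace (/ 2 + / 2) with 1 by field; apply exp_le_3).
  assert (H0 := exp_pos (/ 2)). nra.
Qed.

(** The kernel supplies 8 e^(-3b/2) on the vertical edges: e^(-b) <= t^(-4) outweighs the power of t
    and zeta, which together are at most 26 t^2, and e^(-b/2) absorbs the |z|^2 of the
    correction. *)
Lemma edge_bound (t b u x : R) : 256 <= t -> 1 <= b <= t / 4 -> Rabs u = b -> exp (- b) <= / t ^ 4 -> 0 <= x <= 2 ->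
  let z := (u, (- x)%R) : C in
  Cmod (twist t z * kap z * zeta (zs t z)) <= 20000 / t /\
  Cmod (twist t z * (z * z * kap z) * zeta (zs t z)) <= 20000 / t.
Proof.
  intros Ht Hb Hu He Hx z.
  assert (H1 := twist_le t u x ltac:(lra) Hx). fold z in H1.
  assert (H2 := kap_bound_far u (- x) ltac:(lra)). fold z in H2. rewrite Hu in H2.
  assert (H3 := zeta_near t u x ltac:(lra) ltac:(lra) Hx). fold z in H3.
  assert (H4 := sqrt_le_self t ltac:(lra)).
  assert (Hz : Cmod z <= b + 2).
  { eapply Rle_trans; [apply Cmod_le_Re_Im|]. unfold z; simpl. rewrite Hu, Rabs_Ropp, (Rabs_pos_eq x); lra. }
  assert (P1 := Cmod_ge_0 (twist t z)). assert (P2 := Cmod_ge_0 (kap z)).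
  assert (P3 := Cmod_ge_0 (zeta (zs t z))). assert (P4 := Cmod_ge_0 z).
  set (E := exp (- (3 / 2 * b))) in *. assert (HE : 0 < E) by apply exp_pos.
  assert (Hbase : Cmod (twist t z * kap z * zeta (zs t z)) <= 208 * t ^ 2 * E).
  { rewrite !Cmod_mult. replace (208 * t ^ 2 * E) with (t * (8 * E) * (26 * t)) by ring.
    apply Rmult_le_compat; auto; [nra| |lra]. apply Rmult_le_compat; auto. }
  assert (Hpoly : (b + 2) ^ 2 * E <= 96 * exp (- b)).
  { assert (Hq := pow_le_exp 1 ((b + 2) / 2) ltac:(lra)). simpl INR in Hq.
    assert (He2 : exp ((b + 2) / 2) <= 6 * exp (b / 2)).
    { replace ((b + 2) / 2) with (1 + b / 2) by field. rewrite exp_plus. assert (H := exp_le_3).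
      assert (H0 := exp_pos (b / 2)). nra. }
    assert (Eq : E = exp (- (b / 2)) * exp (- b)).
    { unfold E. rewrite <- exp_plus. f_equal. field. }
    assert (Ei : exp (b / 2) * exp (- (b / 2)) = 1) by (rewrite <- exp_plus, Rplus_opp_r; apply exp_0).
    assert (Hb2 : (b + 2) ^ 2 <= 96 * exp (b / 2)) by (simpl in *; nra).
    rewrite Eq. assert (H0 := exp_pos (- (b / 2))). assert (H5 := exp_pos (- b)).
    apply Rle_trans with (96 * exp (b / 2) * (exp (- (b / 2)) * exp (- b))).
    - apply Rmult_le_compat_r; [nra|auto].
    - replace (96 * exp (b / 2) * (exp (- (b / 2)) * exp (- b)))
        with (96 * exp (- b) * (exp (b / 2) * exp (- (b / 2)))) by ring. rewrite Ei. lra. }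
  assert (Hfin : 208 * t ^ 2 * (96 * exp (- b)) <= 20000 / t).
  { apply Rle_trans with (208 * t ^ 2 * (96 * / t ^ 4)).
    - apply Rmult_le_compat_l; [nra|lra].
    - replace (208 * t ^ 2 * (96 * / t ^ 4)) with (19968 / t * / t) by (field; lra).
      assert (Hi : / t <= 1) by (rewrite <- Rinv_1; apply Rinv_le_contravar; lra).
      assert (0 < / t) by (apply Rinv_0_lt_compat; lra). unfold Rdiv. nra. }
  assert (Hbig : 208 * t ^ 2 * ((b + 2) ^ 2 * E) <= 20000 / t).
  { eapply Rle_trans; [|exact Hfin]. apply Rmult_le_compat_l; [nra|auto]. }
  split.
  - eapply Rle_trans; [exact Hbase|]. eapply Rle_trans; [|exact Hbig].
    apply Rmult_le_compat_l; [nra|]. assert (1 <= (b + 2) ^ 2) by nra. nra.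
  - replace (twist t z * (z * z * kap z) * zeta (zs t z))%C with (z * z * (twist t z * kap z * zeta (zs t z)))%C by ring.
    rewrite Cmod_mult. eapply Rle_trans; [|exact Hbig].
    replace (208 * t ^ 2 * ((b + 2) ^ 2 * E)) with ((b + 2) ^ 2 * (208 * t ^ 2 * E)) by ring.
    apply Rmult_le_compat; [apply Cmod_ge_0|apply Cmod_ge_0| |auto].
    rewrite Cmod_mult. nra.
Qed.

Lemma sin_half_pi_ge (x : R) : 0 <= x <= 2 -> Rmin x (2 - x) <= sin (PI * x / 2).
Proof.
  intros Hx. assert (HP := PI_RGT_0). destruct (Rle_dec x 1) as [H|H].
  - rewrite Rmin_left by lra. eapply Rle_trans; [|apply sin_ge_linear; nra]. right; field; lra.
  - rewrite Rmin_right by lra. rewrite <- sin_PI_x.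
    eapply Rle_trans; [|apply sin_ge_linear; nra]. right; field; lra.
Qed.

(** Lies between the poles 0 and -2i of the kernel and to the right of x = -t - i/2, where zeta has
    its pole. *)
Definition strip (t : R) (z : C) : Prop := - t < Re z /\ 0 < - Im z < 2.

Lemma Hol_kap_strip (t : R) : Hol (strip t) kap.
Proof.
  apply Hol_kap. intros u y [_ Hy]. simpl in Hy.
  assert (H := sin_half_pi_ge (- y) ltac:(lra)).
  assert (Hm : 0 < Rmin (- y) (2 - - y)) by (apply Rmin_glb_lt; lra).
  replace (PI * - y / 2) with (- (PI * y / 2)) in H by field. rewrite sin_neg in H.
  assert (H0 := pow2_ge_0 (sinh (PI * u / 2))). nra.
Qed.

Lemma shift_main (t b e1 e2 : R) : 256 <= t -> 1 <= b <= t / 4 -> exp (- b) <= / t ^ 4 -> 0 < e1 <= e2 -> e2 < 2 ->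
  Cmod (CInt (fun u => twist t (u, (- e2)%R) * kap (u, (- e2)%R) * zeta (zs t (u, (- e2)%R)))%C (- b) b
      - CInt (fun u => twist t (u, (- e1)%R) * kap (u, (- e1)%R) * zeta (zs t (u, (- e1)%R)))%C (- b) b) <= 80000 / t.
Proof.
  intros Ht Hb He H1 H2.
  set (m := Rmin e1 (2 - e2)). assert (Hm : 0 < m) by (apply Rmin_glb_lt; lra).
  assert (Hm1 : m <= e1) by apply Rmin_l. assert (Hm2 : m <= 2 - e2) by apply Rmin_r.
  eapply Rle_trans; [apply (zeta_contour_shift (strip t) (fun z => twist t z * kap z)%C t b m e1 e2 (20000 / t) (t * (4 / m)))|].
  - apply Hol_mult; [apply Hol_twist|apply Hol_kap_strip].
  - lra.
  - auto.
  - lra.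
  - intros u x Hu Hx. split; simpl; lra.
  - intros z [Hz _]. exact Hz.
  - intros u x Hu Hx. rewrite Cmod_mult. apply Rmult_le_compat; try apply Cmod_ge_0.
    + apply twist_le; lra.
    + eapply Rle_trans; [apply kap_bound_line; lra|].
      assert (Hs := sin_half_pi_ge x ltac:(lra)).
      assert (Hmx : m <= sin (PI * x / 2)).
      { eapply Rle_trans; [|exact Hs]. apply Rmin_glb; lra. }
      assert (Hi : / sin (PI * x / 2) <= / m) by (apply Rinv_le_contravar; lra).
      assert (Hi0 : 0 < / sin (PI * x / 2)) by (apply Rinv_0_lt_compat; lra).
      assert (He1 : exp (- (3 / 2 * Rabs u)) <= 1).
      { rewrite <- exp_0. apply exp_le. assert (H := Rabs_pos u). lra. }
      assert (He0 := exp_pos (- (3 / 2 * Rabs u))). unfold Rdiv. nra.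
  - intros x Hx. split.
    + apply (edge_bound t b b x); auto; try lra. rewrite Rabs_pos_eq; lra.
    + apply (edge_bound t b (- b) x); auto; try lra. rewrite Rabs_Ropp, Rabs_pos_eq; lra.
  - assert (0 < 20000 / t) by (apply Rdiv_lt_0_compat; lra).
    replace (80000 / t) with (2 * (20000 / t) * 2) by (field; lra). apply Rmult_le_compat_l; lra.
Qed.

(** The correction to the main integrand, without its constant i/(4t); z^2 is grouped with the
    kernel whose pole it cancels. *)
Definition corr (t : R) (z : C) : C := (twist t z * (z * z * kap z) * zeta (zs t z))%C.

Lemma ccont_corr (t u x : R) : - t < u -> 0 <= x < 1 -> ccont (corr t) (u, (- x)%R).
Proof.
  intros Hu Hx. unfold corr. apply ccont_mult; [apply ccont_mult|].
  - apply (Hol_ccont (fun _ => True)); [apply Hol_twist|auto].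
  - apply ccont_sq_kap. rewrite Rabs_Ropp, Rabs_pos_eq; lra.
  - apply ccont_zeta; lra.
Qed.

Lemma shift_corr (t b : R) : 256 <= t -> 1 <= b <= t / 4 -> exp (- b) <= / t ^ 4 ->
  Cmod (CInt (fun u => corr t (u, (- / 4)%R)) (- b) b - CInt (fun u => corr t (u, 0)) (- b) b) <= 10000 / t.
Proof.
  intros Ht Hb He. apply le_epsilon. intros eps Heps.
  destruct (CInt_line_limit (corr t) b ltac:(lra)) with (eps := eps) as [d [Hd Hlim]]; auto.
  { intros u Hu. replace 0 with (- 0) by ring. apply ccont_corr; lra. }
  set (e := Rmin (d / 2) (/ 8)).
  assert (He0 : 0 < e) by (apply Rmin_glb_lt; lra).
  assert (He1 : e <= d / 2) by apply Rmin_l. assert (He2 : e <= / 8) by apply Rmin_r.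
  assert (H1 := Hlim e ltac:(lra) ltac:(intros; apply ccont_corr; lra)).
  assert (H2 : Cmod (CInt (fun u => corr t (u, (- / 4)%R)) (- b) b - CInt (fun u => corr t (u, (- e)%R)) (- b) b)
     <= 2 * (20000 / t) * (/ 4 - e)).
  { apply (zeta_contour_shift (strip t) (fun z => twist t z * (z * z * kap z))%C t b e e (/ 4) (20000 / t) (t * (2 * (b + 1))));
      [|lra|auto|lra| | | |].
    - apply Hol_mult; [apply Hol_twist|]. apply Hol_mult; [apply Hol_mult; apply Hol_id|apply Hol_kap_strip].
    - intros u x Hu Hx. split; simpl; lra.
    - intros z [Hz _]. exact Hz.
    - intros u x Hu Hx. rewrite Cmod_mult. apply Rmult_le_compat; try apply Cmod_ge_0.
      + apply twist_le; lra.
      + eapply Rle_trans; [apply sq_kap_bound_near; simpl; rewrite Rabs_Ropp, Rabs_pos_eq; lra|].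
        apply Rmult_le_compat_l; [lra|]. eapply Rle_trans; [apply Cmod_le_Re_Im|]. simpl.
        rewrite Rabs_Ropp, (Rabs_pos_eq x) by lra. assert (Rabs u <= b) by (apply Rabs_le; lra). lra.
    - intros x Hx. split.
      + apply (edge_bound t b b x); auto; try lra. rewrite Rabs_pos_eq; lra.
      + apply (edge_bound t b (- b) x); auto; try lra. rewrite Rabs_Ropp, Rabs_pos_eq; lra. }
  assert (H3 : 2 * (20000 / t) * (/ 4 - e) <= 10000 / t).
  { assert (0 < 20000 / t) by (apply Rdiv_lt_0_compat; lra).
    replace (10000 / t) with (2 * (20000 / t) * / 4) by (field; lra). apply Rmult_le_compat_l; lra. }
  match goal with |- Cmod (?a - ?c)%C <= _ => match type of H1 with Cmod (?d1 - _)%C <= _ =>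
    replace (a - c)%C with ((a - d1) + (d1 - c))%C by ring end end.
  eapply Rle_trans; [apply Cmod_triangle|]. lra.
Qed.

Lemma sq_kap_bound_line0 (u : R) : Cmod ((u, 0) * (u, 0) * kap (u, 0))%C <= 128 * exp (- Rabs u).
Proof.
  assert (Hu := Rabs_pos u). assert (Hm : Cmod (u, 0) <= Rabs u).
  { eapply Rle_trans; [apply Cmod_le_Re_Im|]. simpl. rewrite Rabs_R0; lra. }
  assert (He := exp_pos (- Rabs u)).
  destruct (Rle_dec 1 (Rabs u)) as [H|H].
  - rewrite !Cmod_mult. assert (Hk := kap_bound_far u 0 H).
    assert (Hq := pow_le_exp 1 (Rabs u / 2) ltac:(lra)). simpl INR in Hq.
    assert (E : exp (- (3 / 2 * Rabs u)) = exp (- (Rabs u / 2)) * exp (- Rabs u)).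
    { rewrite <- exp_plus. f_equal. field. }
    assert (Ei : exp (Rabs u / 2) * exp (- (Rabs u / 2)) = 1) by (rewrite <- exp_plus, Rplus_opp_r; apply exp_0).
    assert (H0 := exp_pos (- (Rabs u / 2))). assert (P := Cmod_ge_0 (u, 0)).
    assert (Hsq : Cmod (u, 0) * Cmod (u, 0) <= 16 * exp (Rabs u / 2)).
    { assert (Cmod (u, 0) * Cmod (u, 0) <= Rabs u * Rabs u) by nra. simpl in Hq. nra. }
    apply Rle_trans with (16 * exp (Rabs u / 2) * (8 * (exp (- (Rabs u / 2)) * exp (- Rabs u)))).
    + rewrite <- E. apply Rmult_le_compat; auto; [nra|apply Cmod_ge_0].
    + replace (16 * exp (Rabs u / 2) * (8 * (exp (- (Rabs u / 2)) * exp (- Rabs u))))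
        with (128 * exp (- Rabs u) * (exp (Rabs u / 2) * exp (- (Rabs u / 2)))) by ring. rewrite Ei. lra.
  - eapply Rle_trans; [apply sq_kap_bound_near; simpl; rewrite Rabs_R0; lra|].
    assert (H3 : / 3 <= exp (- Rabs u)).
    { apply Rle_trans with (exp (- (1))); [|apply exp_le; lra]. rewrite exp_Ropp.
      apply Rinv_le_contravar; [apply exp_pos|apply exp_le_3]. }
    lra.
Qed.

(** On the real axis the power of t has modulus 1 and s lies on the critical line at heights between
    t/2 and 2t. Through this estimate alone the critical-line bound enters the error term. *)
Lemma corr_line0_bound (t b K a : R) : 256 <= t -> 1 <= b <= t / 4 -> 0 <= K -> 0 <= a ->
  (forall v, t / 2 <= v -> Cmod (zeta (RtoC (/ 2) + Ci * RtoC v)) <= K * Rpower v a) ->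
  Cmod (CInt (fun u => corr t (u, 0)) (- b) b) <= 256 * (K * Rpower (2 * t) a).
Proof.
  intros Ht Hb HK Ha Hz.
  replace (256 * (K * Rpower (2 * t) a)) with (2 * (128 * (K * Rpower (2 * t) a))) by ring.
  apply CInt_exp_bound; [lra| |].
  - intros u Hu. apply (ccont_line (corr t)). replace 0 with (- 0) by ring. apply ccont_corr; lra.
  - intros u Hu. unfold corr. rewrite Cmod_mult, (Cmod_mult (twist _ _)).
    assert (H1 : Cmod (twist t (u, 0)) = 1).
    { replace 0 with (- 0) by ring. rewrite Cmod_twist. replace (0 / 2) with 0 by field. rewrite Rmult_0_l. apply exp_0. }
    rewrite H1, Rmult_1_l. assert (H2 := sq_kap_bound_line0 u).
    assert (H3 : Cmod (zeta (zs t (u, 0))) <= K * Rpower (2 * t) a).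
    { replace (zs t (u, 0)) with (RtoC (/ 2) + Ci * RtoC (t + u))%C.
      2:{ rewrite zs_pair. unfold Ci, RtoC, Cmult, Cplus; simpl. f_equal; ring. }
      eapply Rle_trans; [apply Hz; lra|]. apply Rmult_le_compat_l; auto.
      unfold Rpower. apply exp_le. apply Rmult_le_compat_l; auto. apply ln_le; lra. }
    replace (128 * (K * Rpower (2 * t) a) * exp (- Rabs u)) with (128 * exp (- Rabs u) * (K * Rpower (2 * t) a)) by ring.
    apply Rmult_le_compat; auto; apply Cmod_ge_0.
Qed.

(** * The asymptotic formula *)

Definition theta_factor (t : R) (x : C) : C := Cexp (Ci * theta (RtoC t + x) - Ci * theta (RtoC t)).

Definition U_integrand (t u : R) : C :=
  let x : C := (u, (- / 4)%R) in (theta_factor t x * zeta (zs t x) * kap x)%C.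

Lemma RtoC_plus_pair (t u y : R) : (RtoC t + (u, y))%C = (t + u, y).
Proof. unfold RtoC, Cplus; simpl. f_equal; ring. Qed.

Lemma Cmod_theta_factor (t : R) (x : C) :
  Cmod (theta_factor t x) = Cmod (Cexp (Ci * theta (RtoC t + x))).
Proof.
  unfold theta_factor, Cminus. rewrite Cexp_plus, Cexp_opp, Cmod_mult, Cmod_inv by apply Cexp_neq_0.
  rewrite Cexp_theta_real. field.
Qed.

Lemma kap_bound_quarter (u : R) : Cmod (kap (u, (- / 4)%R)) <= 16 * exp (- (3 / 2 * Rabs u)).
Proof.
  eapply Rle_trans; [apply kap_bound_line; lra|].
  apply Rmult_le_compat_r; [left; apply exp_pos|].
  assert (H := sin_half_pi_ge (/ 4) ltac:(lra)). rewrite Rmin_left in H by lra.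
  assert (Hi : / sin (PI * / 4 / 2) <= / / 4) by (apply Rinv_le_contravar; lra).
  rewrite Rinv_inv in Hi. unfold Rdiv in *. lra.
Qed.

Lemma exp_three_halves (u : R) : exp (- (3 / 2 * u)) = exp (- (u / 2)) * exp (- u).
Proof. rewrite <- exp_plus. f_equal. field. Qed.

(** The surplus decay exp(-u/2) absorbs the polynomial, by [pow_le_exp] at (1 + u)/2. *)
Lemma poly_exp_absorb (n : nat) (u : R) : 0 <= u ->
  (1 + u) ^ S n * exp (- (3 / 2 * u)) <= 2 * (2 * INR (S n)) ^ S n * exp (- u).
Proof.
  intros Hu. assert (Hq := pow_le_exp n ((1 + u) / 2) ltac:(lra)).
  assert (Hh := exp_half_shift u).
  assert (Ei : exp (u / 2) * exp (- (u / 2)) = 1) by (rewrite <- exp_plus, Rplus_opp_r; apply exp_0).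
  assert (H2 : 0 < 2 ^ S n) by (apply pow_lt; lra).
  assert (Hk : 0 <= INR (S n) ^ S n) by (apply pow_le, pos_INR).
  assert (E1 : (1 + u) ^ S n = 2 ^ S n * ((1 + u) / 2) ^ S n).
  { rewrite <- Rpow_mult_distr. f_equal. field. }
  rewrite E1, Rpow_mult_distr, exp_three_halves.
  assert (H0 := exp_pos (- (u / 2))). assert (H1 := exp_pos (- u)).
  apply Rle_trans with (2 ^ S n * (INR (S n) ^ S n * (2 * exp (u / 2))) * (exp (- (u / 2)) * exp (- u))).
  - apply Rmult_le_compat_r; [nra|]. apply Rmult_le_compat_l; [lra|].
    eapply Rle_trans; [exact Hq|]. apply Rmult_le_compat_l; auto.
  - right. transitivity (2 * (2 ^ S n * INR (S n) ^ S n) * exp (- u) * (exp (u / 2) * exp (- (u / 2)))); [ring|].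
    rewrite Ei. ring.
Qed.

(** A bound on the whole line, for the tails: theta contributes (1 + |t+u|)^2 and zeta at Re s = 3/4
    one more power, hence t^3. *)
Lemma U_integrand_bound (t u : R) : 1 <= t ->
  Cmod (U_integrand t u) <= 8640000 * t ^ 3 * exp (- Rabs u).
Proof.
  intros Ht. assert (Hu := Rabs_pos u). unfold U_integrand. rewrite !Cmod_mult.
  rewrite Cmod_theta_factor, RtoC_plus_pair, zs_pair.
  replace (/ 2 - - / 4) with (3 / 4) by field.
  assert (H1 := Cexp_theta_growth (t + u)). assert (H2 := zeta_bound_three_quarters (t + u)).
  assert (H3 := kap_bound_quarter u).
  set (V := 1 + Rabs (t + u)) in *.
  assert (HV : 1 <= V <= 2 * t * (1 + Rabs u)).
  { unfold V. assert (H0 := Rabs_pos (t + u)). assert (T := Rabs_triang t u). rewrite (Rabs_pos_eq t) in T by lra.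
    split; [lra|]. nra. }
  assert (HV3 : V ^ 3 <= (2 * t * (1 + Rabs u)) ^ 3) by (apply pow_incr; lra).
  assert (Hp := poly_exp_absorb 2 (Rabs u) Hu). simpl INR in Hp.
  set (E := exp (- (3 / 2 * Rabs u))) in *. assert (HE : 0 < E) by apply exp_pos.
  apply Rle_trans with (12 * V ^ 2 * (13 * V) * (16 * E)).
  - apply Rmult_le_compat; auto; [apply Rmult_le_pos; apply Cmod_ge_0|apply Cmod_ge_0|].
    apply Rmult_le_compat; auto; apply Cmod_ge_0.
  - apply Rle_trans with (2496 * (2 * t * (1 + Rabs u)) ^ 3 * E).
    + replace (12 * V ^ 2 * (13 * V) * (16 * E)) with (2496 * V ^ 3 * E) by ring.
      apply Rmult_le_compat_r; lra.
    + replace (2496 * (2 * t * (1 + Rabs u)) ^ 3 * E) with (19968 * t ^ 3 * ((1 + Rabs u) ^ 3 * E)) by ring.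
      assert (Ht3 : 0 < t ^ 3) by (apply pow_lt; lra).
      replace (8640000 * t ^ 3 * exp (- Rabs u)) with (t ^ 3 * (8640000 * exp (- Rabs u))) by ring.
      replace (19968 * t ^ 3 * ((1 + Rabs u) ^ 3 * E)) with (t ^ 3 * (19968 * ((1 + Rabs u) ^ 3 * E))) by ring.
      apply Rmult_le_compat_l; [lra|]. assert (H0 := exp_pos (- Rabs u)). lra.
Qed.

Lemma ccont_U_integrand (t u : R) : ccont (U_integrand t) u.
Proof.
  unfold U_integrand. apply ccont_mult; [apply ccont_mult|].
  - apply (ccont_ext (fun r => Cexp (Ci * theta ((t + r)%R, (- / 4)%R)) * Cexp (- (Ci * theta (RtoC t))))%C).
    + intros r. rewrite <- Cexp_plus. unfold theta_factor. rewrite RtoC_plus_pair. reflexivity.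
    + apply ccont_mult; [|apply ccont_const].
      assert (Hc : continuous (fun r : R => t + r) u).
      { apply (continuous_plus (fun _ : R => t) (fun r : R => r)); [apply continuous_const|apply continuous_id]. }
      destruct (ccont_Cexp_theta (t + u)) as [H1 H2]. split.
      * apply (continuous_comp (fun r : R => t + r) (fun v => Re (Cexp (Ci * theta (v, (- / 4)%R))))); auto.
      * apply (continuous_comp (fun r : R => t + r) (fun v => Im (Cexp (Ci * theta (v, (- / 4)%R))))); auto.
  - apply ccont_zeta_line.
  - apply (ccont_line kap). apply (Hol_ccont (strip (1 + Rabs u))); [apply Hol_kap_strip|].
    split; simpl; [|lra]. assert (H := Rabs_def2 u (1 + Rabs u) ltac:(lra)). lra.
Qed.

(** [rho] is the exponent left after division by the power of t. It is i x^2/(4t) + O(X^3/t^2), and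
    at most 3/4 in modulus because X^2 <= t/16; hence e^rho = 1 + rho + O(X^4/t^2). *)
Lemma theta_factor_expansion (t u : R) : 256 <= t -> (1 + Rabs u) ^ 2 <= t / 16 ->
  let x := (u, (- / 4)%R) : C in
  Cmod (theta_factor t x - twist t x * (1 + Ci / (4 * RtoC t) * (x * x)))
    <= sqrt t * (603 * (1 + Rabs u) ^ 4 / t ^ 2).
Proof.
  intros Ht HX x. assert (Hu := Rabs_pos u). set (X := 1 + Rabs u) in *.
  assert (HX1 : 1 <= X) by (unfold X; lra).
  assert (HXt : X <= t / 16) by nra.
  assert (Htc : RtoC t <> 0%C) by (apply RtoC_neq_0; lra).
  assert (Hx : Cmod x <= X).
  { eapply Rle_trans; [apply Cmod_le_Re_Im|]. unfold x, X; simpl. rewrite Rabs_Ropp, (Rabs_pos_eq (/ 4)); lra. }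
  assert (Hx0 := Cmod_ge_0 x).
  set (rho := (Ci * theta (RtoC t + x) - Ci * theta (RtoC t) - Ci * x / 2 * RtoC (ln (t / (2 * PI))))%C).
  set (c := (Ci / (4 * RtoC t) * (x * x))%C).
  assert (Hd : Cmod (rho - c) <= 171 * X ^ 3 / t ^ 2).
  { assert (H := theta_diff t x ltac:(lra) ltac:(unfold x; simpl; rewrite Rabs_Ropp, Rabs_pos_eq; lra) ltac:(lra)).
    match type of H with Cmod ?w <= _ => replace w with (rho - c)%C in H end.
    2:{ unfold rho, c. field. auto. }
    eapply Rle_trans; [exact H|]. apply Rmult_le_compat_r; [left; apply Rinv_0_lt_compat, pow_lt; lra|].
    assert (Cmod x ^ 2 <= X ^ 2) by (apply pow_incr; lra). assert (Cmod x ^ 3 <= X ^ 3) by (apply pow_incr; lra).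
    assert (X <= X ^ 3) by (simpl; nra). assert (X ^ 2 <= X ^ 3) by (simpl; nra). lra. }
  assert (Hc : Cmod c <= X ^ 2 / (4 * t)).
  { unfold c, Cdiv. rewrite !Cmod_mult, Cmod_Ci, Cmod_inv, Cmod_mult, !Cmod_R, !Rabs_pos_eq; try lra.
    2:{ apply Cmult_neq_0; [apply RtoC_neq_0; lra|auto]. }
    replace (1 * / (4 * t) * (Cmod x * Cmod x)) with (Cmod x * Cmod x * / (4 * t)) by ring.
    apply Rmult_le_compat_r; [left; apply Rinv_0_lt_compat; lra|]. nra. }
  assert (Hit : 0 < / t) by (apply Rinv_0_lt_compat; lra).
  assert (Hd2 : 171 * X ^ 3 / t ^ 2 <= 11 * (X ^ 2 / t)).
  { replace (171 * X ^ 3 / t ^ 2) with (171 * (X / t) * (X ^ 2 / t)) by (field; lra).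
    apply Rmult_le_compat_r; [unfold Rdiv; nra|].
    assert (X / t <= / 16); [|lra].
    apply Rmult_le_reg_r with t; [lra|]. unfold Rdiv. rewrite Rmult_assoc, Rinv_l; lra. }
  assert (Hrho : Cmod rho <= 12 * (X ^ 2 / t)).
  { replace rho with ((rho - c) + c)%C by ring. eapply Rle_trans; [apply Cmod_triangle|].
    replace (X ^ 2 / (4 * t)) with (/ 4 * (X ^ 2 / t)) in Hc by (field; lra).
    assert (0 <= X ^ 2 / t) by (unfold Rdiv; nra). lra. }
  assert (Hsmall : X ^ 2 / t <= / 16).
  { apply Rmult_le_reg_r with t; [lra|]. unfold Rdiv. rewrite Rmult_assoc, Rinv_l by lra. lra. }
  assert (Hrho0 := Cmod_ge_0 rho).
  assert (Htay : Cmod (Cexp rho - 1 - rho) <= 432 * (X ^ 4 / t ^ 2)).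
  { eapply Rle_trans; [apply Cexp_taylor1|].
    assert (He : exp (Cmod rho) <= 3) by (apply Rle_trans with (exp 1); [apply exp_le; lra|apply exp_le_3]).
    assert (Hsq : Cmod rho ^ 2 <= (12 * (X ^ 2 / t)) ^ 2) by (apply pow_incr; lra).
    replace (432 * (X ^ 4 / t ^ 2)) with ((12 * (X ^ 2 / t)) ^ 2 * 3) by (field; lra).
    apply Rmult_le_compat; auto; [nra|left; apply exp_pos]. }
  assert (E : theta_factor t x = (twist t x * Cexp rho)%C).
  { unfold theta_factor, twist. rewrite <- Cexp_plus. f_equal. unfold rho. ring. }
  rewrite E. replace (twist t x * Cexp rho - twist t x * (1 + c))%C
    with (twist t x * ((Cexp rho - 1 - rho) + (rho - c)))%C by ring.
  rewrite Cmod_mult. apply Rmult_le_compat; try apply Cmod_ge_0.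
  - apply (twist_le_sqrt t u (/ 4)); lra.
  - eapply Rle_trans; [apply Cmod_triangle|].
    assert (H3 : 171 * X ^ 3 / t ^ 2 <= 171 * (X ^ 4 / t ^ 2)).
    { unfold Rdiv. rewrite Rmult_assoc. apply Rmult_le_compat_l; [lra|].
      apply Rmult_le_compat_r; [left; apply Rinv_0_lt_compat, pow_lt; lra|].
      assert (0 <= X ^ 3) by (apply pow_le; lra). simpl in *. nra. }
    replace (603 * X ^ 4 / t ^ 2) with (603 * (X ^ 4 / t ^ 2)) by (field; lra). lra.
Qed.

(** The relative remainder t^(-2) meets sqrt t from the power and sqrt t from zeta, which makes 1/t;
    the kernel absorbs (1 + |u|)^4. *)
Lemma U_integrand_expansion (t b : R) : 256 <= t -> 1 <= b <= t / 4 -> (1 + b) ^ 2 <= t / 16 ->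
  Cmod (CInt (U_integrand t) (- b) b
    - (CInt (fun u => twist t (u, (- / 4)%R) * kap (u, (- / 4)%R) * zeta (zs t (u, (- / 4)%R)))%C (- b) b
       + Ci / (4 * RtoC t) * CInt (fun u => corr t (u, (- / 4)%R)) (- b) b)%C) <= 4200000000 / t.
Proof.
  intros Ht Hb Hb2.
  set (g := fun u => (twist t (u, (- / 4)%R) * kap (u, (- / 4)%R) * zeta (zs t (u, (- / 4)%R)))%C).
  set (h := fun u => corr t (u, (- / 4)%R)).
  assert (Hg : forall u, - b <= u <= b -> ccont g u).
  { intros u Hu. unfold g. apply (ccont_line (fun z => twist t z * kap z * zeta (zs t z))%C).
    apply ccont_mult; [|apply ccont_zeta; lra].
    apply (Hol_ccont (strip t)); [apply Hol_mult; [apply Hol_twist|apply Hol_kap_strip]|]. split; simpl; lra. }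
  assert (Hh : forall u, - b <= u <= b -> ccont h u).
  { intros u Hu. apply (ccont_line (corr t)). apply ccont_corr; lra. }
  set (k := (Ci / (4 * RtoC t))%C).
  assert (Hkh : forall u, - b <= u <= b -> ccont (fun u => k * h u)%C u)
    by (intros; apply ccont_mult; [apply ccont_const|auto]).
  assert (HU : forall u, - b <= u <= b -> ccont (U_integrand t) u) by (intros; apply ccont_U_integrand).
  rewrite <- (CInt_scal k) by (auto; lra).
  match goal with |- Cmod (?A - (?B + ?D))%C <= _ => replace (A - (B + D))%C with (A - B - D)%C by ring end.
  rewrite <- CInt_minus by (auto; lra).
  rewrite <- CInt_minus; [|lra|intros; apply ccont_minus; auto|auto].
  replace (4200000000 / t) with (2 * (2100000000 / t)) by (field; lra).
  apply CInt_exp_bound; [lra|intros; apply ccont_minus; [apply ccont_minus|]; auto|].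
  intros u Hu. assert (Hub : Rabs u <= b) by (apply Rabs_le; lra). assert (Hu0 := Rabs_pos u).
  set (x := (u, (- / 4)%R) : C).
  assert (E : (U_integrand t u - g u - k * h u)%C
    = ((theta_factor t x - twist t x * (1 + k * (x * x))) * zeta (zs t x) * kap x)%C).
  { unfold U_integrand, g, h, corr. fold x. ring. }
  rewrite E, !Cmod_mult.
  assert (H1 := theta_factor_expansion t u Ht ltac:(nra)). cbv zeta in H1. fold x k in H1.
  assert (H2 := zeta_near t u (/ 4) ltac:(lra) ltac:(lra) ltac:(lra)). fold x in H2.
  assert (H3 := kap_bound_quarter u). fold x in H3.
  assert (Hp := poly_exp_absorb 3 (Rabs u) Hu0). simpl INR in Hp.
  set (X := 1 + Rabs u) in *. set (Ex := exp (- (3 / 2 * Rabs u))) in *.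
  assert (Hss : sqrt t * sqrt t = t) by (apply sqrt_sqrt; lra).
  apply Rle_trans with (sqrt t * (603 * X ^ 4 / t ^ 2) * (26 * sqrt t) * (16 * Ex)).
  - apply Rmult_le_compat; auto; [apply Rmult_le_pos; apply Cmod_ge_0|apply Cmod_ge_0|].
    apply Rmult_le_compat; auto; apply Cmod_ge_0.
  - replace (sqrt t * (603 * X ^ 4 / t ^ 2) * (26 * sqrt t) * (16 * Ex))
      with ((sqrt t * sqrt t) * / t ^ 2 * (250848 * (X ^ 4 * Ex))) by (field; lra).
    rewrite Hss. replace (t * / t ^ 2) with (/ t) by (field; lra).
    replace (2100000000 / t * exp (- Rabs u)) with (/ t * (2100000000 * exp (- Rabs u))) by (field; lra).
    apply Rmult_le_compat_l; [left; apply Rinv_0_lt_compat; lra|].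
    assert (H0 := exp_pos (- Rabs u)). lra.
Qed.

(** Everything is O(1/t) except the correction on the real axis, which is 1/(4t) times a multiple of
    t^(kappa+eps). *)
Lemma approx_of_critical_line_bound (kappa eps sigma : R) : 0 <= kappa -> 0 < eps -> 0 < sigma < 2 ->
  critical_line_bound kappa -> approx_with_error sigma (-1 + kappa + eps).
Proof.
  (* C >= 4 gives e^(-b) <= t^(-4), which turns the tail t^3 e^(-b) into 1/t. *)
  intros Hka Heps Hsig Hcrit. exists 4. split; [lra|]. intros Cc HCc.
  destruct (Hcrit eps Heps) as [Kc [Tc [HTc Hz]]].
  destruct (log_square_small Cc ltac:(lra)) as [T0 [HT0 Hlog]].
  set (a := kappa + eps). set (Ka := Rabs Kc). assert (HKa : 0 <= Ka) by apply Rabs_pos.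
  (* 64 = 256/4 belongs to the correction, and the first number exceeds the sum of the other
     constants. From 2 Tc on, heights above t/2 are above Tc. *)
  exists (4300000000 + (64 * (Ka * Rpower 2 a))), (Rmax T0 (2 * Tc)).
  assert (HM1 := Rmax_l T0 (2 * Tc)). assert (HM2 := Rmax_r T0 (2 * Tc)).
  split; [lra|]. intros t HtT.
  assert (Ht : 256 <= t) by lra.
  destruct (Hlog t ltac:(lra)) as [Hsq Hln].
  set (b := Cc * ln t) in *.
  assert (Hb1 : 4 <= b) by (unfold b; nra).
  assert (Hb : 1 <= b <= t / 4) by (split; nra).
  assert (Heb : exp (- b) <= / t ^ 4).
  { rewrite exp_Ropp. apply Rinv_le_contravar; [apply pow_lt; lra|].
    rewrite <- Rpower_pow by lra. apply exp_le. simpl INR. unfold b. nra. }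
  set (I1 := @RInt_gen C_R_CompleteNormedModule (U_integrand t) (Rbar_locally m_infty) (Rbar_locally p_infty)).
  set (G := fun e => CInt (fun u => twist t (u, (- e)%R) * kap (u, (- e)%R) * zeta (zs t (u, (- e)%R)))%C (- b) b).
  set (w := (/ (2 * RtoC PI * Ci))%C).
  assert (EU : U t = (w * I1)%C) by reflexivity.
  assert (ES : segment_integral sigma b t = (w * G sigma)%C).
  { unfold segment_integral. fold w. f_equal.
    transitivity (CInt (fun u => twist t (u, (- sigma)%R) * zeta (zs t (u, (- sigma)%R)) * kap (u, (- sigma)%R))%C (- b) b).
    - apply (RInt_CInt (fun u => twist t (u, (- sigma)%R) * zeta (zs t (u, (- sigma)%R)) * kap (u, (- sigma)%R))%C); [lra|].
      intros u Hu. apply (ccont_line (fun z => twist t z * zeta (zs t z) * kap z)%C).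
      assert (Hst : strip t (u, (- sigma)%R)) by (split; simpl; lra).
      apply ccont_mult; [apply ccont_mult; [|apply ccont_zeta; lra]|].
      + apply (Hol_ccont (strip t)); auto. apply Hol_twist.
      + apply (Hol_ccont (strip t)); auto. apply Hol_kap_strip.
    - apply CInt_ext; [lra|]. intros; ring. }
  rewrite EU, ES. replace (w * I1 - w * G sigma)%C with (w * (I1 - G sigma))%C by ring.
  assert (Hw : Cmod w <= 1).
  { unfold w. assert (HP := PI2_1). rewrite <- Rinv_1. apply Cmod_inv_le; [lra|].
    rewrite !Cmod_mult, Cmod_Ci, !Cmod_R, !Rabs_pos_eq; lra. }
  assert (Hit : 0 < / t) by (apply Rinv_0_lt_compat; lra).
  assert (H1 : Cmod (I1 - CInt (U_integrand t) (- b) b) <= 17280000 / t).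
  { eapply Rle_trans; [apply (RInt_gen_tail _ (8640000 * t ^ 3) b)|].
    - intros; apply ccont_U_integrand.
    - intros; apply U_integrand_bound; lra.
    - lra.
    - assert (Ht3 : 0 < t ^ 3) by (apply pow_lt; lra).
      apply Rle_trans with (2 * (8640000 * t ^ 3 * / t ^ 4)).
      + apply Rmult_le_compat_l; [lra|]. apply Rmult_le_compat_l; lra.
      + right. field. lra. }
  assert (H2 := U_integrand_expansion t b Ht Hb Hsq).
  assert (H3 := shift_corr t b Ht Hb Heb).
  assert (H4 : Cmod (CInt (fun u => corr t (u, 0)) (- b) b) <= 256 * (Ka * Rpower (2 * t) a)).
  { apply corr_line0_bound; auto; [unfold a; lra|]. intros v Hv.
    eapply Rle_trans; [apply Hz; lra|]. fold a. apply Rmult_le_compat_r; [left; apply exp_pos|apply Rle_abs]. }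
  assert (H5 : Cmod (G (/ 4) - G sigma) <= 80000 / t).
  { destruct (Rle_dec sigma (/ 4)) as [Hs|Hs].
    - apply (shift_main t b sigma (/ 4)); auto; lra.
    - rewrite Cmod_minus_sym. apply (shift_main t b (/ 4) sigma); auto; lra. }
  change (CInt (fun u => twist t (u, (- / 4)%R) * kap (u, (- / 4)%R) * zeta (zs t (u, (- / 4)%R)))%C (- b) b)
    with (G (/ 4)) in H2.
  set (F := CInt (U_integrand t) (- b) b) in *.
  set (Q := CInt (fun u => corr t (u, (- / 4)%R)) (- b) b) in *.
  set (Q0 := CInt (fun u => corr t (u, 0)) (- b) b) in *.
  set (k := (Ci / (4 * RtoC t))%C) in *.
  assert (Hk : Cmod k = / 4 * / t).
  { unfold k, Cdiv. rewrite Cmod_mult, Cmod_Ci, Cmod_inv, Cmod_mult, !Cmod_R, !Rabs_pos_eq; try lra.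
    - field. lra.
    - apply Cmult_neq_0; apply RtoC_neq_0; lra. }
  assert (Htot : Cmod (I1 - G sigma) <= 17280000 / t + 4200000000 / t
     + / 4 * / t * (10000 / t + 256 * (Ka * Rpower (2 * t) a)) + 80000 / t).
  { replace (I1 - G sigma)%C with
      ((I1 - F) + (F - (G (/ 4)%R + k * Q)) + k * ((Q - Q0) + Q0) + (G (/ 4)%R - G sigma))%C by ring.
    eapply Rle_trans; [apply Cmod_triangle|]. apply Rplus_le_compat; [|exact H5].
    eapply Rle_trans; [apply Cmod_triangle|]. apply Rplus_le_compat.
    - eapply Rle_trans; [apply Cmod_triangle|]. apply Rplus_le_compat; auto.
    - rewrite Cmod_mult, Hk. apply Rmult_le_compat_l; [nra|].
      eapply Rle_trans; [apply Cmod_triangle|]. apply Rplus_le_compat; auto. }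
  rewrite Cmod_mult.
  apply Rle_trans with (1 * Cmod (I1 - G sigma)); [apply Rmult_le_compat_r; [apply Cmod_ge_0|auto]|].
  rewrite Rmult_1_l. eapply Rle_trans; [exact Htot|].
  assert (Ha : 0 <= a) by (unfold a; lra).
  assert (E2 : Rpower (2 * t) a = Rpower 2 a * Rpower t a).
  { unfold Rpower. rewrite <- exp_plus, ln_mult by lra. f_equal. ring. }
  assert (Et : Rpower t (-1 + kappa + eps) = / t * Rpower t a).
  { replace (-1 + kappa + eps) with (-1 + a) by (unfold a; ring). rewrite Rpower_plus. f_equal.
    replace (-1) with (- (1)) by ring. rewrite Rpower_Ropp, Rpower_1; lra. }
  rewrite E2, Et.
  assert (Hta : 1 <= Rpower t a) by (rewrite <- exp_0; apply exp_le; apply Rmult_le_pos; lra).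
  assert (Hit1 : / t <= 1) by (rewrite <- Rinv_1; apply Rinv_le_contravar; lra).
  set (A := Rpower t a) in *. set (B := Ka * Rpower 2 a).
  replace (17280000 / t + 4200000000 / t + / 4 * / t * (10000 / t + 256 * (Ka * (Rpower 2 a * A))) + 80000 / t)
    with (/ t * (4217360000 + 2500 * / t + 64 * (B * A))) by (unfold B; field; lra).
  replace ((4300000000 + 64 * B) * (/ t * A)) with (/ t * (4300000000 * A + 64 * (B * A))) by ring.
  apply Rmult_le_compat_l; [lra|]. lra.
Qed.

Theorem mainTheorem5 :
  forall eps sigma : R, 0 < eps < 1 -> 0 < sigma < 2 ->
    approx_with_error sigma (- (5 / 6) + eps) /\
    (Lindelof_hypothesis -> approx_with_error sigma (- 1 + eps)).
Proof.
  intros eps sigma He Hs. split.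
  - replace (- (5 / 6) + eps) with (-1 + 1 / 6 + eps) by field.
    apply approx_of_critical_line_bound; try lra. apply critical_line_bound_weyl.
  - intros HL. replace (- 1 + eps) with (-1 + 0 + eps) by ring.
    apply approx_of_critical_line_bound; try lra.
    intros d Hd. destruct (HL d Hd) as [K [T [HT H]]]. exists K, T. split; auto.
    intros t Ht. assert (Ht' := H t). rewrite Rabs_pos_eq in Ht' by lra.
    replace (0 + d) with d by ring. apply Ht'. lra.
Qed.
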